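(* Let $n\geq 2$, let $V\subset\mathbb{R}^n$ be a nonempty open set, and let $d\in\mathbb{N}$ be odd such that $0<d<n$. If $f\in C_\infty(\mathbb{R}^n)$ satisfies $f|_V=0$ and $R_df(A)=0$ for all $d$-planes $A$ intersecting $V$, then $f=0$. The claim holds also for $f\in\mathcal{E}'(\mathbb{R}^n)$ when the assumption that $R_df=0$ for all $d$-planes intersecting $V$ is understood in the sense of distributions, i.e. $\langle R_df,\varphi\rangle=0$ for all $\varphi\in C_c^\infty(\mathbf{P}^d_V)$.
   Context: $\mathcal{E}'(\mathbb{R}^n)$ is the space of compactly supported distributions. $C_\infty(\mathbb{R}^n)$ is the space of continuous functions $f$ on $\mathbb{R}^n$ such that $(1+|x|^2)^{N/2}f(x)$ is bounded for every $N\in\mathbb{N}$. Let $\mathbf{P}^d$ be the space of all $d$-dimensional affine planes in $\mathbb{R}^n$ and $\mathbf{P}^d_V\subset\mathbf{P}^d$ the set of those intersecting $V$. The $d$-plane transform of a function $f$ is $R_df(A)=\int_{x\in A}f(x)\,dm(x)$, $A\in\mathbf{P}^d$, with $m$ the $d$-dimensional Hausdorff measure on $A$; its adjoint is $R_d^*g(x)=\int_{A\ni x}g(A)\,d\mu(A)$ for functions $g$ on $\mathbf{P}^d$, with $\mu$ the rotation invariant (normalized) measure on the $d$-planes through $x$. For $f\in\mathcal{E}'(\mathbb{R}^n)$, $R_df\in\mathcal{E}'(\mathbf{P}^d)$ is defined by $\langle R_df,\psi\rangle=\langle f,R_d^*\psi\rangle$ for $\psi\in C^\infty(\mathbf{P}^d)$.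 When $V=B(0,R)$ is a ball, $\varphi\in C_c^\infty(\mathbf{P}^d_V)$ means that $\varphi$ is smooth and, for some $r<R$, $\varphi(A)=0$ for all $d$-planes $A$ at distance greater than $r$ from the origin. *)

(* Defs.v *)
From HB Require Import structures.
From mathcomp Require Import all_boot all_order all_algebra.
From mathcomp Require Import all_classical all_reals all_analysis.
From mathcomp Require Import complex.
Import Order.TTheory GRing.Theory Num.Theory.
Import numFieldNormedType.Exports.

Set Implicit Arguments.
Unset Strict Implicit.
Unset Printing Implicit Defensive.

Local Open Scope classical_set_scope.
Local Open Scope ring_scope.

Section Euclidean.
Context {R : realType} {n : nat}.

(* The library norm on 'rV[R]_n is the sup norm, hence this definition. *)
Definition enorm (x : 'rV[R]_n) : R := Num.sqrt (\sum_(i < n) x 0 i ^+ 2).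

Definition ediam (E : set 'rV[R]_n) : \bar R :=
  ereal_sup [set (enorm (xy.1 - xy.2))%:E | xy in E `*` E].

End Euclidean.

Section Hausdorff.
Local Open Scope ereal_scope.
Context {R : realType} {n : nat}.
Variable k : nat.

(* Lebesgue volume of the unit ball of R^k, by
   omega_(k+2) = 2 pi / (k + 2) * omega_k. *)
Fixpoint ball_volume (k : nat) : R :=
  match k with
  | 0%N => 1
  | 1%N => 2
  | k'.+2 => 2 * pi / k'.+2%:R * ball_volume k'
  end.

(* With this normalization the k-dimensional Hausdorff measure on a k-plane is
   Lebesgue measure. The value +oo excludes covers by sets of diameter larger
   than delta. *)
Definition hausdorff_gauge (delta : R) (E : set 'rV[R]_n) : \bar R :=
  if `[< E = set0 >] then 0
  else if ediam E <= delta%:E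
  then (ball_volume k / 2 ^+ k)%:E * ediam E ^+ k
  else +oo.

(* The sigma-algebra generated by all subsets makes mu_ext range over all
   countable covers. *)
Definition hausdorff_approx (delta : R) : set 'rV[R]_n -> \bar R :=
  @mu_ext _ (g_sigma_algebraType [set: set 'rV[R]_n]) R (hausdorff_gauge delta).

Definition hausdorff (E : set 'rV[R]_n) : \bar R :=
  ereal_sup [set hausdorff_approx delta E | delta in [set delta : R | (0 < delta)%R]].

Lemma ball_volume_ge0 j : (0 <= ball_volume j)%R.
Proof.
suff : ((0 <= ball_volume j) && (0 <= ball_volume j.+1))%R by case/andP.
elim: j => [|j /andP[IH1 IH2]]; first by rewrite /= ler01 ler0n.
by rewrite IH2 /= mulr_ge0 // divr_ge0 // mulr_ge0 // pi_ge0.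
Qed.

Lemma ediam_ge0 (E : set 'rV[R]_n) : E !=set0 -> 0 <= ediam E.
Proof.
move=> [x Ex]; apply: ereal_sup_ubound; exists (x, x) => //=.
by rewrite /enorm subrr big1 ?sqrtr0 // => i _; rewrite mxE expr0n.
Qed.

Lemma hausdorff_gauge_ge0 delta E : 0 <= hausdorff_gauge delta E.
Proof.
rewrite /hausdorff_gauge; case: asboolP => // /eqP/set0P E0.
case: ifP => // _; apply: mule_ge0.
  by rewrite lee_fin divr_ge0 ?ball_volume_ge0 // exprn_ge0.
exact/expe_ge0/ediam_ge0.
Qed.

Lemma hausdorff_gauge0 delta : hausdorff_gauge delta set0 = 0.
Proof. by rewrite /hausdorff_gauge asboolT. Qed.

Lemma hausdorff0 : hausdorff set0 = 0.
Proof.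
apply/eqP; rewrite eq_le; apply/andP; split.
  apply: ge_ereal_sup => _ [delta _ <-].
  by rewrite /hausdorff_approx mu_ext0 //; [exact: hausdorff_gauge0|exact: hausdorff_gauge_ge0].
apply: (@le_trans _ _ (hausdorff_approx 1 set0)).
  exact/mu_ext_ge0/hausdorff_gauge_ge0.
by apply: ereal_sup_ubound; exists 1%R => //=; exact: ltr01.
Qed.

Lemma hausdorff_ge0 E : 0 <= hausdorff E.
Proof.
apply: (@le_trans _ _ (hausdorff_approx 1 E)).
  exact/mu_ext_ge0/hausdorff_gauge_ge0.
by apply: ereal_sup_ubound; exists 1%R => //=; exact: ltr01.
Qed.

Lemma le_hausdorff : {homo hausdorff : E F / E `<=` F >-> E <= F}.
Proof.
move=> E F EF; apply: ge_ereal_sup => _ [delta d0 <-].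
apply: (@le_trans _ _ (hausdorff_approx delta F)); first exact: le_mu_ext.
by apply: ereal_sup_ubound; exists delta.
Qed.

Lemma hausdorff_sigma_subadditive : sigma_subadditive hausdorff.
Proof.
move=> F; apply: ge_ereal_sup => _ [delta d0 <-].
apply: (@le_trans _ _ (\sum_(i <oo) hausdorff_approx delta (F i))).
  exact/mu_ext_sigma_subadditive/hausdorff_gauge_ge0.
apply: lee_nneseries => i *; first exact/mu_ext_ge0/hausdorff_gauge_ge0.
by apply: ereal_sup_ubound; exists delta.
Qed.

HB.instance Definition _ := isOuterMeasure.Build R 'rV[R]_n hausdorff
  hausdorff0 hausdorff_ge0 le_hausdorff hausdorff_sigma_subadditive.

Definition hausdorff_outer : {outer_measure set 'rV[R]_n -> \bar R} := hausdorff.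

(* The restriction to Caratheodory measurable sets is a measure. *)
Definition hausdorff_measure :
    {measure set (caratheodory_type hausdorff_outer) -> \bar R} :=
  (hausdorff_outer : set (caratheodory_type hausdorff_outer) -> \bar R).

End Hausdorff.

Section ComplexValued.
Context {R : realType}.

Definition cRe {T : Type} (f : T -> R[i]) : T -> R := fun x => complex.Re (f x).
Definition cIm {T : Type} (f : T -> R[i]) : T -> R := fun x => complex.Im (f x).

Definition cintegral d (T : measurableType d) (mu : {measure set T -> \bar R})
    (D : set T) (f : T -> R[i]) : R[i] :=
  Complex (\int[mu]_(x in D) cRe f x)%R (\int[mu]_(x in D) cIm f x)%R.

Definition ccontinuous {T : topologicalType} (f : T -> R[i]) : Prop :=
  continuous (cRe f) /\ continuous (cIm f).

Definition csupport {T : topologicalType} (f : T -> R[i]) : set T :=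
  closure [set x | f x != 0].

End ComplexValued.

Section Smooth.
Context {R : realType} {E : normedModType R}.

Definition iter_derive (vs : seq E) (f : E -> R) : E -> R :=
  foldr (fun v g => 'D_v g) f vs.

Definition smooth_on (O : set E) (f : E -> R) : Prop :=
  forall vs x, O x -> {for x, continuous (iter_derive vs f)} /\
    forall v, derivable (iter_derive vs f) x v.

Definition csmooth_on (O : set E) (f : E -> R[i]) : Prop :=
  smooth_on O (cRe f) /\ smooth_on O (cIm f).

End Smooth.

Section Functions.
Context {R : realType} {n : nat}.

Definition C_infty (f : 'rV[R]_n -> R[i]) : Prop :=
  ccontinuous f /\
  forall N : nat, exists B : R, forall x,
    (1 + enorm x ^+ 2) `^ (N%:R / 2) * ComplexField.Normc.normc (f x) <= B.

Definition smooth_fun (f : 'rV[R]_n -> R[i]) : Prop := csmooth_on setT f.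

Definition test_fun (V : set 'rV[R]_n) (f : 'rV[R]_n -> R[i]) : Prop :=
  [/\ smooth_fun f, compact (csupport f) & csupport f `<=` V].

Definition partial (alpha : seq 'I_n) (f : 'rV[R]_n -> R) : 'rV[R]_n -> R :=
  iter_derive [seq 'e_i | i <- alpha] f.

(* E'(R^n) as the dual of C^oo(R^n): linear forms u satisfying
   |u phi| <= C sup_(|alpha| <= N, x in K) |D^alpha phi (x)|.
   The values of u on functions that are not smooth are irrelevant. *)
Definition compact_distribution (u : ('rV[R]_n -> R[i]) -> R[i]) : Prop :=
  (forall (a : R[i]) phi psi, smooth_fun phi -> smooth_fun psi ->
     u (fun x => a * phi x + psi x) = a * u phi + u psi) /\
  exists (K : set 'rV[R]_n) (N : nat) (C : R), compact K /\
    forall phi (B : R), smooth_fun phi -> 0 <= B ->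
      (forall alpha x, (size alpha <= N)%N -> K x ->
         `|partial alpha (cRe phi) x| <= B /\
         `|partial alpha (cIm phi) x| <= B) ->
      ComplexField.Normc.normc (u phi) <= C * B.

End Functions.

Section Planes.
Context {R : realType} {n : nat}.
Variable d : 'I_n.

(* The plane through p spanned by the rows of M. *)
Definition plane_set (p : 'rV[R]_n) (M : 'M[R]_(d, n)) : set 'rV[R]_n :=
  [set p + t *m M | t in [set: 'rV[R]_d]].

Record dplane : Type := DPlane {
  dplane_set :> set 'rV[R]_n;
  dplaneP : exists p M, row_free M /\ dplane_set = plane_set p M }.

Lemma dplane_eq (A B : dplane) : dplane_set A = dplane_set B -> A = B.
Proof.
case: A B => [A PA] [B PB] /= AB; case: B / AB PB => PB.
by congr DPlane; exact: Prop_irrelevance.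
Qed.

Definition frame_set : set ('rV[R]_n * 'M[R]_(d, n)) :=
  [set pM | row_free pM.2].

Definition mk_dplane (p : 'rV[R]_n) (M : 'M[R]_(d, n)) (h : row_free M) :=
  @DPlane (plane_set p M) (ex_intro _ p (ex_intro _ M (conj h erefl))).

Definition frame_plane (F : set_type frame_set) : dplane :=
  mk_dplane (val F).1 (set_mem (valP F)).

HB.instance Definition _ := gen_eqMixin dplane.
HB.instance Definition _ := gen_choiceMixin dplane.

Lemma row_free_pid_mx : row_free (pid_mx d : 'M[R]_(d, n)).
Proof. by rewrite /row_free rank_pid_mx // ltnW. Qed.

HB.instance Definition _ := isPointed.Build dplane (mk_dplane 0 row_free_pid_mx).

(* The manifold topology: the quotient topology for frame_plane. *)
Definition dplane_open : set (set dplane) :=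
  [set U | open (frame_plane @^-1` U)].

Lemma dplane_openT : dplane_open setT.
Proof. by rewrite /dplane_open /= preimage_setT; exact: openT. Qed.

Lemma dplane_openI : setI_closed dplane_open.
Proof. by move=> U W oU oW; rewrite /dplane_open /= preimage_setI; exact: openI. Qed.

Lemma dplane_open_bigU (I : Type) (F : I -> set dplane) :
  (forall i, dplane_open (F i)) -> dplane_open (\bigcup_i F i).
Proof.
move=> oF; rewrite /dplane_open /= preimage_bigcup.
by apply: bigcup_open => i _; exact: oF.
Qed.

HB.instance Definition _ := isOpenTopological.Build dplane
  dplane_openT dplane_openI dplane_open_bigU.

Definition borel_dplane := g_sigma_algebraType (@open dplane).

Definition frame_pullback (phi : dplane -> R[i])
    (pM : 'rV[R]_n * 'M[R]_(d, n)) : R[i] :=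
  if pselect (row_free pM.2) is left h then phi (mk_dplane pM.1 h) else 0.

(* frame_plane is a surjective submersion from an open subset of a vector
   space, so a function on the manifold of d-planes is smooth if and only if
   its pullback is. *)
Definition dplane_smooth (phi : dplane -> R[i]) : Prop :=
  csmooth_on frame_set (frame_pullback phi).

Definition planes_meeting (V : set 'rV[R]_n) : set dplane :=
  [set A | dplane_set A `&` V !=set0].

Definition dplane_test_fun (V : set 'rV[R]_n) (phi : dplane -> R[i]) : Prop :=
  [/\ dplane_smooth phi, compact (csupport phi) & csupport phi `<=` planes_meeting V].

Lemma translate_subproof (x : 'rV[R]_n) (A : dplane) :
  exists p M, row_free M /\
    [set x + y | y in dplane_set A] = @plane_set p M.
Proof.
have [p [M [hM ->]]] := dplaneP A; exists (x + p), M; split => //.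
apply/seteqP; split => [_ [_ [t _ <-] <-]|_ [t _ <-]].
  by exists t => //; rewrite addrA.
by exists (p + t *m M); [exists t | rewrite addrA].
Qed.

Definition translate (x : 'rV[R]_n) (A : dplane) : dplane :=
  DPlane (translate_subproof x A).

Definition planes_through (x : 'rV[R]_n) : set dplane := [set A | dplane_set A x].

Definition rotate_set (Q : 'M[R]_n) (S : set dplane) : set dplane :=
  [set A | exists2 L, S L & dplane_set A = [set y *m Q | y in dplane_set L]].

(* The normalized rotation invariant measure on the d-planes through the
   origin; it is unique. *)
Definition invariant_measure (mu : probability borel_dplane R) : Prop :=
  mu (planes_through 0) = 1%E /\
  forall Q : 'M[R]_n, Q *m Q^T = 1%:M -> \det Q = 1 ->
    forall S : set borel_dplane, measurable S -> mu (rotate_set Q S) = mu S.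

Definition dplane_transform (f : 'rV[R]_n -> R[i]) (A : dplane) : R[i] :=
  cintegral (@hausdorff_measure R n d) (dplane_set A) f.

(* The measure on the d-planes through x is the image under translation by x of
   the measure on the d-planes through the origin. *)
Definition adjoint_transform (mu : probability borel_dplane R)
    (g : dplane -> R[i]) (x : 'rV[R]_n) : R[i] :=
  cintegral mu (planes_through 0) (fun L : borel_dplane => g (translate x L)).

Definition dist_transform (mu : probability borel_dplane R)
    (u : ('rV[R]_n -> R[i]) -> R[i]) : (dplane -> R[i]) -> R[i] :=
  fun psi => u (adjoint_transform mu psi).

End Planes.

(* Main.v *)
Require Import Defs.
From HB Require Import structures.
From mathcomp Require Import all_boot all_order all_algebra.
From mathcomp Require Import all_classical all_reals all_analysis.
From mathcomp Require Import measurable_realfun complex ring lra zify.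
Import Order.TTheory GRing.Theory Num.Theory.
Import numFieldNormedType.Exports.

Local Open Scope classical_set_scope.
Local Open Scope ring_scope.

(** Let d be odd, and consider first a function f that vanishes near x0 and whose
    integrals over the d-planes meeting a neighbourhood of x0 vanish. For x near x0
    and a bump b of small support, the function A |-> b (dist(x, A)^2 / l) on the
    space of d-planes is supported in the planes meeting that neighbourhood. Its
    adjoint transform is a radial function: a random projection argument shows
    that, up to a constant, its value at y is
      radial_avg p q b (|y - x|^2 / l)
        = int_0^(pi/2) b (|y - x|^2 / l * sin t ^ 2) sin t ^ p cos t ^ q dt
    with p = n - d - 1 and q = d - 1 ([projection_average]). So f is orthogonal to
    these radial functions, for all small l and all x near x0.

    For y away from x the radial function has an expansion in half-integer powers
    of l, whose terms are multiples of |y - x|^-(p + 1 + 2 i). As d is odd,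
    cos t ^ q dt is (1 - s)^((q - 1) / 2) times a power of s = sin t ^ 2 and ds,
    with an exponent that is not an integer, and no coefficient of the expansion
    vanishes ([radial_avg_asymptotics]). Hence f, which vanishes near x, is
    orthogonal to all the functions |y - x|^-(p + 1 + 2 i). By Weierstrass's
    theorem in the variable 1 / |y - x|^2 these span enough to reach the Gaussians
    centred at x ([radial_kill]). The integral of f against a Gaussian is analytic
    in the centre, so it vanishes for all centres, and narrow Gaussians give f = 0
    ([radial_orthogonal_eq0]).

    For functions, one may restrict f to a (d + 1)-plane through x0 and a given
    point; the average over planes then becomes an average over their normal
    lines, and Fubini's theorem for each line applies ([rapid_slices_eq0],
    [function_case]). This uses that the Hausdorff measure of a plane is a multiple
    of Lebesgue measure ([ge0_integral_plane]), which follows from the uniqueness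
    of translation invariant measures.

    For a distribution u, the real and imaginary parts of u on real functions are
    linear forms L of compact support, and the bump on the space of planes is a
    legitimate test function ([plane_bump_test]): it is smooth since the squared
    distance is a rational function of a frame, and compactly supported since the
    orthonormal frames near x form a compact set. Thus L vanishes on the radial
    functions above. Mollification of L gives a continuous function of compact
    support to which [radial_orthogonal_eq0] applies, so all mollifications
    vanish, and L = 0 ([functional_eq0]). *)

Set Implicit Arguments.
Unset Strict Implicit.
Unset Printing Implicit Defensive.

(** * Row vectors and Lebesgue measure *)


Lemma measurable_preimageT d d' (T : measurableType d) (U : measurableType d')
    (f : T -> U) (A : set U) :
  measurable_fun setT f -> measurable A -> measurable (f @^-1` A).
Proof. by move=> mf mA; rewrite -[X in measurable X]setTI; exact: mf. Qed.

HB.lock Definition rVcons {R : realType} n (x : R) (v : 'rV[R]_n) : 'rV[R]_n.+1 :=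
  row_mx x%:M v.
Arguments rVcons {R n} x v.

Section RowVectors.
Context {R : realType}.

Lemma coord_le_norm n (x : 'rV[R]_n) i : `|x 0 i| <= `|x|.
Proof.
rewrite [leRHS]/Num.norm /= mx_normrE.
by apply/bigmax_geP; right => /=; exists (ord0, i).
Qed.

Lemma norm_rV_le n (x : 'rV[R]_n) c :
  0 <= c -> (forall i, `|x 0 i| <= c) -> `|x| <= c.
Proof.
move=> c0 xc; rewrite [leLHS]/Num.norm /= mx_normrE; apply/bigmax_leP; split => //.
by move=> -[i j] _ /=; rewrite ord1.
Qed.

Definition borel_rV (n : nat) := g_sigma_algebraType (@open 'rV[R]_n).

Lemma open_borel_rV n (U : set 'rV[R]_n) :
  open U -> measurable (U : set (borel_rV n)).
Proof. by move=> oU; exact: sub_sigma_algebra. Qed.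

Lemma closed_borel_rV n (U : set 'rV[R]_n) :
  closed U -> measurable (U : set (borel_rV n)).
Proof.
move=> cU; rewrite -[U]setCK; apply: measurableC; apply: open_borel_rV.
exact: closed_openC.
Qed.

Lemma continuous_measurable_rV n (f : 'rV[R]_n -> R) :
  continuous f -> measurable_fun setT (f : borel_rV n -> R).
Proof.
move=> cf; apply: (measurability _ (RGenOpens.measurableE R)).
move=> _ [_ [a [b ->]] <-]; rewrite setTI; apply: open_borel_rV.
by apply: open_comp => [x _|]; [exact: cf|exact: interval_open].
Qed.

(** Rational cubes form a countable basis, so that coordinates generate the
    Borel sigma-algebra. *)
Lemma measurable_fun_rV d (T : measurableType d) n (F : T -> 'rV[R]_n) :
  (forall i, measurable_fun setT (fun x => F x 0 i)) ->
  measurable_fun setT (F : T -> borel_rV n).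
Proof.
move=> mF; apply: (@measurability _ _ _ (g_sigma_algebraType (@open 'rV[R]_n)) setT F
  (@open 'rV[R]_n)) => //.
move=> _ [U oU <-]; rewrite setTI.
pose q2r (q : 'rV[rat]_n) : 'rV[R]_n := \row_i ratr (q 0 i).
pose I := [set qk : 'rV[rat]_n * nat | ball (q2r qk.1) qk.2.+1%:R^-1 `<=` U].
have -> : F @^-1` U = \bigcup_(qk in I) F @^-1` (ball (q2r qk.1) qk.2.+1%:R^-1).
  apply/seteqP; split => [x /= Ux|x [qk Iqk] Fx]; last exact: Iqk.
  move: (oU); rewrite openE => /(_ _ Ux) /nbhs_ballP[e /= e0 eU].
  have [k ke] : exists k : nat, (k.+1%:R^-1 : R) < e / 2.
    have /cvgrPdist_lt/(_ (e / 2)) := @cvg_harmonic R.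
    rewrite divr_gt0 // => /(_ isT)[k _ /(_ k (leqnn k))] /=.
    by rewrite sub0r normrN ger0_norm //; exists k.
  have k0 : 0 < (k.+1%:R^-1 : R) by rewrite invr_gt0.
  have /choice[q qP] : forall i, exists q : rat, `|F x 0 i - ratr q| < (k.+1%:R^-1 : R).
    move=> i; have : F x 0 i - k.+1%:R^-1 < F x 0 i + k.+1%:R^-1.
      by rewrite ltrBlDr -addrA ltrDl addr_gt0.
    move=> /rat_in_itvoo[q]; rewrite in_itv /= => /andP[q1 q2]; exists q.
    by rewrite ltr_distlC q1 q2.
  have qx : ball (q2r (\row_i q i)) k.+1%:R^-1 (F x).
    split => // i j; rewrite ord1 !mxE /ball /= distrC; exact: qP.
  exists (\row_i q i, k) => //= y yb; apply: eU.
  apply: (@le_ball _ _ _ (k.+1%:R^-1 + k.+1%:R^-1)).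
    by rewrite (splitr e) ltW // ltrD.
  by apply: ball_triangle yb; exact: ball_sym.
rewrite bigcup_mkcond; apply: countable_bigcupT_measurable => // -[q k].
case: ifPn => //= _.
have -> : F @^-1` ball (q2r q) k.+1%:R^-1 =
    \bigcap_(i in [set: 'I_n])
      [set x | ball (ratr (q 0 i) : R) k.+1%:R^-1 (F x 0 i)].
  apply/seteqP; split => [x [_ xq] i _ /=|x xq].
    by have := xq 0 i; rewrite mxE.
  split; first by rewrite invr_gt0.
  by move=> i j; rewrite ord1 mxE; exact: xq.
apply: fin_bigcap_measurable => // i _.
have := mF i measurableT (ball (ratr (q 0 i) : R) k.+1%:R^-1).
by rewrite setTI; apply; exact: measurable_ball.
Qed.

Lemma rVcons0 n x (v : 'rV[R]_n) : rVcons x v 0 0 = x.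
Proof.
rewrite unlock; have -> : 0 = lshift n (0 : 'I_1) by exact/val_inj.
by apply: etrans (row_mxEl _ _ _ _) _; rewrite mxE mulr1n.
Qed.

Lemma rVconsS n x (v : 'rV[R]_n) j : rVcons x v 0 (lift ord0 j) = v 0 j.
Proof.
rewrite unlock; have -> : lift ord0 j = rshift 1 j by exact/val_inj.
exact: row_mxEr.
Qed.

Lemma mul_rVcons n m x (v : 'rV[R]_n) (w : 'rV[R]_m) (M : 'M[R]_(n, m)) :
  rVcons x v *m (col_mx w M : 'M[R]_(n.+1, m)) = x *: w + v *m M.
Proof. by rewrite unlock -mul_scalar_mx; apply: (@mul_row_col R 1 1 n m). Qed.

Definition rVcons_pair n (xv : measurableTypeR R * borel_rV n) : borel_rV n.+1 :=
  rVcons xv.1 xv.2.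

Lemma rVcons_rowP n (y : 'rV[R]_n.+1) :
  rVcons (y 0 0) (\row_j y 0 (lift ord0 j)) = y.
Proof.
apply/rowP => i; have [j ->|->] := unliftP ord0 i; last by rewrite rVcons0.
by rewrite rVconsS mxE.
Qed.

Lemma measurable_coord n i : measurable_fun setT (fun x : borel_rV n => x 0 i).
Proof.
by apply: continuous_measurable_rV; exact: coord_continuous.
Qed.

Lemma measurable_rVcons n : measurable_fun setT (@rVcons_pair n).
Proof.
rewrite /rVcons_pair; apply: measurable_fun_rV => i.
have [j ->|->] := unliftP ord0 i; last first.
  by under eq_fun do rewrite rVcons0; exact: measurable_fst.
under eq_fun do rewrite rVconsS.
by apply: (measurableT_comp (measurable_coord j)); exact: measurable_snd.
Qed.

Lemma measurable_norm_le n (r : R) :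
  measurable ([set x | `|x| <= r] : set (borel_rV n)).
Proof.
have := @continuous_measurable_rV n (fun x => `|x|) (@norm_continuous _ _).
move=> /(_ measurableT `]-oo, r]%classic); rewrite setTI; apply.
exact: measurable_itv.
Qed.

Lemma bigcup_norm_le n : \bigcup_(k : nat) [set x : 'rV[R]_n | `|x| <= k%:R] = setT.
Proof.
rewrite -subTset => x _; exists (Num.trunc `|x|).+1 => //=.
by rewrite ltW // truncnS_gt.
Qed.

Lemma sigma_finite_rV n (m : set (borel_rV n) -> \bar R) :
  (forall k : nat, (m [set x | `|x| <= k%:R]%R < +oo)%E) -> sigma_finite setT m.
Proof.
move=> mk; exists (fun k : nat => [set x | `|x| <= k%:R]).
  by rewrite bigcup_norm_le.
by move=> k; split; [exact: measurable_norm_le|exact: mk].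
Qed.

Section Step.
Variables (n : nat) (m : {sigma_finite_measure set (borel_rV n) -> \bar R}).

Definition lebesgue_step : set (borel_rV n.+1) -> \bar R :=
  pushforward (lebesgue_measure \x m)%E
    (@rVcons_pair n).


Let measurable_step (A : set (borel_rV n.+1)) : measurable A ->
  measurable ((@rVcons_pair n) @^-1` A).
Proof. by move=> mA; rewrite -[X in measurable X]setTI; exact: measurable_rVcons. Qed.

Let step0 : lebesgue_step set0 = 0%E.
Proof. by rewrite /lebesgue_step /pushforward preimage_set0 measure0. Qed.

Let step_ge0 A : (0 <= lebesgue_step A)%E.
Proof. by rewrite /lebesgue_step /pushforward. Qed.

Let step_sigma_additive : semi_sigma_additive lebesgue_step.
Proof.
move=> F mF tF mUF; rewrite /lebesgue_step /pushforward preimage_bigcup.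
apply: measure_semi_sigma_additive.
- by move=> k; exact: measurable_step.
- apply/trivIsetP => /= i j _ _ ij; rewrite -preimage_setI.
  by move/trivIsetP : tF => /(_ _ _ _ _ ij) ->//; rewrite preimage_set0.
- by rewrite -preimage_bigcup; exact: measurable_step.
Qed.

HB.instance Definition _ := isMeasure.Build _ _ _
  lebesgue_step step0 step_ge0 step_sigma_additive.

Let step_sigma_finite : sigma_finite setT lebesgue_step.
Proof.
have /sigma_finiteP[G [GT ndG Goo]] := sigma_finiteT m.
pose I k : set R := `[- (k%:R), k%:R]%classic.
exists (fun k => [set y : 'rV[R]_n.+1 | I k (y 0 0) /\ G k (\row_j y 0 (lift ord0 j))]).
  apply/seteqP; split => // y _.
  have : [set: borel_rV n] (\row_j y 0 (lift ord0 j)) by [].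
  rewrite GT => -[k _ Gk]; pose l := (Num.trunc `|y 0 0|).+1.
  exists (maxn k l) => //; split; last first.
    by move: Gk; apply/subsetPset/ndG; exact: leq_maxl.
  rewrite /I /= in_itv /= -ler_norml (@le_trans _ _ l%:R) ?ler_nat ?leq_maxr //.
  by rewrite ltW // truncnS_gt.
move=> k; have [mG Gk] := Goo k.
have mI : measurable (I k : set (measurableTypeR R)) by exact: measurable_itv.
have E : @rVcons_pair n @^-1`
    [set y : 'rV[R]_n.+1 | I k (y 0 0) /\ G k (\row_j y 0 (lift ord0 j))] = I k `*` G k.
  apply/seteqP; split => -[x v] /=; rewrite /rVcons_pair /= rVcons0;
    by rewrite (_ : \row__ _ = v) //; apply/rowP => j; rewrite mxE rVconsS.
split; last first.
  rewrite /lebesgue_step /pushforward E product_measure1E // lte_mul_pinfty //.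
    suff : lebesgue_measure (I k : set (measurableTypeR R)) \is a fin_num by [].
    by rewrite lebesgue_measure_itv; case: ifP.
apply: measurableI.
  exact: (measurable_preimageT (measurable_coord 0) mI).
have mg : measurable_fun setT (fun y : borel_rV n.+1 =>
    \row_j y 0 (lift ord0 j) : borel_rV n).
  by apply: measurable_fun_rV => j; under eq_fun do rewrite mxE; exact: measurable_coord.
exact: (measurable_preimageT mg mG).
Qed.

HB.instance Definition _ := Measure_isSigmaFinite.Build _ _ _ lebesgue_step step_sigma_finite.
End Step.

(** Lebesgue measure on row vectors, the first coordinate being integrated last. *)
Fixpoint lebesgue_rV n : {sigma_finite_measure set (borel_rV n) -> \bar R} :=
  match n with
  | 0 => \d_(0 : borel_rV 0)
  | k.+1 => lebesgue_step (lebesgue_rV k)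
  end.

Local Open Scope ereal_scope.
Lemma ge0_integral_lebesgue_rVS n (f : 'rV[R]_n.+1 -> \bar R) :
  measurable_fun setT (f : borel_rV n.+1 -> _) -> (forall y, 0 <= f y) ->
  \int[lebesgue_rV n.+1]_y f y =
  \int[lebesgue_measure]_x \int[lebesgue_rV n]_v f (rVcons x v).
Proof.
move=> mf f0 /=.
rewrite [LHS](@ge0_integral_pushforward _ _ _ _ _ _ (@measurable_rVcons n)) //.
rewrite preimage_setT fubini_tonelli1 //.
by apply: measurableT_comp => //; exact: measurable_rVcons.
by move=> -[x v]; exact: f0.
Qed.

End RowVectors.

Section Lebesgue1.
Context {R : realType}.
Local Open Scope ereal_scope.

Lemma lebesgue_measure_affine (c a : R) (A : set R) : (0 < c)%R -> measurable A ->
  lebesgue_measure ((fun x => c * x + a)%R @^-1` A) = c^-1%:E * lebesgue_measure A.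
Proof.
move=> c0 mA.
have mf : measurable_fun setT ((fun x => c * x + a)%R : measurableTypeR R -> measurableTypeR R).
  by apply: measurable_funD => //; exact: measurable_funM.
pose P : {measure set (measurableTypeR R) -> \bar R} :=
  measure_function_pushforward__canonical__measure_function_Measure lebesgue_measure mf.
pose Q := mscale (NngNum (ltW c0)) P.
suff -> : lebesgue_measure A = Q A.
  by rewrite /Q /mscale /= muleA -EFinM mulVf ?gt_eqF // mul1e.
apply: lebesgue_measure_unique => // _ [[u v] _ <-] /=.
rewrite /Q /mscale /P /= /pushforward.
have -> : (fun x => c * x + a)%R @^-1` `]u, v]%classic = `](u - a) / c, (v - a) / c]%classic%R.
  apply/seteqP; split => x /=; rewrite !in_itv /= ltr_pdivrMr // ler_pdivlMr // mulrC ltrBlDr lerBrDr //.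
rewrite !lebesgue_measure_itv /= !lte_fin ltr_pM2r ?invr_gt0 // ltrD2r.
case: ifPn => uv; last by rewrite mule0.
by rewrite -!EFinD -EFinM; congr EFin; field; rewrite gt_eqF.
Qed.

Lemma ge0_integral_lebesgue_affine (c a : R) (f : R -> \bar R) : (0 < c)%R ->
  measurable_fun setT f -> (forall x, 0 <= f x) ->
  \int[lebesgue_measure]_x f (c * x + a)%R = c^-1%:E * \int[lebesgue_measure]_x f x.
Proof.
move=> c0 mf f0.
have mg : measurable_fun setT ((fun x => c * x + a)%R : measurableTypeR R -> measurableTypeR R).
  by apply: measurable_funD => //; exact: measurable_funM.
have := @ge0_integral_pushforward _ _ _ _ _ _ mg (@lebesgue_measure R) setT f measurableT mf.
rewrite preimage_setT => <- //.
have ci0 : (0 <= c^-1)%R by rewrite invr_ge0 ltW.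
rewrite -(@ge0_integral_mscale _ _ _ lebesgue_measure setT measurableT (NngNum ci0)) //.
apply: eq_measure_integral => A mA _ /=; rewrite /pushforward lebesgue_measure_affine //.
Qed.

Lemma ge0_integral_lebesgueN (f : R -> \bar R) :
  measurable_fun setT f -> (forall x, 0 <= f x) ->
  \int[lebesgue_measure]_x f (- x)%R = \int[lebesgue_measure]_x f x.
Proof.
move=> mf f0.
have mg : measurable_fun setT (-%R : measurableTypeR R -> measurableTypeR R) by [].
have := @ge0_integral_pushforward _ _ _ _ _ _ mg (@lebesgue_measure R) setT f measurableT mf.
rewrite preimage_setT => <- //.
by apply: eq_measure_integral => A mA _ /=; exact: lebesgue_measureN.
Qed.

Lemma lebesgue_measure_segment (a b : R) : (a <= b)%R ->
  lebesgue_measure (`[a, b]%classic : set R) = (b - a)%:E.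
Proof.
move=> ab; rewrite lebesgue_measure_itv /= lte_fin -EFinD.
by case: ltP => // ba; rewrite (@le_anti _ _ a b) ?subrr // ab ba.
Qed.

End Lebesgue1.

Section LebesgueRowVectors.
Context {R : realType}.
Local Open Scope ereal_scope.
Notation lam := (@lebesgue_rV R).

Lemma rVcons_affine n (c x y : R) (v w : 'rV[R]_n) :
  (c *: rVcons x v + rVcons y w = rVcons (c * x + y) (c *: v + w))%R.
Proof.
apply/rowP => i; rewrite !mxE; have [j ->|->] := unliftP ord0 i.
  by rewrite !rVconsS !mxE.
by rewrite !rVcons0.
Qed.

Lemma measurable_section n (A : set (@borel_rV R n.+1)) (x : R) :
  measurable A -> measurable ([set v | A (rVcons x v)] : set (borel_rV n)).
Proof.
move=> mA; apply: (measurable_preimageT _ mA).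
by apply: (measurable_fun_pair2 (f:=@rVcons_pair R n)); exact: measurable_rVcons.
Qed.

Lemma measurable_lebesgue_section n (A : set (@borel_rV R n.+1)) : measurable A ->
  measurable_fun setT (fun x : measurableTypeR R => lam n [set v | A (rVcons x v)]).
Proof.
move=> mA; have := measurable_preimageT (@measurable_rVcons R n) mA.
move=> /(measurable_fun_xsection (lam n)); apply: eq_measurable_fun => x _.
by rewrite /= /xsection; congr (lam n _); apply/seteqP; split => v /=; rewrite inE.
Qed.

Lemma lebesgue_rVS n (A : set (@borel_rV R n.+1)) :
  lam n.+1 A = \int[lebesgue_measure]_x lam n [set v | A (rVcons x v)].
Proof.
apply: eq_integral => x _ /=; congr (lam n _).
by apply/seteqP; split => v /=; rewrite /xsection /= inE.
Qed.

Lemma lebesgue_rV0 (A : set (@borel_rV R 0)) : A 0%R -> lam 0 A = 1.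
Proof. by move=> A0; rewrite /= diracE mem_set. Qed.

Lemma lebesgue_rV_affine n (c : R) (a : 'rV[R]_n) (A : set (@borel_rV R n)) :
  (0 < c)%R -> measurable A ->
  lam n ((fun y => c *: y + a)%R @^-1` A) = (c^-1 ^+ n)%:E * lam n A.
Proof.
move=> c0; elim: n a A => [|n IH] a A mA.
  rewrite expr0 mul1e; congr (lam 0 _); apply/seteqP; split => y /=;
    by rewrite (thinmx0 y) (thinmx0 a) (thinmx0 (_ + _)%R).
rewrite !lebesgue_rVS.
pose g x := lam n [set v | A (rVcons x v)].
rewrite -{1}(rVcons_rowP a); set a0 := (a 0 0)%R; set a1 := (\row__ _)%R.
under eq_integral => x _.
  rewrite (_ : [set v | _] = (fun v => c *: v + a1)%R @^-1`
    [set v | A (rVcons (c * x + a0) v)]%R); last first.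
    by apply/seteqP; split => v /=; rewrite rVcons_affine.
  rewrite IH; last exact: measurable_section.
  over.
have cn0 k : (0 <= c^-1 ^+ k)%R by rewrite exprn_ge0 // invr_ge0 ltW.
have mg := measurable_lebesgue_section mA.
rewrite ge0_integralZl //=; last 2 first.
- apply: (measurableT_comp mg).
  by apply: measurable_funD => //; exact: measurable_funM.
- by rewrite lee_fin.
rewrite (@ge0_integral_lebesgue_affine _ c a0 g) // muleA -EFinM.
by rewrite exprSr.
Qed.

Lemma lebesgue_rV_translation n (a : 'rV[R]_n) (A : set (@borel_rV R n)) :
  measurable A -> lam n ((fun y => y + a)%R @^-1` A) = lam n A.
Proof.
move=> mA; have := lebesgue_rV_affine a (@ltr01 R) mA.
rewrite invr1 expr1n mul1e => <-; congr (lam n _).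
by apply/seteqP; split => y /=; rewrite scale1r.
Qed.

Lemma lebesgue_rVN n (A : set (@borel_rV R n)) :
  measurable A -> lam n ((fun y => - y)%R @^-1` A) = lam n A.
Proof.
elim: n A => [|n IH] A mA.
  by congr (lam 0 _); apply/seteqP; split => y /=; rewrite (thinmx0 y) oppr0.
rewrite !lebesgue_rVS.
under eq_integral => x _.
  rewrite (_ : [set v | _] = (fun v => - v)%R @^-1` [set v | A (rVcons (- x) v)]%R); last first.
    have oppE v : (- rVcons x v = rVcons (- x) (- v))%R.
      by apply/rowP => i; rewrite mxE; have [j ->|->] := unliftP ord0 i;
        rewrite ?rVconsS ?mxE ?rVcons0.
    by apply/seteqP; split => v /=; rewrite oppE.
  rewrite IH; last exact: measurable_section.
  over.
rewrite (@ge0_integral_lebesgueN _ (fun x => lam n [set v | A (rVcons x v)])) //.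
exact: measurable_lebesgue_section.
Qed.

Definition cube n (r : R) : set 'rV[R]_n := [set x | `|x| <= r]%R.
Arguments cube : clear implicits.

Lemma lebesgue_cube n (r : R) : (0 <= r)%R -> lam n (cube n r) = ((2 * r) ^+ n)%:E.
Proof.
move=> r0; elim: n => [|n IH].
  by rewrite lebesgue_rV0 // /cube /= normr0.
rewrite lebesgue_rVS (_ : (fun x => _) = fun x => lam n (cube n r) * (\1_(`[(- r)%R, r]%classic) x)%:E).
  rewrite IH ge0_integralZl //=; last 2 first.
  - by apply/measurable_EFinP; apply: measurable_indic; exact: measurable_itv.
  - by rewrite lee_fin exprn_ge0 // mulr_ge0.
  rewrite (@integral_indic _ (measurableTypeR R) _ _ setT measurableT) //.
  rewrite setIT exprSr EFinM; congr (_ * _).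
  apply: etrans (lebesgue_measure_segment _) _; first lra.
  by congr EFin; lra.
apply/funext => x; rewrite indicE mem_setE in_itv /= -ler_norml.
have E : cube n.+1 r `&` [set y | y 0 0 = x]%R = set0 -> True by [].
have [xr|xr] := leP.
  rewrite mule1; congr (lam n _); apply/seteqP; split => v; rewrite /cube /= => H.
    apply: norm_rV_le => // j; rewrite -(rVconsS x v j).
    exact: le_trans (coord_le_norm _ _) H.
  apply: norm_rV_le => // i; have [j ->|->] := unliftP ord0 i; rewrite ?rVcons0 // rVconsS.
  exact: le_trans (coord_le_norm _ _) H.
rewrite mule0 -[RHS](measure0 (lam n)); congr (lam n _); apply/seteqP; split => v //=.
rewrite /cube /= => H; have := le_trans (coord_le_norm (rVcons x v) 0%R) H.
by rewrite rVcons0 leNgt xr.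
Qed.

End LebesgueRowVectors.
Arguments cube {R} n r.

Section TranslationInvariance.
Context {R : realType}.
Local Open Scope ereal_scope.
Notation lam := (@lebesgue_rV R).

Lemma measurable_rV_add n : measurable_fun setT
  (fun xy : borel_rV n * borel_rV n => (xy.1 + xy.2)%R : @borel_rV R n).
Proof.
apply: measurable_fun_rV => i; under eq_fun do rewrite mxE.
by apply: measurable_funD; apply: (measurableT_comp (measurable_coord i)).
Qed.

Lemma measurable_rV_sub n : measurable_fun setT
  (fun xy : borel_rV n * borel_rV n => (xy.1 - xy.2)%R : @borel_rV R n).
Proof.
apply: measurable_fun_rV => i; under eq_fun do rewrite !mxE.
by apply: measurable_funB; apply: (measurableT_comp (measurable_coord i)).
Qed.

Section SigmaFinite.
Variables (n : nat) (m : {measure set (@borel_rV R n) -> \bar R}).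
Hypothesis mk : forall k : nat, m (cube n k%:R) < +oo.

Definition locally_finite (_ : forall k : nat, m (cube n k%:R) < +oo) :
  set (@borel_rV R n) -> \bar R := m.
HB.instance Definition _ := Measure.on (locally_finite mk).
HB.instance Definition _ := Measure_isSigmaFinite.Build _ _ _ (locally_finite mk)
  (sigma_finite_rV mk).

End SigmaFinite.

(** Both sides are the measure, for [m \x lam], of the pairs (x, y) with
    x in B and x + y in A: integrate y first, or translate x by - y first. *)
Lemma translation_invariant_unique n (m : {measure set (borel_rV n) -> \bar R})
    (A B : set (@borel_rV R n)) :
  (forall k : nat, m (cube n k%:R) < +oo) ->
  (forall a (A : set (borel_rV n)), measurable A -> m ((fun y => y + a)%R @^-1` A) = m A) ->
  measurable A -> measurable B ->
  m A * lam n B = lam n A * m B.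
Proof.
move=> mk mtr mA mB.
pose M : {sigma_finite_measure set (borel_rV n) -> \bar R} := locally_finite mk.
have mtrx (x : 'rV[R]_n) : measurable_fun setT (fun y : borel_rV n => (y + x)%R : borel_rV n).
  apply: measurable_fun_rV => i; under eq_fun do rewrite mxE.
  by apply: measurable_funD => //; exact: measurable_coord.
pose S := [set xy : borel_rV n * borel_rV n | B xy.1 /\ A (xy.1 + xy.2)%R].
pose T := [set xy : borel_rV n * borel_rV n | B (xy.1 - xy.2)%R /\ A xy.1].
have mS : measurable S.
  apply: measurableI; first exact: (measurable_preimageT measurable_fst mB).
  exact: (measurable_preimageT (@measurable_rV_add n) mA).
have mT : measurable T.
  apply: measurableI; last exact: (measurable_preimageT measurable_fst mA).
  exact: (measurable_preimageT (@measurable_rV_sub n) mB).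
have fub W : measurable W -> \int[m]_x lam n (xsection W x) = \int[lam n]_y m (ysection W y).
  move=> mW; have := indic_fubini_tonelli M (lam n) mW.
  by rewrite indic_fubini_tonelli_FE // indic_fubini_tonelli_GE.
have ind (mu : {measure set (borel_rV n) -> \bar R}) (C : set (borel_rV n)) (c : \bar R) :
    measurable C -> 0 <= c -> \int[mu]_x (c * (\1_C x)%:E) = c * mu C.
  move=> mC c0; rewrite ge0_integralZl //=; last first.
    by apply/measurable_EFinP; exact: measurable_indic.
  by rewrite integral_indic // setIT.
have E1 : \int[m]_x lam n (xsection S x) = lam n A * m B.
  rewrite -ind //; apply: eq_integral => x _; rewrite indicE.
  case: (boolP (x \in B)) => xB; last first.
    rewrite mule0 (_ : xsection S x = set0) ?measure0 //.
    by apply/seteqP; split => y //; rewrite /xsection /S /= inE /= => -[/mem_set]; rewrite (negbTE xB).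
  rewrite mule1 -(lebesgue_rV_translation x mA); congr (lam n _).
  apply/seteqP; split => y /=; rewrite /xsection /S /= inE /= addrC; first by case.
  by split => //; exact: set_mem.
have E2 : \int[m]_x lam n (xsection T x) = lam n B * m A.
  rewrite -ind //; apply: eq_integral => x _; rewrite indicE.
  case: (boolP (x \in A)) => xA; last first.
    rewrite mule0 (_ : xsection T x = set0) ?measure0 //.
    by apply/seteqP; split => y //; rewrite /xsection /T /= inE /= => -[_ /mem_set]; rewrite (negbTE xA).
  have mxB : measurable ((fun y : borel_rV n => y + x)%R @^-1` B : set (borel_rV n)).
    exact: (measurable_preimageT (mtrx x) mB).
  rewrite mule1 -(lebesgue_rV_translation x mB) -(lebesgue_rVN mxB); congr (lam n _).
  apply/seteqP; split => y /=; rewrite /xsection /T /= inE /= addrC; first by case.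
  by split => //; exact: set_mem.
rewrite muleC -[LHS]E2 -E1 !fub //; apply: eq_integral => y _.
have mTy : measurable (ysection T y) by exact: measurable_ysection.
rewrite -(mtr y _ mTy); congr (m _).
by apply/seteqP; split => x /=; rewrite /ysection /S /T /= !inE /= addrK.
Qed.

End TranslationInvariance.

(** * Euclidean geometry *)

Lemma continuous_sum (R : realType) (T : topologicalType) I (r : seq I) (P : pred I)
    (f : I -> T -> R) x :
  (forall i, P i -> {for x, continuous (f i)}) ->
  {for x, continuous (fun y => \sum_(i <- r | P i) f i y)}.
Proof.
rewrite /prop_for /continuous_at => cf; elim: r => [|i r IH].
  have -> : (fun y => \sum_(i <- [::] | P i) f i y) = cst 0.
    by apply/funext => y; rewrite big_nil.
  by rewrite big_nil; exact: cvg_cst.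
have -> : (fun y => \sum_(j <- i :: r | P j) f j y) =
    fun y => if P i then f i y + \sum_(j <- r | P j) f j y else \sum_(j <- r | P j) f j y.
  by apply/funext => y; rewrite big_cons.
rewrite big_cons; case: ifP => // Pi.
by apply: cvgD; [exact: cf|exact: IH].
Qed.

Lemma continuous_cstT (R : realType) (T : topologicalType) (c : R) (x : T) :
  {for x, continuous (fun _ : T => c)}.
Proof. exact: cvg_cst. Qed.

Lemma continuous_mulT (R : realType) (T : topologicalType) (f g : T -> R) x :
  {for x, continuous f} -> {for x, continuous g} ->
  {for x, continuous (fun y => f y * g y)}.
Proof. exact: continuousM. Qed.

Section Euclidean.
Context {R : realType}.

Definition sqnorm n (x : 'rV[R]_n) : R := \sum_i x 0 i ^+ 2.

Definition dotp n (x y : 'rV[R]_n) : R := \sum_i x 0 i * y 0 i.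

Lemma dotpE n (x y : 'rV[R]_n) : dotp x y = (x *m y^T) 0 0.
Proof. by rewrite mxE; apply: eq_bigr => i _; rewrite mxE. Qed.

Lemma sqnormE n (x : 'rV[R]_n) : sqnorm x = dotp x x.
Proof. by apply: eq_bigr => i _; rewrite expr2. Qed.

Lemma dotpC n (x y : 'rV[R]_n) : dotp x y = dotp y x.
Proof. by apply: eq_bigr => i _; rewrite mulrC. Qed.

Lemma dotpDl n (x y z : 'rV[R]_n) : dotp (x + y) z = dotp x z + dotp y z.
Proof. by rewrite -big_split; apply: eq_bigr => i _; rewrite mxE mulrDl. Qed.

Lemma dotpZl n a (x z : 'rV[R]_n) : dotp (a *: x) z = a * dotp x z.
Proof. by rewrite mulr_sumr; apply: eq_bigr => i _; rewrite mxE mulrA. Qed.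

Lemma sqnorm_ge0 n (x : 'rV[R]_n) : 0 <= sqnorm x.
Proof. by apply: sumr_ge0 => i _; rewrite sqr_ge0. Qed.

Lemma sqnorm0 n : sqnorm (0 : 'rV[R]_n) = 0.
Proof. by rewrite /sqnorm big1 // => i _; rewrite mxE expr0n. Qed.

Lemma sqnormN n (x : 'rV[R]_n) : sqnorm (- x) = sqnorm x.
Proof. by apply: eq_bigr => i _; rewrite mxE sqrrN. Qed.

Lemma sqnormZ n a (x : 'rV[R]_n) : sqnorm (a *: x) = a ^+ 2 * sqnorm x.
Proof. by rewrite mulr_sumr; apply: eq_bigr => i _; rewrite mxE exprMn. Qed.

Lemma sqnormD n (x y : 'rV[R]_n) :
  sqnorm (x + y) = sqnorm x + 2 * dotp x y + sqnorm y.
Proof.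
rewrite mulr_sumr -!big_split; apply: eq_bigr => i _ /=.
by rewrite mxE sqrrD mulr_natl.
Qed.

Lemma coord_le_sqnorm n (x : 'rV[R]_n) i : x 0 i ^+ 2 <= sqnorm x.
Proof.
by rewrite /sqnorm (bigD1 i) //= lerDl; apply: sumr_ge0 => j _; rewrite sqr_ge0.
Qed.

Lemma norm_le_sqnorm n (x : 'rV[R]_n) : `|x| ^+ 2 <= sqnorm x.
Proof.
rewrite -[leRHS]sqr_sqrtr ?sqnorm_ge0 // ler_sqr ?nnegrE ?sqrtr_ge0 //.
apply: norm_rV_le; rewrite ?sqrtr_ge0 // => i.
by rewrite -sqrtr_sqr ler_sqrt ?sqnorm_ge0 // coord_le_sqnorm.
Qed.

Lemma sqnorm_le_norm n (x : 'rV[R]_n) : sqnorm x <= n%:R * `|x| ^+ 2.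
Proof.
rewrite -[n in n%:R]card_ord -sum1_card natr_sum mulr_suml; apply: ler_sum => i _.
by rewrite mul1r -real_normK ?num_real // ler_sqr ?nnegrE // coord_le_norm.
Qed.

Lemma sqnorm_eq0 n (x : 'rV[R]_n) : (sqnorm x == 0) = (x == 0).
Proof.
apply/eqP/eqP => [x0|->]; last exact: sqnorm0.
have := norm_le_sqnorm x; rewrite x0 => x0'.
by apply/eqP; rewrite -normr_eq0 -sqrf_eq0 eq_le x0' sqr_ge0.
Qed.

Lemma sqnorm_gt0 n (x : 'rV[R]_n) : (0 < sqnorm x) = (x != 0).
Proof. by rewrite lt_def sqnorm_ge0 andbT sqnorm_eq0. Qed.

Lemma continuous_sqnorm n : continuous (@sqnorm n).
Proof.
move=> x; apply: continuous_sum => i _; apply: continuousM; exact: coord_continuous.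
Qed.

Lemma continuous_dotp n (y : 'rV[R]_n) : continuous (fun x => dotp x y).
Proof.
move=> x; apply: continuous_sum => i _; apply: continuous_mulT.
  exact: coord_continuous.
exact: continuous_cstT.
Qed.

Definition orthogonal_mx n (Q : 'M[R]_n) := Q *m Q^T = 1%:M.

Lemma orthogonal_mxC n (Q : 'M[R]_n) : orthogonal_mx Q -> Q^T *m Q = 1%:M.
Proof. by move/mulmx1C. Qed.

Lemma dotp_orthogonal n (Q : 'M[R]_n) x y :
  orthogonal_mx Q -> dotp (x *m Q) (y *m Q) = dotp x y.
Proof.
by move=> hQ; rewrite !dotpE trmx_mul mulmxA -[_ *m Q *m _]mulmxA hQ mulmx1.
Qed.

Lemma sqnorm_orthogonal n (Q : 'M[R]_n) x :
  orthogonal_mx Q -> sqnorm (x *m Q) = sqnorm x.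
Proof. by move=> hQ; rewrite !sqnormE dotp_orthogonal. Qed.

Definition eball n (r : R) : set 'rV[R]_n := [set x | sqnorm x <= r].
End Euclidean.
Arguments eball {R} n r.

Section RotationInvariance.
Context {R : realType}.
Notation lam := (@lebesgue_rV R).

Lemma measurable_eball n (r : R) : measurable (eball n r : set (borel_rV n)).
Proof.
apply: closed_borel_rV.
rewrite (_ : eball n r = @sqnorm R n @^-1` [set x | x <= r]) //.
by apply: closed_comp; [move=> x _; exact: continuous_sqnorm|exact: closed_le].
Qed.

Lemma eball_sub_cube n (r : R) : 0 <= r -> eball n (r ^+ 2) `<=` cube n r.
Proof.
move=> r0 x /= xr; rewrite /cube /= -ler_sqr ?nnegrE //.
exact: le_trans (norm_le_sqnorm _) xr.
Qed.

Lemma lebesgue_eball_lty n (r : R) : (lam n (eball n r) < +oo)%E.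
Proof.
have [r0|r0] := leP 0 r; last first.
  rewrite (_ : eball n r = set0) ?measure0 ?ltry //.
  by apply/seteqP; split => x //= xr; have := le_lt_trans xr r0; rewrite ltNge sqnorm_ge0.
apply: (@le_lt_trans _ _ (lam n (cube n (Num.sqrt r)))).
  rewrite -{1}(sqr_sqrtr r0); apply: le_measure; rewrite ?inE.
  - exact: measurable_eball.
  - exact: measurable_norm_le.
  - exact: eball_sub_cube.
by rewrite lebesgue_cube ?ltry.
Qed.

Lemma lebesgue_eball_gt0 n (r : R) : 0 < r -> (0 < lam n (eball n r))%E.
Proof.
move=> r0; pose s := Num.sqrt (r / n.+1%:R).
have s0 : 0 < s by rewrite sqrtr_gt0 divr_gt0.
apply: (@lt_le_trans _ _ (lam n (cube n s))).
  by rewrite lebesgue_cube ?(ltW s0) // lte_fin exprn_gt0 // mulr_gt0.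
apply: le_measure; rewrite ?inE.
- exact: measurable_norm_le.
- exact: measurable_eball.
move=> x; rewrite /cube /eball /= => xs; apply: le_trans (sqnorm_le_norm _) _.
apply: (@le_trans _ _ (n%:R * s ^+ 2)).
  by rewrite ler_wpM2l // ler_sqr ?nnegrE // ltW.
rewrite sqr_sqrtr ?divr_ge0 ?(ltW r0) // mulrCA ger_pMr //.
by rewrite ler_pdivrMr // mul1r ler_nat.
Qed.

Lemma measurable_mulmxr n m (Q : 'M[R]_(n, m)) :
  measurable_fun setT (fun y : borel_rV n => (y *m Q) : borel_rV m).
Proof.
apply: measurable_fun_rV => i; under eq_fun do rewrite mxE.
apply: measurable_sum => j; apply: measurable_funM => //; exact: measurable_coord.
Qed.

Lemma lebesgue_rV_orthogonal n (Q : 'M[R]_n) (A : set (borel_rV n)) :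
  orthogonal_mx Q -> measurable A -> lam n ((fun y => y *m Q) @^-1` A) = lam n A.
Proof.
move=> hQ mA; pose B := eball n (1 : R).
have mB : measurable (B : set (borel_rV n)) by exact: measurable_eball.
have mQ := measurable_mulmxr Q.
pose m : {measure set (borel_rV n) -> \bar R} :=
  measure_function_pushforward__canonical__measure_function_Measure (lam n) mQ.
have mE C : m C = lam n ((fun y => y *m Q) @^-1` C) by [].
have mBE r : (fun y => y *m Q) @^-1` eball n r = eball n r.
  by apply/seteqP; split => x; rewrite /eball /= sqnorm_orthogonal.
have E := @translation_invariant_unique R n m A B.
suff : (lam n A * lam n B = m A * lam n B)%E.
  have B0 := lebesgue_eball_gt0 n (@ltr01 R).
  have Boo := lebesgue_eball_lty n (1 : R).
  have Bfin : lam n B \is a fin_num by rewrite ge0_fin_numE.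
  move=> E'; rewrite -mE; apply/le_anti/andP; split;
    by rewrite -(lee_pmul2r Bfin B0) E'.
rewrite E //; first by rewrite mE mBE.
  move=> k; rewrite mE.
  apply: le_lt_trans (lebesgue_eball_lty n (n%:R * k%:R ^+ 2)).
  rewrite -[in leRHS]mBE; apply: le_measure; rewrite ?inE.
  - exact: measurable_preimageT mQ (measurable_norm_le _).
  - exact: measurable_preimageT mQ (measurable_eball _).
  move=> x; rewrite /cube /eball /= => xk; apply: le_trans (sqnorm_le_norm _) _.
  by rewrite ler_wpM2l // ler_sqr ?nnegrE.
move=> a C mC; rewrite !mE -(lebesgue_rV_translation (a *m Q^T) (measurable_preimageT mQ mC)).
congr (lam n _); apply/seteqP; split => x /=;
  by rewrite mulmxDl -mulmxA orthogonal_mxC ?mulmx1.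
Qed.

End RotationInvariance.

(** * Tame functions *)

Section Tame.
Context {R : realType}.
Notation lam := (@lebesgue_rV R).

Lemma oneDsqr_gt0 (x : R) : 0 < oneDsqr x.
Proof. exact: lt_le_trans ltr01 (oneDsqr_ge1 x). Qed.

Lemma oneDsqr_ge0 (x : R) : 0 <= oneDsqr x.
Proof. exact/ltW/oneDsqr_gt0. Qed.

Lemma integral_oneDsqrV_lty :
  (\int[@lebesgue_measure R]_x ((oneDsqr x)^-1)%:E < +oo)%E.
Proof.
rewrite ge0_symfun_integralT //; first last.
- by move=> x; rewrite /= /oneDsqr sqrrN.
- exact: continuous_oneDsqrV.
have -> : [set x : R | 0 <= x] = `[0, +oo[%classic by rewrite set_itvcy.
by rewrite integral0y_oneDsqr -EFinM ltry.
Qed.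

(** An integrable majorant that is a product, so that its integral is computed one coordinate at a time. *)
Definition decay n (y : 'rV[R]_n) : R := \prod_i (oneDsqr (y 0 i))^-1.

Lemma decay_gt0 n (y : 'rV[R]_n) : 0 < decay y.
Proof. by apply: prodr_gt0 => i _; rewrite invr_gt0 oneDsqr_gt0. Qed.

Lemma decay_rVcons n x (v : 'rV[R]_n) :
  decay (rVcons x v) = (oneDsqr x)^-1 * decay v.
Proof.
rewrite /decay big_ord_recl rVcons0; congr (_ * _).
by apply: eq_bigr => i _; rewrite rVconsS.
Qed.

Lemma measurable_decay n : measurable_fun setT (@decay n : borel_rV n -> R).
Proof.
apply: measurable_prod => i _.
apply: (measurableT_comp (f := fun x : R => (oneDsqr x)^-1)); last exact: measurable_coord.
exact: continuous_measurable_fun continuous_oneDsqrV.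
Qed.

Lemma integrable_decay n : (lam n).-integrable setT (EFin \o @decay n).
Proof.
have mD k : measurable_fun setT (fun y : borel_rV k => (decay y)%:E).
  by apply/measurable_EFinP; exact: measurable_decay.
have D0 k (y : 'rV[R]_k) : (0 <= (decay y)%:E)%E by rewrite lee_fin ltW // decay_gt0.
apply/integrableP; split; first exact: mD.
under eq_integral => y _.
  rewrite /= ger0_norm; last by rewrite ltW // decay_gt0.
  over.
elim: n => [|n IH].
  rewrite integral_dirac // diracT mul1e ltry //.
rewrite ge0_integral_lebesgue_rVS //.
under eq_integral => x _.
  under eq_integral => v _ do rewrite decay_rVcons EFinM.
  rewrite ge0_integralZl //.
  over.
rewrite ge0_integralZr //.
- by rewrite lte_mul_pinfty ?integral_oneDsqrV_lty ?integral_ge0 //;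
    rewrite ge0_fin_numE ?integral_oneDsqrV_lty ?integral_ge0.
- apply/measurable_EFinP.
  exact: continuous_measurable_fun (@continuous_oneDsqrV R).
- exact: integral_ge0.
Qed.

Definition tame n (f : 'rV[R]_n -> R) :=
  continuous f /\ exists2 C, 0 <= C & forall y, `|f y| <= C * decay y.

Lemma tame_mul_integrable n (f g : 'rV[R]_n -> R) B :
  tame f -> measurable_fun setT (g : borel_rV n -> R) -> 0 <= B ->
  (forall y, f y != 0 -> `|g y| <= B) ->
  (lam n).-integrable setT (EFin \o (fun y => f y * g y)).
Proof.
move=> [cf [C C0 fC]] mg B0 gB.
have := integrableZl measurableT (C * B) (integrable_decay n).
apply: le_integrable => //.
  apply/measurable_EFinP; apply: measurable_funM => //.
  exact: continuous_measurable_rV.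
move=> y _; rewrite /= lee_fin normrM [leRHS]ger0_norm; last first.
  by rewrite !mulr_ge0 // ltW // decay_gt0.
have [->|f0] := eqVneq (f y) 0.
  by rewrite normr0 mul0r !mulr_ge0 // ltW // decay_gt0.
by rewrite mulrAC ler_pM // gB.
Qed.

Lemma tame_integrable n (f : 'rV[R]_n -> R) :
  tame f -> (lam n).-integrable setT (EFin \o f).
Proof.
move=> tf; have := @tame_mul_integrable n f (cst 1) 1 tf.
rewrite (_ : (fun y => f y * cst 1 y) = f); last by apply/funext => y /=; rewrite mulr1.
by apply => // y _ /=; rewrite normr1.
Qed.

Lemma tameM n (f g : 'rV[R]_n -> R) B : tame f -> continuous g ->
  (forall y, `|g y| <= B) -> tame (fun y => f y * g y).
Proof.
move=> [cf [C C0 fC]] cg gB; split.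
  by move=> y; apply: continuous_mulT; [exact: cf|exact: cg].
have B0 : 0 <= B by apply: le_trans (gB 0).
exists (C * B); first exact: mulr_ge0.
by move=> y; rewrite normrM mulrAC ler_pM.
Qed.

End Tame.

(** * Approximation and asymptotics in one variable *)

Section OneVariable.
Context {R : realType}.

(** By induction on i: divide by l ^+ i and let l tend to 0. *)
Lemma polynomial_small_coef0 (a : nat -> R) (l0 : R) : 0 < l0 ->
  (forall J, exists C : R, forall l : R, 0 < l -> l < l0 ->
     `|\sum_(i < J.+1) a i * l ^+ i| <= C * l ^+ J.+1) ->
  forall i, a i = 0.
Proof.
move=> l0_gt0 small i; elim/ltn_ind: i => j IH.
have [C HC] := small j.
have aC l : 0 < l -> l < l0 -> `|a j| <= C * l.
  move=> lp ll0; have := HC l lp ll0; rewrite big_ord_recr /= big1 ?add0r; last first.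
    by move=> i _; rewrite IH ?mul0r.
  by rewrite normrM (ger0_norm (exprn_ge0 _ (ltW lp))) exprS mulrA ler_pM2r ?exprn_gt0.
apply/eqP; rewrite -normr_le0 leNgt; apply/negP => aj.
have C0 : 0 < C.
  have := aC (l0 / 2); rewrite divr_gt0 // => /(_ isT).
  rewrite ltr_pdivrMr // ltr_pMr // ltr1n => /(_ isT) /(lt_le_trans aj).
  by rewrite pmulr_lgt0 // divr_gt0.
pose l := Num.min (l0 / 2) (`|a j| / (2 * C)).
have lp : 0 < l by rewrite lt_min !divr_gt0 // mulr_gt0.
have := aC l lp; rewrite gt_min ltr_pdivrMr // ltr_pMr // ltr1n => /(_ isT).
apply/negP; rewrite -ltNge.
apply: (@le_lt_trans _ _ (C * (`|a j| / (2 * C)))).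
  by rewrite ler_wpM2l ?(ltW C0) // ge_min lexx orbT.
rewrite (_ : C * _ = `|a j| / 2); last by field; rewrite gt_eqF.
by rewrite ltr_pdivrMr // ltr_pMr // ltr1n.
Qed.

Lemma bernstein_shift n (x y : R) (g : nat -> R) :
  \sum_(k < n.+2) k%:R * g k * ('C(n.+1, k)%:R * x ^+ k * y ^+ (n.+1 - k)) =
  n.+1%:R * x * \sum_(k < n.+1) g k.+1 * ('C(n, k)%:R * x ^+ k * y ^+ (n - k)).
Proof.
rewrite big_ord_recl !mul0r add0r mulr_sumr; apply: eq_bigr => k _ /=.
rewrite /bump /= add1n subSS.
have := mul_bin_diag n.+1 k => /(congr1 (fun m : nat => m%:R : R)).
rewrite /= !natrM exprS => E.
rewrite [LHS](_ : _ = g k.+1 * x * (x ^+ k * y ^+ (n - k)) * (k.+1%:R * 'C(n.+1, k.+1)%:R)); last by ring.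
by rewrite -E; ring.
Qed.

Definition bernstein n (f : R -> R) : {poly R} :=
  \sum_(k < n.+1) f (k%:R / n%:R) *: ('C(n, k)%:R *: ('X ^+ k * (1 - 'X) ^+ (n - k))).

Definition bernstein_weight n k (x : R) := 'C(n, k)%:R * x ^+ k * (1 - x) ^+ (n - k).

Lemma horner_bernstein n f x :
  (bernstein n f).[x] = \sum_(k < n.+1) f (k%:R / n%:R) * bernstein_weight n k x.
Proof.
rewrite /bernstein horner_sum; apply: eq_bigr => k _.
rewrite /bernstein_weight !hornerZ hornerM hornerXn horner_exp. by rewrite !hornerE.
Qed.

Lemma bernstein_weight_ge0 n k x : 0 <= x -> x <= 1 -> 0 <= bernstein_weight n k x.
Proof. by move=> x0 x1; rewrite !mulr_ge0 // exprn_ge0 // subr_ge0. Qed.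

Lemma sum_bernstein_weight n x : \sum_(k < n.+1) bernstein_weight n k x = 1.
Proof.
transitivity ((1 - x + x) ^+ n); last by rewrite subrK expr1n.
rewrite exprDn; apply: eq_bigr => k _.
by rewrite /bernstein_weight -mulr_natl; ring.
Qed.

(** The variance of a binomial law. *)
Lemma bernstein_weight_var n x :
  \sum_(k < n.+1) (n%:R * x - k%:R) ^+ 2 * bernstein_weight n k x = n%:R * x * (1 - x).
Proof.
case: n => [|n].
  by rewrite big_ord1 /= !mul0r subr0 expr0n mul0r.
have M1 m : \sum_(k < m.+2) k%:R * bernstein_weight m.+1 k x = m.+1%:R * x.
  have := bernstein_shift m x (1 - x) (fun=> 1).
  under eq_bigr do rewrite mulr1.
  under [in RHS]eq_bigr do rewrite mul1r.
  by rewrite [X in _ * X](sum_bernstein_weight m x) mulr1.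
have M2 : \sum_(k < n.+2) k%:R * (k%:R - 1) * bernstein_weight n.+1 k x =
    n.+1%:R * x * (n%:R * x).
  rewrite (bernstein_shift n x (1 - x) (fun k => k%:R - 1)); congr (_ * _).
  under eq_bigr do rewrite -natr1 addrK.
  case: n => [|n]; first by rewrite big_ord1 !mul0r.
  exact: M1.
rewrite [LHS](_ : _ = (n.+1%:R * x) ^+ 2 * \sum_(k < n.+2) bernstein_weight n.+1 k x
   - (2 * n.+1%:R * x - 1) * \sum_(k < n.+2) k%:R * bernstein_weight n.+1 k x
   + \sum_(k < n.+2) k%:R * (k%:R - 1) * bernstein_weight n.+1 k x).
  by rewrite sum_bernstein_weight M1 M2 -natr1; ring.
rewrite !mulr_sumr -sumrB -big_split; apply: eq_bigr => k _ /=; ring.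
Qed.

Lemma compact_unif_continuous (V : normedModType R) (K : set V) (f : V -> R) (e : R) :
  compact K -> continuous f -> 0 < e ->
  exists2 d : R, 0 < d & forall x y, K x -> `|x - y| < d -> `|f x - f y| < e.
Proof.
move=> cK cf e0.
pose P (d : R) (x : V) := forall y, `|x - y| < d -> `|f x - f y| < e.
have e2 : 0 < e / 2 by rewrite divr_gt0.
have H : \forall d \near 0^'+, K `<=` P d.
  apply: ((compact_near_coveringP K).1 cK) => x Kx.
  have /cvgrPdist_lt/(_ _ e2)/nbhs_ballP[d /= d0 dP] := cf x.
  have d2 : 0 < d / 2 by rewrite divr_gt0.
  have dd : d / 2 <= d by rewrite ler_pdivrMr // ler_peMr ?ltW // ltr1n.
  exists (ball x (d / 2), [set r | r < d / 2]) => /=.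
    by split; [exact: nbhsx_ballx|exact: nbhs_right_lt].
  move=> [x' r] /= [xx' rd] y x'y; rewrite (splitr e).
  apply: (le_lt_trans (ler_distD (f x) _ _)); rewrite ltrD //.
    by rewrite distrC; apply: dP; exact: le_ball xx'.
  apply: dP; rewrite (splitr d); apply: ball_triangle xx' _.
  by rewrite -ball_normE /=; exact: lt_trans x'y rd.
have [d /= [Hd d0]] : exists d, (K `<=` P d) /\ 0 < d.
  by apply: (filter_ex (F := 0^'+)); apply: filterI => //; exact: nbhs_right_gt.
by exists d => // x y Kx; exact: Hd.
Qed.

(** Weierstrass's theorem, with Bernstein polynomials. *)
Lemma weierstrass01 (f : R -> R) (e : R) : continuous f -> 0 < e ->
  exists p : {poly R}, forall x : R, 0 <= x <= 1 -> `|f x - p.[x]| <= e.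
Proof.
move=> cf e0; have e2 : 0 < e / 2 by rewrite divr_gt0.
have cI := @segment_compact R 0 1.
have [d d0 fd] := compact_unif_continuous cI cf e2.
have [B B0 fB] : exists2 B : R, 0 < B & forall x : R, 0 <= x <= 1 -> `|f x| <= B.
  have := @continuous_compact _ _ f _ (continuous_subspaceT cf) cI.
  move=> /compact_bounded[M [Mr MP]]; exists (`|M| + 1); first by rewrite ltr_wpDl.
  move=> x x01; apply: MP => /=; first by rewrite ltr_pwDr // ler_norm.
  by exists x => //; rewrite /= in_itv.
pose c := 2 * B / d ^+ 2.
have c0 : 0 <= c by rewrite divr_ge0 ?exprn_ge0 ?mulr_ge0 ?(ltW B0) // ltW.
have mod_f (x y : R) : 0 <= x <= 1 -> 0 <= y <= 1 ->
    `|f x - f y| <= e / 2 + c * (x - y) ^+ 2.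
  move=> x01 y01; have [xy|xy] := ltP `|x - y| d.
    apply: le_trans (ltW (fd _ _ _ xy)) _; first by rewrite /= in_itv.
    by rewrite lerDl mulr_ge0 // sqr_ge0.
  apply: le_trans (ler_normB _ _) _; apply: le_trans (lerD (fB _ x01) (fB _ y01)) _.
  apply: (@le_trans _ _ (c * (x - y) ^+ 2)); last by rewrite lerDr ltW.
  rewrite (_ : B + B = 2 * B); last by ring.
  rewrite /c mulrAC ler_pdivlMr ?exprn_gt0 //.
  by rewrite ler_pM2l ?mulr_gt0 // -[leRHS]real_normK ?num_real // ler_sqr ?nnegrE // ltW.
pose n := (Num.trunc (c / (e / 2))).+1.
have n0 : (0 : R) < n%:R by [].
have nc : c / n%:R <= e / 2.
  rewrite ler_pdivrMr // mulrC -ler_pdivrMr //.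
  by apply/ltW; exact: truncnS_gt.
exists (bernstein n f) => x /andP[x0 x1].
have w0 k := bernstein_weight_ge0 n k x0 x1.
have -> : f x = \sum_(k < n.+1) f x * bernstein_weight n k x.
  by rewrite -mulr_sumr sum_bernstein_weight mulr1.
rewrite horner_bernstein -sumrB.
apply: le_trans (ler_norm_sum _ _ _) _.
apply: (@le_trans _ _ (\sum_(k < n.+1) (e / 2 * bernstein_weight n k x +
    c / n%:R ^+ 2 * ((n%:R * x - k%:R) ^+ 2 * bernstein_weight n k x)))).
  apply: ler_sum => k _; rewrite -mulrBl normrM (ger0_norm (w0 k)).
  rewrite mulrA -mulrDl ler_wpM2r //.
  apply: le_trans (mod_f _ _ _ _) _; first by rewrite x0.
    by rewrite divr_ge0 //= ler_pdivrMr // mul1r ler_nat -ltnS.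
  rewrite lerD2l -mulrA; rewrite ler_wpM2l //.
  rewrite (_ : x - k%:R / n%:R = (n%:R * x - k%:R) / n%:R).
    by rewrite expr_div_n mulrC.
  by field; rewrite gt_eqF.
rewrite big_split /= -!mulr_sumr sum_bernstein_weight bernstein_weight_var mulr1.
rewrite [leRHS](splitr e) lerD2l; apply: le_trans nc.
rewrite (_ : c / n%:R ^+ 2 * _ = c / n%:R * (x * (1 - x))); last by field; rewrite gt_eqF.
rewrite ler_piMr //; first by rewrite mulr_ge0 // invr_ge0 ltW.
by apply: mulr_ile1; rewrite ?subr_ge0 // lerBlDr lerDl.
Qed.

Lemma weierstrass (f : R -> R) (M e : R) : 0 < M -> continuous f -> 0 < e ->
  exists p : {poly R}, forall x : R, 0 <= x <= M -> `|f x - p.[x]| <= e.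
Proof.
move=> M0 cf e0.
have cg : continuous (fun x => f (M * x)).
  move=> x; apply: continuous_comp; last exact: cf.
  by apply: continuous_mulT => //; exact: continuous_cstT.
have [p pP] := weierstrass01 cg e0.
exists (p \Po (M^-1 *: 'X)) => x /andP[x0 xM].
have := pP (M^-1 * x); rewrite mulVKf ?gt_eqF // horner_comp !hornerE; apply.
by rewrite mulr_ge0 ?invr_ge0 ?(ltW M0) //= mulrC ler_pdivrMr // mul1r.
Qed.

End OneVariable.

Section SegmentIntegral.
Context {R : realType}.
Implicit Types (a b : R) (f g F : R -> R).

Definition segint a b f : R := \int[lebesgue_measure]_(t in `[a, b]) f t.

Lemma segint_integrable a b f : continuous f ->
  (@lebesgue_measure R).-integrable `[a, b] (EFin \o f).
Proof.
move=> cf; apply: continuous_compact_integrable; first exact: segment_compact.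
exact: continuous_subspaceT.
Qed.

Lemma eq_segint a b f g : (forall t, a <= t <= b -> f t = g t) -> segint a b f = segint a b g.
Proof. by move=> fg; apply: eq_Rintegral => t; rewrite inE /= in_itv /=; exact: fg. Qed.

Lemma segintD a b f g : continuous f -> continuous g ->
  segint a b (fun t => f t + g t) = segint a b f + segint a b g.
Proof. by move=> cf cg; rewrite /segint RintegralD //; exact: segint_integrable. Qed.

Lemma segintB a b f g : continuous f -> continuous g ->
  segint a b (fun t => f t - g t) = segint a b f - segint a b g.
Proof. by move=> cf cg; rewrite /segint RintegralB //; exact: segint_integrable. Qed.

Lemma segintZ a b c f : continuous f ->
  segint a b (fun t => c * f t) = c * segint a b f.
Proof. by move=> cf; rewrite /segint RintegralZl //; exact: segint_integrable. Qed.

Lemma segint_sum a b n (f : nat -> R -> R) : (forall i, continuous (f i)) ->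
  segint a b (fun t => \sum_(i < n) f i t) = \sum_(i < n) segint a b (f i).
Proof.
move=> cf; elim: n => [|n IH].
  rewrite big_ord0 /segint -[RHS](mul0r (fine (lebesgue_measure `[a, b]%classic))) -Rintegral_cst //.
  by apply: eq_Rintegral => t _; rewrite big_ord0.
rewrite big_ord_recr /= -IH -segintD //.
  by apply: eq_segint => t _; rewrite big_ord_recr.
by move=> x; apply: continuous_sum => i _; exact: cf.
Qed.

Lemma segint_cst a b c : a <= b -> segint a b (fun=> c) = c * (b - a).
Proof.
move=> ab; rewrite /segint Rintegral_cst //; congr (_ * _).
exact: (congr1 fine (lebesgue_measure_segment ab)).
Qed.

Lemma le_segint a b f g : continuous f -> continuous g ->
  (forall t, a <= t <= b -> f t <= g t) -> segint a b f <= segint a b g.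
Proof.
move=> cf cg fg; apply: (le_Rintegral _ (segint_integrable _ _ cf) (segint_integrable _ _ cg)) => //.
Qed.

Lemma norm_segint a b f : continuous f -> `|segint a b f| <= segint a b (fun t => `|f t|).
Proof. by move=> cf; apply: le_normr_Rintegral => //; exact: segint_integrable. Qed.

Lemma segint_derive a b f F : a <= b -> continuous f ->
  (forall t, a <= t <= b -> is_derive t 1 F (f t)) ->
  segint a b f = F b - F a.
Proof.
move=> ab cf dF; move: ab; rewrite le_eqVlt => /predU1P[ab|ab].
  by rewrite -ab subrr /segint set_itv1 Rintegral_set1.
have dcF t : a <= t <= b -> F @ t --> F t.
  move=> /dF[dft _]; apply: differentiable_continuous; exact/derivable1_diffP.
rewrite /segint /Rintegral (@continuous_FTC2 _ f F) //.
- exact: continuous_subspaceT.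
- split.
  + by move=> t; rewrite in_itv /= => /andP[at_ tb]; have [] // := dF t _; rewrite !ltW.
  + by apply: cvg_at_right_filter; apply: dcF; rewrite lexx ltW.
  + by apply: cvg_at_left_filter; apply: dcF; rewrite lexx ltW.
- move=> t; rewrite in_itv /= => /andP[at_ tb]; rewrite derive1E.
  by have [] // := dF t _; rewrite !ltW.
Qed.

Lemma primitive (m : R) f : continuous f ->
  exists F : R -> R, forall t, m < t -> is_derive t 1 F (f t).
Proof.
move=> cf; exists (fun x => \int[lebesgue_measure]_(t in `[m, x]) f t) => t mt.
have tt : t < t + 1 by rewrite ltrDl.
have [dF F'] := continuous_FTC1_closed tt (segint_integrable m (t + 1) cf) mt (cf t).
by apply: (DeriveDef dF); rewrite -derive1E; exact: F'.
Qed.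

Lemma MVT_le a b f (df : R -> R) : a <= b ->
  (forall t, a <= t <= b -> is_derive t 1 f (df t)) ->
  exists2 c, a <= c <= b & f b - f a = df c * (b - a).
Proof.
move=> ab dF; have [||c cab E] := MVT_segment ab _ _ (df := df) (f := f).
- by move=> t; rewrite in_itv /= => /andP[? ?]; apply: dF; rewrite !ltW.
- apply: derivable_within_continuous => t; rewrite in_itv /= => tab.
  by have [] := dF t tab.
- by exists c.
Qed.

Lemma is_derive_eq0_le a b f : a <= b ->
  (forall t, a <= t <= b -> is_derive t 1 f (0 : R)) -> f b = f a.
Proof.
move=> ab df; have [c _] := MVT_le ab (df := fun=> 0) df.
by rewrite mul0r => /eqP; rewrite subr_eq0 => /eqP.
Qed.

End SegmentIntegral.

Section BinomialSeries.
Context {R : realType}.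

(** The coefficients of the expansion of (1 - v)^a in powers of v. *)
Fixpoint binom_coef (a : R) (i : nat) : R :=
  match i with
  | 0%N => 1
  | j.+1 => - a / j.+1%:R * binom_coef (a - 1) j
  end.

Lemma binom_coef_neq0 (a : R) i : (forall j : nat, a != j%:R) -> binom_coef a i != 0.
Proof.
elim: i a => [|i IH] a aN /=; first by rewrite oner_eq0.
rewrite !mulf_neq0 ?oppr_eq0 ?invr_eq0 ?pnatr_eq0 //; first exact: aN 0%N.
by apply: IH => j; rewrite subr_eq natr1; exact: aN.
Qed.

Lemma binom_taylor J (a : R) : exists2 C : R, 0 <= C &
  forall v : R, 0 <= v <= 1 / 2 ->
    `|(1 - v) `^ a - \sum_(i < J) binom_coef a i * v ^+ i| <= C * v ^+ J.
Proof.
elim: J a => [|J IH] a.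
  exists (expR (`|a| * ln 2)); first exact: expR_ge0.
  move=> v /andP[v0 v12]; rewrite big_ord0 subr0 mulr1.
  have v1 : 0 < 1 - v by lra.
  rewrite ger0_norm ?powR_ge0 // /powR gt_eqF // ler_expR.
  apply: le_trans (ler_norm _) _; rewrite normrM ler_wpM2l //.
  rewrite ler0_norm; last by rewrite ln_le0 //; lra.
  rewrite -lnV ?posrE // ler_ln ?posrE ?invr_gt0 //.
  by rewrite -[leRHS]invrK lef_pV2 ?posrE ?invr_gt0 //; lra.
have [C C0 HC] := IH (a - 1).
exists (`|a| * C); first by rewrite mulr_ge0.
move=> v /andP[v0 v12].
pose p : {poly R} := \poly_(i < J.+1) binom_coef a i.
pose F x := (1 - x) `^ a - p.[x].
pose dF x := - a * ((1 - x) `^ (a - 1) - \sum_(i < J) binom_coef (a - 1) i * x ^+ i).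
have pE x : p.[x] = \sum_(i < J.+1) binom_coef a i * x ^+ i.
  by rewrite horner_poly.
have dpE x : (p^`()).[x] = - a * \sum_(i < J) binom_coef (a - 1) i * x ^+ i.
  rewrite (@horner_coef_wide _ J); last first.
    have := size_poly J.+1 (binom_coef a); rewrite -/p => sp.
    by apply: leq_trans (size_poly _ _) _; case: (size p) sp.
  rewrite mulr_sumr; apply: eq_bigr => i _.
  rewrite coef_deriv coef_poly /= ltnS ltn_ord -mulr_natr.
  by field; rewrite nat1r pnatr_eq0.
have F0 : F 0 = 0.
  rewrite /F pE big_ord_recl big1 ?addr0 /=; last first.
    by move=> i _; rewrite expr0n /= mulr0.
  by rewrite subr0 powR1 expr0 mulr1 subrr.
have dFE x : 0 <= x <= v -> is_derive x 1 F (dF x).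
  move=> /andP[x0 xv]; have x1 : 0 < 1 - x by lra.
  have d1 : is_derive x 1 (fun x : R => 1 - x) (-1).
    have -> : -1 = 0 - 1 :> R by rewrite sub0r.
    exact: is_deriveB.
  have d2 := @is_derive1_comp _ (fun y => y `^ a) _ x _ _ (is_derive1_powR a x1) d1.
  have d3 := is_derive_poly p x.
  have := is_deriveB d2 d3; rewrite dpE /dF.
  by congr is_derive; ring.
have [c /andP[c0 cv]] := MVT_le v0 dFE.
rewrite F0 !subr0 -pE -/(F v) => ->.
rewrite /dF normrM normrM normrN (ger0_norm v0) -!mulrA exprSr ler_wpM2l //.
rewrite mulrA ler_wpM2r //.
apply: le_trans (HC c _) _; first by rewrite c0 (le_trans cv).
by rewrite ler_wpM2l // lerXn2r ?nnegrE.
Qed.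

End BinomialSeries.

(** * Radial averages *)

Section ContinuityCalculus.
Context {R : realType} {T : topologicalType}.
Implicit Types f g : T -> R.

Lemma cont_cst (c : R) : continuous (fun _ : T => c).
Proof. by move=> x; exact: cvg_cst. Qed.

Lemma cont_add f g : continuous f -> continuous g -> continuous (fun x => f x + g x).
Proof. by move=> cf cg x; apply: continuousD; [exact: cf|exact: cg]. Qed.

Lemma cont_opp f : continuous f -> continuous (fun x => - f x).
Proof. by move=> cf x; apply: continuousN; exact: cf. Qed.

Lemma cont_mul f g : continuous f -> continuous g -> continuous (fun x => f x * g x).
Proof. by move=> cf cg x; apply: continuousM; [exact: cf|exact: cg]. Qed.

Lemma cont_comp (h : R -> R) f : continuous h -> continuous f -> continuous (fun x => h (f x)).
Proof. by move=> ch cf x; apply: continuous_comp; [exact: cf|exact: ch]. Qed.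

Lemma cont_exp n f : continuous f -> continuous (fun x => f x ^+ n).
Proof. by move=> cf; apply: (cont_comp (h := fun y => y ^+ n)) => //; exact: exprn_continuous. Qed.

Lemma cont_sum I (r : seq I) (P : pred I) (f : I -> T -> R) :
  (forall i, P i -> continuous (f i)) -> continuous (fun x => \sum_(i <- r | P i) f i x).
Proof. by move=> cf x; apply: continuous_sum => i /cf; exact. Qed.

End ContinuityCalculus.

Section RadialAverage.
Context {R : realType}.

(** Up to a constant, the average of h (rho * |pi z|^2) over the uniformly
    distributed (p+1)-dimensional subspaces of R^(p+q+2), for a unit vector z
    and the orthogonal projection pi. *)
Definition radial_avg (p q : nat) (h : R -> R) (rho : R) : R :=
  segint 0 (pi / 2) (fun t => h (rho * sin t ^+ 2) * sin t ^+ p * cos t ^+ q).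

Lemma continuous_sin_cos p q : continuous (fun t : R => sin t ^+ p * cos t ^+ q).
Proof.
apply: cont_mul; apply: cont_exp; [exact: continuous_sin|exact: continuous_cos].
Qed.

Lemma continuous_radial_integrand p q (h : R -> R) rho : continuous h ->
  continuous (fun t => h (rho * sin t ^+ 2) * sin t ^+ p * cos t ^+ q).
Proof.
move=> ch; under eq_fun do rewrite -mulrA.
apply: cont_mul; last exact: continuous_sin_cos.
apply: cont_comp ch _; apply: cont_mul; first exact: cont_cst.
by apply: cont_exp; exact: continuous_sin.
Qed.

Lemma pihalf_ge0 : 0 <= pi / 2 :> R. Proof. by rewrite divr_ge0 // pi_ge0. Qed.

Lemma sin_cos_ge0 (t : R) : 0 <= t <= pi / 2 -> 0 <= sin t /\ 0 <= cos t.
Proof.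
move=> /andP[t0 t1]; split.
  by apply: sin_ge0_pi; rewrite t0 (le_trans t1) // ler_pdivrMr // ler_peMr ?pi_ge0 // ler1n.
by apply: cos_ge0_pihalf; rewrite t1 andbT (le_trans _ t0) // oppr_le0 pihalf_ge0.
Qed.

Section Asymptotics.
Variables (b : R -> R) (p q : nat).
Hypotheses (cb : continuous b) (b0 : forall t, 1 <= t -> b t = 0)
  (b1 : forall t, t < 1 -> 0 < b t).

Lemma b_ge0 t : 0 <= b t.
Proof. by have [/b0 ->|/b1/ltW] := leP 1 t. Qed.

(** The substitution u = sin t / s. *)
Lemma radial_avg_monomial m : exists2 mu : R, 0 < mu &
  forall s : R, 0 < s < 1 -> radial_avg m 1 b (s ^- 2) = s ^+ m.+1 * mu.
Proof.
pose g (u : R) := b (u ^+ 2) * u ^+ m.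
have cg : continuous g.
  apply: cont_mul; last exact: exprn_continuous.
  by apply: cont_comp cb _; exact: exprn_continuous.
have [G dG] := primitive (-1) cg.
have dG0 (u : R) : 0 <= u -> is_derive u 1 G (g u).
  by move=> u0; apply: dG; apply: lt_le_trans u0; rewrite oppr_lt0.
exists (G 1 - G 0).
  have [||c c01 ->] := @MVT R G g 0 1 ltr01 _ _.
  - by move=> x; rewrite in_itv /= => /andP[/ltW x0 _]; exact: dG0.
  - apply: derivable_within_continuous => t; rewrite in_itv /= => /andP[t0 _].
    by have [] := dG0 t t0.
  - move: c01; rewrite in_itv /= => /andP[c0 c1].
    rewrite subr0 mulr1 /g mulr_gt0 ?exprn_gt0 // b1 // expr_lt1 // ltW //.
move=> s /andP[s0 s1].
pose F t := s ^+ m.+1 * G (sin t / s).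
have cf := @continuous_radial_integrand m 1 b (s ^- 2) cb.
have dF t : 0 <= t <= pi / 2 ->
    is_derive t 1 F (b (s ^- 2 * sin t ^+ 2) * sin t ^+ m * cos t ^+ 1).
  move=> t01; have [st0 ct0] := sin_cos_ge0 t01.
  have d1 : is_derive t 1 (fun t => sin t / s) (cos t / s).
    have -> : (fun t : R => sin t / s) = s^-1 \*: @sin R.
      by apply/funext => x; rewrite /= mulrC.
    by rewrite mulrC; exact: is_deriveZ.
  have st : 0 <= sin t / s by rewrite divr_ge0 // ltW.
  have d2 := @is_derive1_comp _ G _ t _ _ (dG0 _ st) d1.
  have := is_deriveZ (s ^+ m.+1) d2.
  rewrite /g /F; congr is_derive.
  rewrite [_ *: _ in LHS]/GRing.scale /= expr1 !expr_div_n exprS.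
  rewrite (mulrC (s ^- 2)).
  by field; rewrite gt_eqF //= expf_neq0 // gt_eqF.
rewrite /radial_avg (segint_derive pihalf_ge0 cf dF).
rewrite /F sin_pihalf sin0 mul0r mul1r -mulrBr; congr (_ * (_ - _)).
apply: is_derive_eq0_le; first by rewrite ltW // invf_gt1.
move=> t /andP[t1 _]; have := dG0 t (le_trans ler01 t1).
by rewrite /g b0 ?mul0r // -[leLHS](expr1n _ 2) ler_sqr ?nnegrE // (le_trans _ t1).
Qed.

Lemma cos_pow_half (t : R) : 0 < cos t ->
  cos t ^+ q = cos t * (1 - sin t ^+ 2) `^ ((q%:R - 1) / 2).
Proof.
move=> ct; have c0 := ltW ct.
have -> : 1 - sin t ^+ 2 = cos t `^ 2%:R by rewrite powR_mulrn // cos2sin2.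
rewrite -powRrM -[in RHS](powRr1 c0) -powRrM -powRD; last first.
  by apply/implyP => _; rewrite gt_eqF.
by rewrite -powR_mulrn //; congr (_ `^ _); field.
Qed.

(** Write cos t ^+ q as (1 - sin t ^+ 2) to the power (q - 1) / 2 times cos t, and
    expand that power in the binomial series. For q even the exponent is not a
    natural number, so the series does not terminate and no coefficient is 0;
    for q odd it would be a polynomial, and this is where parity matters. *)
Lemma radial_avg_asymptotics : ~~ odd q ->
  exists2 c : nat -> R, (forall i, c i != 0) &
  forall J, exists C : R, forall s : R, 0 < s -> s ^+ 2 <= 1 / 2 ->
  `|radial_avg p q b (s ^- 2) - s ^+ p.+1 * \sum_(i < J) c i * (s ^+ 2) ^+ i| <=
  C * (s ^+ p.+1 * (s ^+ 2) ^+ J).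
Proof.
move=> q_even; pose a : R := (q%:R - 1) / 2.
have aN (j : nat) : a != j%:R.
  apply/eqP => aj; have : q = (j.*2.+1)%N.
    apply/eqP; rewrite -(eqr_nat R) -muln2 -natr1 natrM -aj /a.
    by apply/eqP; field.
  by move=> qj; move: q_even; rewrite qj /= odd_double.
have /choice[mu muP] : forall i, exists mu : R, 0 < mu /\
    forall s : R, 0 < s < 1 -> radial_avg (p + i.*2) 1 b (s ^- 2) = s ^+ (p + i.*2).+1 * mu.
  by move=> i; have [mu ? ?] := radial_avg_monomial (p + i.*2); exists mu.
exists (fun i => binom_coef a i * mu i).
  by move=> i; rewrite mulf_neq0 ?binom_coef_neq0 // gt_eqF; have [] := muP i.
move=> J; have [C C0 HC] := binom_taylor J a.
exists (C * mu J) => s s0 s2.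
have s1 : s < 1.
  by rewrite -(@ltr_pXn2r _ 2) ?nnegrE ?(ltW s0) // expr1n; lra.
have muE i : s ^+ p.+1 * (mu i * (s ^+ 2) ^+ i) = radial_avg (p + i.*2) 1 b (s ^- 2).
  have [_ ->] := muP i; last by rewrite s0.
  by rewrite -exprM -mul2n -addSn exprD; ring.
rewrite mulr_sumr (eq_bigr (fun i : 'I_J => binom_coef a i * radial_avg (p + i.*2) 1 b (s ^- 2))); last first.
  by move=> i _; rewrite -muE; ring.
rewrite (_ : C * mu J * _ = C * radial_avg (p + J.*2) 1 b (s ^- 2)); last first.
  by rewrite -muE; ring.
rewrite /radial_avg.
have cI i := @continuous_radial_integrand (p + i.*2) 1 b (s ^- 2) cb.
under eq_bigr do rewrite -segintZ //.
rewrite -[X in `|_ - X|](@segint_sum _ 0 (pi / 2) J (fun i t => binom_coef a i *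
   (b (s ^- 2 * sin t ^+ 2) * sin t ^+ (p + i.*2) * cos t ^+ 1))); last first.
  by move=> i; apply: cont_mul => //; exact: cont_cst.
have cS : continuous (fun t : R => \sum_(i < J) binom_coef a i *
   (b (s ^- 2 * sin t ^+ 2) * sin t ^+ (p + i.*2) * cos t ^+ 1)).
  by apply: cont_sum => i _; apply: cont_mul => //; exact: cont_cst.
have cM := @continuous_radial_integrand p q b (s ^- 2) cb.
have cD := cont_add cM (cont_opp cS).
rewrite -segintB //; apply: le_trans (norm_segint _ _ cD) _.
rewrite -segintZ //; apply: le_segint.
- by apply: cont_comp cD; exact: norm_continuous.
- by apply: cont_mul => //; exact: cont_cst.
move=> t t01; have [st0 ct0] := sin_cos_ge0 t01.
set B := b _; have B0 : 0 <= B by exact: b_ge0.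
have [sst|sst] := leP (s ^+ 2) (sin t ^+ 2).
  have -> : B = 0 by rewrite /B b0 // mulrC ler_pdivlMr ?exprn_gt0 // mul1r.
  rewrite !mul0r mulr0 sub0r big1 ?oppr0 ?normr0 // => i _.
  by rewrite !mul0r mulr0.
have sin2 : sin t ^+ 2 <= 1 / 2 by apply: le_trans (ltW sst) s2.
have ct : 0 < cos t.
  rewrite lt_def ct0 andbT -sqrf_eq0 cos2sin2 subr_eq0; apply/eqP => E.
  by move: sin2; rewrite -E; lra.
rewrite cos_pow_half // -/a.
rewrite (_ : _ - _ = B * sin t ^+ p * cos t *
  ((1 - sin t ^+ 2) `^ a - \sum_(i < J) binom_coef a i * (sin t ^+ 2) ^+ i)); last first.
  rewrite mulrBr; congr (_ - _); first by ring.
  by rewrite mulr_sumr; apply: eq_bigr => i _; rewrite -exprM -mul2n exprD; ring.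
rewrite normrM ger0_norm ?mulr_ge0 ?exprn_ge0 //.
apply: le_trans (ler_wpM2l _ (HC _ _)) _; first by rewrite !mulr_ge0 ?exprn_ge0.
  by rewrite sqr_ge0.
by rewrite -exprM -mul2n exprD le_eqVlt; apply/orP; left; apply/eqP; ring.
Qed.

End Asymptotics.
End RadialAverage.

(** * Flat functions *)

Section ExpBump.
Context {R : realType}.

Lemma exp_taylor (s u : R) J : 0 <= s <= 1 ->
  `|expR (s * u) - \sum_(i < J) (s * u) ^+ i / i`!%:R| <= (s / 2) ^+ J * expR (2 * `|u|).
Proof.
move=> /andP[s0 s1].
pose T N (x : R) := \sum_(0 <= i < N) x ^+ i / i`!%:R.
have TE (x : R) : T^~ x @ \oo --> expR x by exact: is_cvg_series_exp_coeff.
have Tle (x : R) N : 0 <= x -> T N x <= expR x.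
  move=> x0; apply: (@nondecreasing_cvgn_le _ (T^~ x)); last exact: cvgP (TE x).
    apply/nondecreasing_seqP => k; rewrite /T big_nat_recr //= lerDl.
  by rewrite divr_ge0 // exprn_ge0.
rewrite -(big_mkord xpredT (fun i => (s * u) ^+ i / i`!%:R)) -/(T J (s * u)).
have H : (fun N => `|T N (s * u) - T J (s * u)|) @ \oo --> `|expR (s * u) - T J (s * u)|.
  by apply: cvg_norm; apply: cvgB; [exact: TE|exact: cvg_cst].
apply: (cvgr_to_le H); near=> N.
have JN : (J <= N)%N by near: N; exact: nbhs_infty_ge.
rewrite /T (big_cat_nat (n := J)) //= addrAC subrr add0r.
apply: le_trans (ler_norm_sum _ _ _) _.
apply: (@le_trans _ _ ((s / 2) ^+ J * \sum_(J <= i < N) (2 * `|u|) ^+ i / i`!%:R)).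
  rewrite mulr_sumr big_seq [leRHS]big_seq; apply: ler_sum => i.
  rewrite mem_index_iota => /andP[Ji iN].
  rewrite normrM normfV (ger0_norm (ler0n _ _)) mulrA ler_wpM2r ?invr_ge0 //.
  rewrite normrX normrM (ger0_norm s0) !exprMn mulrA ler_wpM2r ?exprn_ge0 //.
  rewrite -[in leLHS](subnK Ji) -[in leRHS](subnK Ji) !exprD mulrC.
  rewrite (_ : _ * _ * _ = s ^+ J * 2 ^+ (i - J)); last first.
    by rewrite exprVn; field; rewrite expf_neq0.
  rewrite ler_wpM2l ?exprn_ge0 // lerXn2r ?nnegrE //.
  by rewrite (le_trans s1) // ler1n.
rewrite ler_wpM2l ?exprn_ge0 ?divr_ge0 //.
apply: le_trans (Tle (2 * `|u|) N _); last by rewrite mulr_ge0.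
by rewrite /T [leRHS](big_cat_nat (n := J)) //= lerDr sumr_ge0 // => i _; rewrite divr_ge0 // exprn_ge0 // mulr_ge0.
Unshelve. all: by end_near. Qed.

Lemma monomial_le_exp (u : R) i : 0 <= u -> u ^+ i <= i`!%:R * expR u.
Proof.
move=> u0; rewrite -ler_pdivrMl ?ltr0n ?fact_gt0 // mulrC.
have c0 k : 0 <= exp_coeff u k by rewrite /exp_coeff /= divr_ge0 // exprn_ge0.
have nd : nondecreasing_seq (series (exp_coeff u)).
  by apply/nondecreasing_seqP => k; rewrite /series /= big_nat_recr //= lerDl.
have := nondecreasing_cvgn_le nd (is_cvg_series_exp_coeff u) i.+1.
rewrite {1}/series /= big_nat_recr //=; apply: le_trans.
by rewrite lerDr sumr_ge0.
Qed.

Lemma poly_le_exp (p : {poly R}) : exists2 C : R, 0 <= C &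
  forall u, 0 <= u -> `|p.[u]| <= C * expR u.
Proof.
exists (\sum_(i < size p) `|p`_i| * i`!%:R).
  by apply: sumr_ge0 => i _; rewrite mulr_ge0.
move=> u u0; rewrite horner_coef mulr_suml; apply: le_trans (ler_norm_sum _ _ _) _.
apply: ler_sum => i _; rewrite normrM normrX (ger0_norm u0) -mulrA ler_wpM2l //.
exact: monomial_le_exp.
Qed.

(** Derivatives of exp (-1/t) have the form p(1/t) exp (-1/t). *)
Definition flat (p : {poly R}) (t : R) : R :=
  if 0 < t then p.[t^-1] * expR (- t^-1) else 0.

Lemma flat_bound p : exists2 C : R, 0 <= C & forall t, `|flat p t| <= C * t ^+ 2.
Proof.
have [C C0 HC] := poly_le_exp ('X^2 * p); exists C => // t.
rewrite /flat; case: ifPn => t0; last by rewrite normr0 mulr_ge0 // sqr_ge0.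
have ti : 0 <= t^-1 by rewrite invr_ge0 ltW.
have := HC _ ti; rewrite hornerM hornerXn normrM (ger0_norm (exprn_ge0 _ ti)) => H.
rewrite normrM (ger0_norm (expR_ge0 _)) expRN ler_pdivrMr ?expR_gt0 //.
rewrite mulrAC -ler_pdivrMr ?exprn_gt0 // mulrC -exprVn //.
Qed.

Lemma near_lt (t a : R) : t < a -> \forall x \near t, x < a.
Proof. by move=> ta; apply: open_nbhs_nbhs; split => //; exact: open_lt. Qed.

Lemma near_gt (t a : R) : a < t -> \forall x \near t, a < x.
Proof. by move=> ta; apply: open_nbhs_nbhs; split => //; exact: open_gt. Qed.

Lemma is_derive_flat (p : {poly R}) (t : R) : is_derive t 1 (flat p) (flat ('X^2 * (p - p^`())) t).
Proof.
have [t0|t0|t0] := ltgtP t 0.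
- have -> : flat ('X^2 * (p - p^`())) t = 0 by rewrite /flat ltNge (ltW t0).
  have H : \near t, cst 0 t = flat p t.
    near=> x; rewrite /flat ltNge (_ : x <= 0) //.
    by apply: ltW; near: x; exact: near_lt.
  by apply: (near_eq_is_derive H); exact: is_derive_cst.
- have tn0 : t != 0 by rewrite gt_eqF.
  have H : \near t, p.[t^-1] * expR (- t^-1) = flat p t.
    near=> x; rewrite /flat (_ : 0 < x) //.
    by near: x; exact: near_gt.
  apply: (near_eq_is_derive H).
  have d1 : is_derive t 1 (fun x : R => x^-1) (- t ^- 2).
    have := @is_deriveV _ id t 1 1 tn0 (is_derive_id _ _).
    by congr is_derive; rewrite /GRing.scale /= mulr1.
  have d2 := is_deriveN d1.
  have d3 := @is_derive1_comp _ expR (\- (fun x : R => x^-1)) t _ _ (is_derive_expR _) d2.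
  have d4 := @is_derive1_comp _ (horner p) (fun x : R => x^-1) t _ _ (is_derive_poly p _) d1.
  have := is_deriveM d4 d3.
  rewrite /flat t0.
  congr is_derive; rewrite /GRing.scale /= !hornerE /=; field.
  by rewrite tn0.
- have -> : flat ('X^2 * (p - p^`())) t = 0 by rewrite /flat t0 ltxx.
  rewrite t0.
  have [C C0 HC] := flat_bound p.
  have H : (fun h => h^-1 *: (flat p (h *: 1 + 0) - flat p 0)) @ 0^' --> (0 : R).
    have C1 : 0 < C + 1 by rewrite ltr_wpDl.
    apply/cvgrPdist_le => e e0; near=> h.
    rewrite sub0r normrN addr0 [h *: 1]mulr1 {2}/flat ltxx subr0 [_ *: _]/(_ * _) normrM normfV.
    have h0 : h != 0 by near: h; exact: nbhs_dnbhs_neq.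
    rewrite mulrC ler_pdivrMr ?normr_gt0 //; apply: le_trans (HC h) _.
    rewrite -real_normK ?num_real // expr2 mulrA ler_wpM2r //.
    have : `|h| <= e / (C + 1) by near: h; apply: dnbhs0_le; exact: divr_gt0.
    rewrite ler_pdivlMr // => he; apply: le_trans he.
    by rewrite mulrC ler_wpM2l // lerDl.
  apply: DeriveDef; first by apply/cvg_ex; exists 0.
  exact/cvg_lim.
Unshelve. all: by end_near. Qed.

Lemma is_derive_continuous (f f' : R -> R) :
  (forall t : R, is_derive t 1 f (f' t)) -> continuous f.
Proof.
move=> df t; apply: differentiable_continuous; apply/derivable1_diffP.
by have [] := df t.
Qed.

Lemma continuous_flat p : continuous (flat p).
Proof. by apply: is_derive_continuous => t; exact: is_derive_flat. Qed.

End ExpBump.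

(** * Uniqueness from radial averages *)

Section TameIntegral.
Context {R : realType} {n : nat}.
Notation lam := (@lebesgue_rV R n).
Implicit Types f g : 'rV[R]_n -> R.

Definition lint (f : 'rV[R]_n -> R) : R := \int[lam]_y f y.
Definition litg (f : 'rV[R]_n -> R) := lam.-integrable setT (EFin \o f).

Lemma lintD f g : litg f -> litg g -> lint (fun y => f y + g y) = lint f + lint g.
Proof. by move=> If Ig; exact: RintegralD. Qed.

Lemma lintB f g : litg f -> litg g -> lint (fun y => f y - g y) = lint f - lint g.
Proof. by move=> If Ig; exact: RintegralB. Qed.

Lemma lintZ c f : litg f -> lint (fun y => c * f y) = c * lint f.
Proof. by move=> If; exact: RintegralZl. Qed.

Lemma le_lint f g : litg f -> litg g -> (forall y, f y <= g y) -> lint f <= lint g.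
Proof. by move=> If Ig fg; exact: le_Rintegral. Qed.

Lemma lint_ge0 f : (forall y, 0 <= f y) -> 0 <= lint f.
Proof. by move=> f0; exact: Rintegral_ge0. Qed.

Lemma norm_lint f : litg f -> `|lint f| <= lint (fun y => `|f y|).
Proof. by move=> If; exact: le_normr_Rintegral. Qed.

Lemma litgZ c f : litg f -> litg (fun y => c * f y).
Proof. by move=> If; apply: eq_integrable (integrableZl measurableT c If). Qed.

Lemma litgD f g : litg f -> litg g -> litg (fun y => f y + g y).
Proof. by move=> If Ig; apply: eq_integrable (integrableD measurableT If Ig). Qed.

Lemma litgB f g : litg f -> litg g -> litg (fun y => f y - g y).
Proof. by move=> If Ig; apply: eq_integrable (integrableB measurableT If Ig). Qed.

Lemma litg_norm f : litg f -> litg (fun y => `|f y|).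
Proof. by move=> If; apply: eq_integrable (integrable_norm If). Qed.

Lemma lint0 : lint (fun=> 0) = 0.
Proof. by rewrite /lint Rintegral_cst // mul0r. Qed.

Lemma litg0 : litg (fun=> 0).
Proof. exact: integrable0. Qed.

Lemma litg_sum I (r : seq I) (f : I -> 'rV[R]_n -> R) :
  (forall i, litg (f i)) -> litg (fun y => \sum_(i <- r) f i y).
Proof.
move=> If; elim: r => [|i r IH].
  by rewrite (_ : (fun y => _) = fun=> 0) ?litg0 //; apply/funext => y; rewrite big_nil.
rewrite (_ : (fun y => _) = fun y => f i y + \sum_(j <- r) f j y); last first.
  by apply/funext => y; rewrite big_cons.
exact: litgD.
Qed.

Lemma lint_sum I (r : seq I) (f : I -> 'rV[R]_n -> R) :
  (forall i, litg (f i)) ->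
  lint (fun y => \sum_(i <- r) f i y) = \sum_(i <- r) lint (f i).
Proof.
move=> If; elim: r => [|i r IH].
  rewrite big_nil -[RHS]lint0; congr lint.
  by apply/funext => y; rewrite big_nil.
rewrite big_cons -IH -lintD //; last exact: litg_sum.
by congr lint; apply/funext => y; rewrite big_cons.
Qed.

Lemma litg_tameM f g B : tame f -> continuous g -> (forall y, `|g y| <= B) ->
  litg (fun y => f y * g y).
Proof. by move=> tf cg gB; apply: tame_integrable; exact: tameM tf cg gB. Qed.

Lemma tameN f : tame f -> tame (fun y => - f y).
Proof.
move=> [cf [C C0 fC]]; split; first exact: cont_opp.
by exists C => // y; rewrite normrN.
Qed.

End TameIntegral.

Section ContinuousRadialAverage.
Context {R : realType}.

Lemma sin_pow_cos_pow_le1 p q (t : R) : 0 <= t <= pi / 2 ->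
  0 <= sin t ^+ p * cos t ^+ q <= 1.
Proof.
move=> /sin_cos_ge0[s0 c0]; rewrite mulr_ge0 ?exprn_ge0 //=.
by rewrite mulr_ile1 ?exprn_ge0 ?exprn_ile1 ?sin_le1 ?cos_le1.
Qed.

Lemma continuous_bounded_segment (h : R -> R) (a c : R) : continuous h ->
  exists2 B : R, 0 <= B & forall t, a <= t <= c -> `|h t| <= B.
Proof.
move=> ch; have := @continuous_compact _ _ h _ (continuous_subspaceT ch) (@segment_compact R a c).
move=> /compact_bounded[M [Mr MP]]; exists (`|M| + 1); first by rewrite addr_ge0.
move=> x xac; apply: MP => /=; first by rewrite ltr_pwDr // ler_norm.
by exists x => //; rewrite /= in_itv.
Qed.

Lemma sqr_sin_le1 (t : R) : sin t ^+ 2 <= 1.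
Proof. by rewrite -(cos2Dsin2 t) lerDr sqr_ge0. Qed.

Lemma le_radial_avg p q (h : R -> R) (rho B : R) : continuous h -> 0 <= rho ->
  (forall t, 0 <= t <= rho -> `|h t| <= B) ->
  `|radial_avg p q h rho| <= B * (pi / 2).
Proof.
move=> ch rho0 hB; have cf := @continuous_radial_integrand R p q h rho ch.
have B0 : 0 <= B by apply: le_trans (hB 0 _) => //; rewrite lexx.
apply: le_trans (norm_segint _ _ cf) _.
rewrite -[X in B * X]subr0 -segint_cst ?pihalf_ge0 //; apply: le_segint.
- by apply: cont_comp cf; exact: norm_continuous.
- exact: cont_cst.
move=> t t01; rewrite -mulrA normrM.
have /andP[sc0 sc1] := sin_pow_cos_pow_le1 p q t01.
rewrite (ger0_norm sc0) -[leRHS]mulr1 ler_pM // hB //.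
by rewrite mulr_ge0 ?sqr_ge0 // ler_piMr // sqr_sin_le1.
Qed.

Lemma continuous_radial_avg p q (h : R -> R) : continuous h ->
  continuous (radial_avg p q h).
Proof.
move=> ch rho; apply/cvgrPdist_le => /= e e0.
have e2 : 0 < e / (pi / 2) by rewrite divr_gt0 // divr_gt0 // pi_gt0.
have [d d0 hd] := compact_unif_continuous
  (@segment_compact R (- (`|rho| + 1)) (`|rho| + 1)) ch e2.
apply: filterS (nbhsx_ballx rho d d0) => r rd.
have cf x := @continuous_radial_integrand R p q h x ch.
rewrite /radial_avg -segintB //.
apply: le_trans (norm_segint _ _ _) _; first by apply: cont_add => //; exact: cont_opp.
have -> : e = segint 0 (pi / 2) (fun=> e / (pi / 2)).
  by rewrite segint_cst ?pihalf_ge0 // subr0 divfK // gt_eqF // divr_gt0 // pi_gt0.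
apply: le_segint.
- by apply: cont_comp; [exact: norm_continuous|apply: cont_add => //; exact: cont_opp].
- exact: cont_cst.
move=> t t01; rewrite -!mulrA -mulrBl normrM.
have /andP[sc0 sc1] := sin_pow_cos_pow_le1 p q t01.
rewrite (ger0_norm sc0) -[leRHS]mulr1 ler_pM // ltW // hd //=.
  rewrite in_itv /= -ler_norml (@le_trans _ _ `|rho|) ?lerDl //.
  by rewrite normrM (ger0_norm (sqr_ge0 (sin t))) ler_piMr // sqr_sin_le1.
rewrite -mulrBl normrM (ger0_norm (sqr_ge0 _)); apply: le_lt_trans rd.
by rewrite ler_piMr // sqr_sin_le1.
Qed.
End ContinuousRadialAverage.

Section Core.
Context {R : realType} {n : nat}.
Implicit Types f : 'rV[R]_n -> R.

Lemma continuous_sqdist (x : 'rV[R]_n) : continuous (fun y : 'rV[R]_n => sqnorm (y - x)).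
Proof.
have -> : (fun y : 'rV[R]_n => sqnorm (y - x)) = fun y => sqnorm y + - 2 * dotp y x + sqnorm x.
  apply/funext => y; rewrite sqnormD sqnormN dotpC -scaleN1r dotpZl (dotpC x).
  by congr (_ + _ + _); ring.
apply: cont_add; last exact: cont_cst.
apply: cont_add; first exact: continuous_sqnorm.
by apply: cont_mul; [exact: cont_cst|exact: continuous_dotp].
Qed.

Lemma continuous_gaussian (c : R) (x : 'rV[R]_n) :
  continuous (fun y : 'rV[R]_n => expR (- c * sqnorm (y - x))).
Proof.
apply: cont_comp; first exact: continuous_expR.
by apply: cont_mul; [exact: cont_cst|exact: continuous_sqdist].
Qed.

Lemma gaussian_le1 (c : R) (x : 'rV[R]_n) : 0 < c -> expR (- c * sqnorm x) <= 1.
Proof.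
by move=> c0; rewrite expR_le1 mulNr oppr_le0 mulr_ge0 ?sqnorm_ge0 // ltW.
Qed.

(** If [f z > 0], the integral of f against a Gaussian concentrated at z is
    eventually positive. *)
Lemma gaussian_orthogonal_le0 f z : tame f ->
  (forall c : R, 0 < c -> lint (fun y => f y * expR (- c * sqnorm (y - z))) = 0) ->
  f z <= 0.
Proof.
move=> tf H; rewrite leNgt; apply/negP => fz.
pose d := f z / 2.
have d0 : 0 < d by rewrite divr_gt0.
have [e e0 fe] : exists2 e : R, 0 < e & forall y, sqnorm (y - z) <= e ^+ 2 -> d <= f y.
  have /cvgrPdist_le/(_ _ d0)/nbhs_ballP[e /= e0 He] := tf.1 z.
  exists (e / 2); first exact: divr_gt0.
  move=> y yz; have : `|f z - f y| <= d.
    apply: He; rewrite -ball_normE /= distrC.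
    apply: (@le_lt_trans _ _ (e / 2)); last by rewrite ltr_pdivrMr // ltr_pMr // ltr1n.
    rewrite -ler_sqr ?nnegrE ?divr_ge0 ?(ltW e0) //.
    exact: le_trans (norm_le_sqnorm _) yz.
  by rewrite ler_norml => /andP[_]; rewrite lerBlDr -lerBlDl; apply: le_trans; rewrite /d; lra.
pose B := [set y : 'rV[R]_n | sqnorm (y - z) <= (e / 2) ^+ 2].
pose vol := fine (lebesgue_rV n (eball n ((e / 2) ^+ 2))).
have e20 : 0 < e / 2 by rewrite divr_gt0.
have vol0 : 0 < vol.
  rewrite fine_gt0 // lebesgue_eball_lty andbT lebesgue_eball_gt0 // exprn_gt0 //.
have BE : B = (fun y => y + - z) @^-1` eball n ((e / 2) ^+ 2) by [].
have mB : measurable (B : set (borel_rV n)).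
  apply: closed_borel_rV.
  rewrite (_ : B = (fun y : 'rV[R]_n => sqnorm (y - z)) @^-1` [set r | r <= (e / 2) ^+ 2]) //.
  by apply: closed_comp; [move=> y _; exact: continuous_sqdist|exact: closed_le].
have volB : lebesgue_rV n B = lebesgue_rV n (eball n ((e / 2) ^+ 2)).
  by rewrite BE lebesgue_rV_translation //; exact: measurable_eball.
have IB : lint (\1_B) = vol.
  by rewrite /lint /Rintegral integral_indic // setIT; exact: (congr1 fine volB).
have litB : litg (\1_B : 'rV[R]_n -> R).
  apply/integrableP; split; first by apply/measurable_EFinP; exact: measurable_indic.
  under eq_integral do rewrite /= ger0_norm //.
  rewrite integral_indic // setIT; apply: le_lt_trans (lebesgue_eball_lty n ((e / 2) ^+ 2)).
  by rewrite le_eqVlt; apply/orP; left; apply/eqP; exact: volB.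
pose M := lint (fun y => `|f y|).
have key c : 0 < c -> d * expR (- c * (e / 2) ^+ 2) * vol <= expR (- c * e ^+ 2) * M.
  move=> c0.
  have L1 : litg (fun y => f y * expR (- c * sqnorm (y - z))).
    apply: (litg_tameM (B := 1)) => //; first exact: continuous_gaussian.
    by move=> y; rewrite ger0_norm ?expR_ge0 // gaussian_le1.
  have L2 : litg (fun y => expR (- c * e ^+ 2) * `|f y|).
    by apply: litgZ; apply: litg_norm; exact: tame_integrable.
  rewrite -IB -lintZ // -lintZ; last by apply: litg_norm; exact: tame_integrable.
  rewrite -[leRHS]add0r -(H c c0) -lintD //; apply: le_lint.
  - exact: litgZ.
  - exact: litgD.
  move=> y; rewrite indicE; have E0 x := expR_ge0 (x : R).
  have mono a b : a <= b -> expR (- c * b) <= expR (- c * a).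
    by move=> ab; rewrite ler_expR !mulNr lerN2 ler_wpM2l // ltW.
  have e2e : (e / 2) ^+ 2 <= e ^+ 2.
    by rewrite ler_sqr ?nnegrE ?(ltW e0) ?(ltW e20) // ler_pdivrMr // ler_peMr ?ltW // ltr1n.
  have [yB|yB] := boolP (y \in B).
    rewrite mulr1; move: yB; rewrite inE /B /= => yB.
    apply: (@le_trans _ _ (f y * expR (- c * sqnorm (y - z)))); last first.
      by rewrite lerDl mulr_ge0.
    by rewrite ler_pM ?(ltW d0) // ?mono // fe // (le_trans yB).
  rewrite mulr0; have [yz|yz] := leP (sqnorm (y - z)) (e ^+ 2).
    by rewrite addr_ge0 // mulr_ge0 // (le_trans (ltW d0)) // fe.
  rewrite -lerBlDr sub0r; apply: (@le_trans _ _ (- (`|f y| * expR (- c * sqnorm (y - z))))).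
    by rewrite lerN2 mulrC ler_wpM2r // mono // ltW.
  by rewrite -mulNr ler_wpM2r // lerNnormlW.
have M0 : 0 <= M by exact: lint_ge0.
have dv : 0 < d * vol by rewrite mulr_gt0.
have bound c : 0 < c -> (1 + c * (3 / 4 * e ^+ 2)) * (d * vol) <= M.
  move=> c0; apply: (@le_trans _ _ (expR (c * (3 / 4 * e ^+ 2)) * (d * vol))).
    by rewrite ler_wpM2r ?(ltW dv) // expR_ge1Dx.
  have := key c c0; rewrite mulrAC -ler_pdivlMr ?expR_gt0 // -expRN => H1.
  rewrite mulrC -ler_pdivlMr ?expR_gt0 // -expRN.
  apply: le_trans H1 _; rewrite mulrAC -expRD mulrC ler_wpM2l //.
  by rewrite ler_expR le_eqVlt; apply/orP; left; apply/eqP; field.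
pose c := (M + 1) / (d * vol) / (3 / 4 * e ^+ 2).
have e3 : 0 < 3 / 4 * e ^+ 2 by rewrite mulr_gt0 ?exprn_gt0 // divr_gt0.
have c0 : 0 < c by rewrite !divr_gt0 // ltr_wpDl.
have := bound c c0; rewrite /c divfK ?gt_eqF // mulrDl divfK ?gt_eqF // mul1r.
by apply/negP; rewrite -ltNge; lra.
Qed.

(** Apply the previous inequality to f and to its opposite. *)
Lemma gaussian_orthogonal_eq0 f z : tame f ->
  (forall c : R, 0 < c -> lint (fun y => f y * expR (- c * sqnorm (y - z))) = 0) ->
  f z = 0.
Proof.
move=> tf H; apply/eqP; rewrite eq_le gaussian_orthogonal_le0 //= -oppr_le0.
apply: (gaussian_orthogonal_le0 (f := fun y => - f y)); first exact: tameN.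
move=> c c0; have L : litg (fun y => f y * expR (- c * sqnorm (y - z))).
  apply: (litg_tameM (B := 1)) => //; first exact: continuous_gaussian.
  by move=> y; rewrite ger0_norm ?expR_ge0 // gaussian_le1.
rewrite -[RHS](mulr0 (-1)) -(H c c0) -lintZ //; congr lint; apply/funext => y.
by rewrite mulN1r mulNr.
Qed.

End Core.

Section CoreOrthogonality.
Context {R : realType} {n : nat}.
Implicit Types f : 'rV[R]_n -> R.

(** Asymptotic expansions can be integrated term by term when the remainder is
    dominated, and the coefficients of an expansion of 0 vanish. *)
Lemma lint_expansion_eq0 (A : R -> 'rV[R]_n -> R) (g : nat -> 'rV[R]_n -> R) (l0 : R) :
  0 < l0 ->
  (forall l : R, 0 < l -> l < l0 -> litg (A l) /\ lint (A l) = 0) ->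
  (forall i, litg (g i)) ->
  (forall J, exists2 G : 'rV[R]_n -> R, litg G & forall (l : R) (y : 'rV[R]_n), 0 < l -> l < l0 ->
     `|A l y - \sum_(i < J.+1) g i y * l ^+ i| <= l ^+ J.+1 * G y) ->
  forall i, lint (g i) = 0.
Proof.
move=> l00 HA Hg HG; apply: (polynomial_small_coef0 l00) => J.
have [G IG GP] := HG J; exists (lint G) => l lp ll0.
have [IA A0] := HA l lp ll0.
have Igl i : litg (fun y => l ^+ i * g i y) by exact: litgZ.
have E : \sum_(i < J.+1) lint (g i) * l ^+ i = lint (fun y => \sum_(i < J.+1) l ^+ i * g i y).
  by rewrite lint_sum //; apply: eq_bigr => i _; rewrite lintZ // mulrC.
have IS : litg (fun y => \sum_(i < J.+1) l ^+ i * g i y) by exact: litg_sum.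
rewrite E -normrN -sub0r -[X in X - _]A0 -lintB // mulrC -lintZ //.
apply: le_trans (norm_lint (litgB IA IS)) _; apply: le_lint.
- exact/litg_norm/litgB.
- exact: litgZ.
move=> y; apply: le_trans _ (GP l y lp ll0); rewrite le_eqVlt; apply/orP; left; apply/eqP.
by congr (`|_ - _|); apply: eq_bigr => i _; rewrite mulrC.
Qed.

Lemma sqnormD_le (x y : 'rV[R]_n) : sqnorm (x + y) <= 2 * sqnorm x + 2 * sqnorm y.
Proof.
have := sqnorm_ge0 (x + (-1) *: y).
by rewrite !sqnormD sqnormZ (dotpC x) dotpZl (dotpC y); lra.
Qed.

Lemma gaussian_bounded_moment (c : R) (h x : 'rV[R]_n) :
  0 <= c -> expR (- c * sqnorm x) * expR (2 * `|2 * c * dotp x h|) <= expR (4 * c * sqnorm h).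
Proof.
move=> c0; rewrite -expRD ler_expR.
suff : 2 * `|dotp x h| * 2 <= sqnorm x + 4 * sqnorm h.
  move=> /(ler_wpM2l c0); rewrite !normrM (ger0_norm c0) ger0_norm // => H; lra.
have H1 := sqnorm_ge0 (x + 2 *: h); have H2 := sqnorm_ge0 (x + (-2) *: h).
move: H1 H2; rewrite !sqnormD !sqnormZ !(dotpC x) !dotpZl (dotpC h).
by move=> H1 H2; have [k|k] := leP 0 (dotp x h);
  rewrite ?(ger0_norm k) ?(ltr0_norm k); lra.
Qed.

(** Along the segment from x0 to z the integral is an entire function of the
    position, and it vanishes near x0. *)
Lemma gaussian_orthogonal_extend f (x0 z : 'rV[R]_n) (c r : R) : tame f -> 0 < c -> 0 < r ->
  (forall x : 'rV[R]_n, sqnorm (x - x0) < r -> lint (fun y => f y * expR (- c * sqnorm (y - x))) = 0) ->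
  lint (fun y => f y * expR (- c * sqnorm (y - z))) = 0.
Proof.
move=> tf c0 r0 Hx; pose h := z - x0.
pose u (y : 'rV[R]_n) := 2 * c * dotp (y - x0) h.
pose f1 (y : 'rV[R]_n) := f y * expR (- c * sqnorm (y - x0)).
have cu : continuous u.
  have -> : u = fun y => 2 * c * dotp y h + (- (2 * c * dotp x0 h)).
    by apply/funext => y; rewrite /u dotpDl -scaleN1r dotpZl; ring.
  apply: cont_add; last exact: cont_cst.
  by apply: cont_mul; [exact: cont_cst|exact: continuous_dotp].
have cE : continuous (fun y : 'rV[R]_n => expR (- c * sqnorm (y - x0))) by exact: continuous_gaussian.
have shift s y : expR (- c * sqnorm (y - (x0 + s *: h))) =
    expR (- c * s ^+ 2 * sqnorm h) * (expR (- c * sqnorm (y - x0)) * expR (s * u y)).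
  rewrite -!expRD; congr expR.
  have -> : y - (x0 + s *: h) = (y - x0) + (- s) *: h by rewrite opprD addrA scaleNr.
  by rewrite sqnormD sqnormZ sqrrN (dotpC (y - x0)) dotpZl (dotpC h) /u; ring.
have Bd (g : 'rV[R]_n -> R) C : continuous g -> (forall y, `|g y| <= C * expR (2 * `|u y|)) ->
    litg (fun y => f1 y * g y).
  move=> cg gB; have C0 : 0 <= C.
    by have := le_trans (normr_ge0 _) (gB 0); rewrite pmulr_lge0 // expR_gt0.
  rewrite (_ : (fun y => _) = fun y => f y * (expR (- c * sqnorm (y - x0)) * g y)); last first.
    by apply/funext => y; rewrite /f1 mulrA.
  apply: (litg_tameM (B := C * expR (4 * c * sqnorm h))) => //; first exact: cont_mul.
  move=> y; rewrite normrM (ger0_norm (expR_ge0 _)).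
  apply: le_trans (ler_wpM2l (expR_ge0 _) (gB y)) _.
  by rewrite mulrCA ler_wpM2l // gaussian_bounded_moment // ltW.
have e1 y : 1 <= expR (2 * `|u y|).
  by rewrite -expR0 ler_expR mulr_ge0.
have ui i y : `|u y ^+ i / i`!%:R| <= 1 * expR (2 * `|u y|).
  rewrite mul1r normrM normrX [X in _ * X]ger0_norm ?invr_ge0 // ler_pdivrMr ?ltr0n ?fact_gt0 //.
  rewrite mulrC; apply: le_trans (monomial_le_exp i (normr_ge0 _)) _.
  by rewrite ler_wpM2l // ler_expR ler_peMl // ler1n.
have cui i : continuous (fun y => u y ^+ i / i`!%:R).
  by apply: cont_mul; [exact: cont_exp|exact: cont_cst].
have Iui i : litg (fun y => f1 y * (u y ^+ i / i`!%:R)) by exact: Bd (cui i) (ui i).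
have ces s : continuous (fun y => expR (s * u y)).
  by apply: cont_comp; [exact: continuous_expR|apply: cont_mul => //; exact: cont_cst].
have Ies (s : R) : 0 <= s <= 1 -> litg (fun y => f1 y * expR (s * u y)).
  move=> /andP[s0 s1]; apply: (Bd _ 1) => // y.
  rewrite mul1r ger0_norm ?expR_ge0 // ler_expR (le_trans (ler_norm _)) //.
  by rewrite normrM (ger0_norm s0) ler_wpM2r // (le_trans s1) // ler1n.
have cN : continuous (fun y => `|f1 y|).
  by apply: cont_comp; [exact: norm_continuous|apply: cont_mul => //; exact: tf.1].
have IG : litg (fun y => `|f1 y| * expR (2 * `|u y|)).
  rewrite (_ : (fun y => _) = fun y => `|f1 y * expR (2 * `|u y|)|); last first.
    by apply/funext => y; rewrite [RHS]normrM (ger0_norm (expR_ge0 _)).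
  apply: litg_norm; apply: (Bd _ 1).
    apply: cont_comp; first exact: continuous_expR.
    apply: cont_mul; first exact: cont_cst.
    by apply: cont_comp => //; exact: norm_continuous.
  by move=> y; rewrite mul1r ger0_norm ?expR_ge0.
have tay (s : R) (y : 'rV[R]_n) J : 0 <= s <= 1 ->
    `|f1 y * expR (s * u y) - \sum_(i < J) f1 y * (u y ^+ i / i`!%:R) * s ^+ i|
    <= (s / 2) ^+ J * (`|f1 y| * expR (2 * `|u y|)).
  move=> s01; rewrite [X in `|X|](_ : _ =
      f1 y * (expR (s * u y) - \sum_(i < J) (s * u y) ^+ i / i`!%:R)); last first.
    by rewrite mulrBr mulr_sumr; congr (_ - _); apply: eq_bigr => i _; rewrite [(s * u y) ^+ i]exprMn; ring.
  by rewrite [leLHS]normrM [leRHS]mulrCA ler_wpM2l ?exp_taylor.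
have coef0 i : lint (fun y => f1 y * (u y ^+ i / i`!%:R)) = 0.
  pose l0 := Num.min 1 (Num.sqrt (r / (1 + sqnorm h))).
  have h1 : 0 < 1 + sqnorm h by rewrite ltr_wpDr ?sqnorm_ge0.
  have l00 : 0 < l0 by rewrite lt_min ltr01 sqrtr_gt0 divr_gt0.
  apply: (@lint_expansion_eq0 (fun l y => f1 y * expR (l * u y))
     (fun i y => f1 y * (u y ^+ i / i`!%:R)) l0) => //.
    move=> l lp; rewrite lt_min => /andP[l1 lr]; split; first by apply: Ies; rewrite !ltW.
    have : sqnorm (x0 + l *: h - x0) < r.
      rewrite addrC addKr sqnormZ; apply: (@le_lt_trans _ _ (l ^+ 2 * (1 + sqnorm h))).
        by rewrite ler_wpM2l ?sqr_ge0 // lerDr.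
      rewrite -ltr_pdivlMr // -[ltRHS]sqr_sqrtr ?divr_ge0 ?(ltW r0) ?(ltW h1) //.
      by rewrite ltr_sqr ?nnegrE ?sqrtr_ge0 // ltW.
    move/Hx; rewrite (_ : (fun y => f y * _) =
       fun y => expR (- c * l ^+ 2 * sqnorm h) * (f1 y * expR (l * u y))); last first.
      by apply/funext => y; rewrite shift /f1; ring.
    rewrite lintZ; last by apply: Ies; rewrite !ltW.
    by move/eqP; rewrite mulf_eq0 gt_eqF ?expR_gt0 //= => /eqP.
  move=> J; exists (fun y => `|f1 y| * expR (2 * `|u y|)) => // l y lp.
  rewrite lt_min => /andP[l1 _].
  apply: le_trans (tay l y J.+1 _) _; first by rewrite !ltW.
  rewrite ler_wpM2r ?mulr_ge0 ?expR_ge0 // lerXn2r ?nnegrE ?divr_ge0 ?(ltW lp) //.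
  by rewrite ler_pdivrMr // ler_peMr ?ler1n // ltW.
suff E0 : lint (fun y => f1 y * expR (1 * u y)) = 0.
  rewrite (_ : (fun y => f y * _) =
       fun y => expR (- c * 1 ^+ 2 * sqnorm h) * (f1 y * expR (1 * u y))); last first.
    apply/funext => y; have := shift 1 y; rewrite scale1r /h subrKC => ->.
    by rewrite /f1; ring.
  by rewrite lintZ ?E0 ?mulr0 //; apply: Ies; rewrite ler01 lexx.
have I1 : litg (fun y => f1 y * expR (1 * u y)) by apply: Ies; rewrite ler01 lexx.
pose M := lint (fun y => `|f1 y| * expR (2 * `|u y|)).
have M0 : 0 <= M by apply: lint_ge0 => y; rewrite mulr_ge0 ?expR_ge0.
have bound J : `|lint (fun y => f1 y * expR (1 * u y))| <= (1 / 2) ^+ J * M.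
  have IS : litg (fun y => \sum_(i < J) f1 y * (u y ^+ i / i`!%:R) * 1 ^+ i).
    by apply: litg_sum => i; rewrite (_ : (fun y => _) = fun y => f1 y * (u y ^+ i / i`!%:R)) //;
       apply/funext => y; rewrite expr1n mulr1.
  have S0 : lint (fun y => \sum_(i < J) f1 y * (u y ^+ i / i`!%:R) * 1 ^+ i) = 0.
    rewrite lint_sum => [|i].
      by rewrite big1 // => i _; rewrite -(coef0 i); congr lint; apply/funext => y; rewrite expr1n mulr1.
    by rewrite (_ : (fun y => _) = fun y => f1 y * (u y ^+ i / i`!%:R)) //;
       apply/funext => y; rewrite expr1n mulr1.
  rewrite -[X in `|X|]subr0 -[X in _ - X]S0 -lintB // -lintZ //.
  apply: le_trans (norm_lint (litgB I1 IS)) _; apply: le_lint.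
  - exact/litg_norm/litgB.
  - exact: litgZ.
  by move=> y; apply: tay; rewrite ler01 lexx.
apply/eqP; rewrite -normr_eq0 eq_le normr_ge0 andbT.
rewrite leNgt; apply/negP => pos; set A := `|_| in pos bound.
have [J MJ] : exists J : nat, M / A < 2 ^+ J.
  have [k Hk] : exists k : nat, M / A < k%:R.
    by exists (Num.truncn (M / A)).+1; exact: truncnS_gt.
  by exists k; apply: lt_trans Hk _; rewrite -natrX ltr_nat ltn_expl.
have := bound J; rewrite leNgt => /negP; apply.
by rewrite div1r exprVn mulrC ltr_pdivrMr ?exprn_gt0 // mulrC -ltr_pdivrMr.
Qed.

Section RadialKill.
Variables (b : R -> R) (p q : nat).
Hypotheses (cb : continuous b) (b0 : forall t, 1 <= t -> b t = 0)
  (b1 : forall t, t < 1 -> 0 < b t) (q_even : ~~ odd q).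

(** The expansion of the radial average in lambda gives the orthogonality of
    f to |y - x|^-(p+1+2i) for all i, because no coefficient vanishes when q is
    even; these functions approximate the Gaussian outside a ball around x. *)
Lemma radial_kill f (x : 'rV[R]_n) (rho l0 c : R) : tame f -> 0 < rho -> 0 < l0 -> 0 < c ->
  (forall y : 'rV[R]_n, sqnorm (y - x) < rho -> f y = 0) ->
  (forall l : R, 0 < l -> l < l0 ->
     lint (fun y => f y * radial_avg p q b (l^-1 * sqnorm (y - x))) = 0) ->
  lint (fun y => f y * expR (- c * sqnorm (y - x))) = 0.
Proof.
move=> tf rho0 l00 c0 f0 H.
pose m (y : 'rV[R]_n) : R := Num.max (sqnorm (y - x)) rho.
have rm y : rho <= m y by rewrite /m le_max lexx orbT.
have m0 y : 0 < m y by exact: lt_le_trans (rm y).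
have cm : continuous m.
  have -> : m = fun y => (sqnorm (y - x) + rho + `|sqnorm (y - x) + - rho|) / 2.
    apply/funext => y; rewrite /m; have [h|h] := leP rho (sqnorm (y - x)).
      by rewrite ger0_norm ?subr_ge0 //; field.
    by rewrite ltr0_norm ?subr_lt0 //; field.
  apply: cont_mul; last exact: cont_cst.
  apply: cont_add; first by apply: cont_add; [exact: continuous_sqdist|exact: cont_cst].
  apply: cont_comp; first exact: norm_continuous.
  by apply: cont_add; [exact: continuous_sqdist|exact: cont_cst].
have fm (g : R -> R) y : f y * g (sqnorm (y - x)) = f y * g (m y).
  have [h|h] := ltP (sqnorm (y - x)) rho; first by rewrite f0 // !mul0r.
  by rewrite /m (max_idPl h).
pose v (y : 'rV[R]_n) : R := (m y)^-1.
have v0 y : 0 < v y by rewrite invr_gt0.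
have cv : continuous v by move=> y; exact: cvgV (lt0r_neq0 (m0 y)) (cm y).
have vle y : v y <= rho^-1 by rewrite lef_pV2 ?posrE.
pose w (y : 'rV[R]_n) : R := Num.sqrt (v y) ^+ p.+1.
have w0 y : 0 <= w y by rewrite exprn_ge0 ?sqrtr_ge0.
have cw : continuous w by apply: cont_exp; apply: cont_comp cv; exact: sqrt_continuous.
pose W : R := Num.sqrt rho^-1 ^+ p.+1.
have wle y : w y <= W.
  by rewrite /w /W lerXn2r ?nnegrE ?sqrtr_ge0 // ler_sqrt // ltW // invr_gt0.
have Iwi i : litg (fun y => f y * (w y * v y ^+ i)).
  apply: (litg_tameM (B := W * rho^-1 ^+ i)) => //.
    by apply: cont_mul => //; exact: cont_exp.
  move=> y; rewrite ger0_norm ?mulr_ge0 ?exprn_ge0 ?(ltW (v0 y)) //.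
  by rewrite ler_pM // ?exprn_ge0 ?(ltW (v0 y)) // lerXn2r ?nnegrE ?(ltW (v0 y)) // ltW // invr_gt0.
have [a aN HJ] := @radial_avg_asymptotics R b p q cb b0 b1 q_even.
have orth i : lint (fun y => f y * (w y * v y ^+ i)) = 0.
  suff : lint (fun y => a i * (f y * (w y * v y ^+ i))) = 0.
    by rewrite lintZ // => /eqP; rewrite mulf_eq0 (negPf (aN i)) => /eqP.
  pose l1 := Num.min l0 (rho / 2).
  apply: (@lint_expansion_eq0 (fun l y => (Num.sqrt l ^- p.+1) * (f y * radial_avg p q b (l^-1 * m y)))
     (fun i y => a i * (f y * (w y * v y ^+ i))) l1).
  - by rewrite lt_min l00 divr_gt0.
  - move=> l lp; rewrite lt_min => /andP[ll0 _].
    have [B B0 bB] := continuous_bounded_segment 0 1 cb.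
    have cl : continuous (fun y => radial_avg p q b (l^-1 * m y)).
      apply: cont_comp; first exact: continuous_radial_avg.
      by apply: cont_mul => //; exact: cont_cst.
    have I : litg (fun y => f y * radial_avg p q b (l^-1 * m y)).
      apply: (litg_tameM (B := B * (pi / 2))) => // y.
      apply: le_radial_avg => //; first by rewrite mulr_ge0 ?invr_ge0 ?(ltW lp) ?(ltW (m0 y)).
      move=> t /andP[t0 _]; have [t1|/ltW t1] := leP t 1; first by apply: bB; rewrite t0.
      by rewrite b0 // normr0.
    split; first exact: litgZ.
    rewrite lintZ // -(mulr0 (Num.sqrt l ^- p.+1)) -(H l lp ll0); congr (_ * lint _).
    by apply/funext => y; rewrite (fm (fun D => radial_avg p q b (l^-1 * D))).
  - by move=> j; exact: litgZ.
  move=> J; have [C HC] := HJ J.+1.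
  exists (fun y => C * `|f y * (w y * v y ^+ J.+1)|).
    by apply: litgZ; exact: litg_norm.
  move=> l y lp; rewrite lt_min => /andP[_ lr].
  have s0 : 0 < Num.sqrt (l * v y) by rewrite sqrtr_gt0 mulr_gt0.
  have s2 : Num.sqrt (l * v y) ^+ 2 = l * v y by rewrite sqr_sqrtr // ltW // mulr_gt0.
  have s2le : Num.sqrt (l * v y) ^+ 2 <= 1 / 2.
    rewrite s2 /v ler_pdivrMr //; apply: le_trans (ltW lr) _.
    by rewrite mulrC mul1r ler_wpM2l.
  have := HC _ s0 s2le; rewrite s2 sqrtrM ?(ltW lp) // exprMn -/(w y) invfM /v invrK -/(v y).
  set K := Num.sqrt l ^+ p.+1.
  have K0 : 0 < K by rewrite exprn_gt0 // sqrtr_gt0.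
  set A := radial_avg _ _ _ _ => HA.
  rewrite (_ : _ - _ = K^-1 * f y * (A - K * w y * \sum_(i < J.+1) a i * (l * v y) ^+ i)); last first.
    rewrite mulrBr; congr (_ - _); first by rewrite mulrA.
    rewrite !mulr_sumr; apply: eq_bigr => j _; rewrite [(l * v y) ^+ j]exprMn.
    by field; rewrite gt_eqF.
  rewrite normrM; apply: le_trans (ler_wpM2l (normr_ge0 _) HA) _.
  rewrite !normrM normfV (gtr0_norm K0) (ger0_norm (w0 y)) (ger0_norm (exprn_ge0 _ (ltW (v0 y)))).
  by rewrite exprMn le_eqVlt; apply/orP; left; apply/eqP; field; rewrite gt_eqF.
have polyE (P : {poly R}) : lint (fun y => f y * w y * P.[v y]) = 0 /\
    litg (fun y => f y * w y * P.[v y]).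
  have -> : (fun y => f y * w y * P.[v y]) =
      fun y => \sum_(i < size P) P`_i * (f y * (w y * v y ^+ i)).
    by apply/funext => y; rewrite horner_coef mulr_sumr; apply: eq_bigr => i _; ring.
  have I (i : 'I_(size P)) : litg (fun y => P`_i * (f y * (w y * v y ^+ i))) by exact: litgZ.
  split; last exact: litg_sum.
  by rewrite lint_sum // big1 // => i _; rewrite lintZ // orth mulr0.
pose g t := Num.sqrt t ^+ p.+1 * (c ^- p.+1 * flat 'X^(p.+1) (t / c)).
have cg : continuous g.
  apply: cont_mul; first by apply: cont_exp; exact: sqrt_continuous.
  apply: cont_mul; first exact: cont_cst.
  apply: cont_comp; first exact: continuous_flat.
  by apply: cont_mul; [move=> ?; exact: cvg_id|exact: cont_cst].
have gE y : w y * g (v y) = expR (- c * m y).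
  rewrite /g /flat divr_gt0 // hornerXn mulrA -exprMn -expr2 sqr_sqrtr ?(ltW (v0 y)) //.
  rewrite invf_div exprMn /v invrK mulNr exprVn.
  have : m y ^+ p.+1 != 0 by rewrite expf_neq0 // gt_eqF.
  have : c ^+ p.+1 != 0 by rewrite expf_neq0 // gt_eqF.
  set X := c ^+ _; set Y := m y ^+ _ => X0 Y0.
  by rewrite -(mulrA X) !mulKf.
have -> : (fun y => f y * expR (- c * sqnorm (y - x))) = fun y => f y * w y * g (v y).
  by apply/funext => y; rewrite (fm (fun D => expR (- c * D))) -gE mulrA.
have Ig : litg (fun y => f y * w y * g (v y)).
  rewrite (_ : (fun y => _) = fun y => f y * expR (- c * m y)); last first.
    by apply/funext => y; rewrite -gE mulrA.
  apply: (litg_tameM (B := 1)) => //.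
    apply: cont_comp; first exact: continuous_expR.
    by apply: cont_mul => //; exact: cont_cst.
  move=> y; rewrite ger0_norm ?expR_ge0 // expR_le1 mulNr oppr_le0 mulr_ge0 // ltW //.
have Iw : litg (fun y => `|f y * w y|).
  by apply: litg_norm; apply: (litg_tameM (B := W)) => // y; rewrite ger0_norm.
pose M := lint (fun y => `|f y * w y|).
have M0 : 0 <= M by exact: lint_ge0.
apply/eqP; rewrite -normr_eq0 eq_le normr_ge0 andbT; apply/ler_addgt0Pr => e e0.
rewrite add0r; have e1 : 0 < e / (M + 1) by rewrite divr_gt0 // ltr_wpDl.
have ir : 0 < rho^-1 by rewrite invr_gt0.
have [P HP] := weierstrass ir cg e1; have [P0 IP] := polyE P.
rewrite -[X in `|X|]subr0 -[X in _ - X]P0 -lintB //.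
apply: le_trans (norm_lint (litgB Ig IP)) _.
apply: (@le_trans _ _ (e / (M + 1) * M)); last first.
  by rewrite -mulrA ler_piMr ?(ltW e0) // mulrC ler_pdivrMr ?ltr_wpDl // mul1r lerDl.
rewrite -lintZ //; apply: le_lint; [exact/litg_norm/litgB|exact: litgZ|].
move=> y; rewrite -mulrBr normrM mulrC ler_wpM2r // HP //.
by rewrite ltW //= vle.
Qed.

(** The uniqueness theorem behind both halves of the result. Orthogonality to the
    radial averages centred near x0 gives orthogonality to all Gaussians centred
    near x0, then, by analyticity in the centre, to all Gaussians. *)
Theorem radial_orthogonal_eq0 f (x0 : 'rV[R]_n) (r l0 : R) : tame f -> 0 < r -> 0 < l0 ->
  (forall y : 'rV[R]_n, sqnorm (y - x0) < r -> f y = 0) ->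
  (forall (l : R) (x : 'rV[R]_n), 0 < l -> l < l0 -> sqnorm (x - x0) < r ->
     lint (fun y => f y * radial_avg p q b (l^-1 * sqnorm (y - x))) = 0) ->
  forall z, f z = 0.
Proof.
move=> tf r0 l00 f0 H z; apply: gaussian_orthogonal_eq0 => // c c0.
have r4 : 0 < r / 4 by rewrite divr_gt0.
apply: (@gaussian_orthogonal_extend f x0 z c _ tf c0 r4) => x xr.
apply: (radial_kill tf r4 l00 c0).
  move=> y yx; apply: f0; have -> : y - x0 = (y - x) + (x - x0) by rewrite addrA subrK.
  by apply: le_lt_trans (sqnormD_le _ _) _; move: xr yx; lra.
move=> l lp ll0; apply: H => //; apply: lt_le_trans xr _.
by rewrite ler_pdivrMr // ler_peMr ?(ltW r0) // ler1n.
Qed.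

End RadialKill.
End CoreOrthogonality.

(** * Averages over random projections *)

Section FiniteMeasure.
Context {R : realType} d (T : measurableType d) (mu : {measure set T -> \bar R}) (D : set T).
Hypotheses (mD : measurable D) (muD : (mu D < +oo)%E).
Implicit Types f g : T -> R.

Definition bounded_meas f := measurable_fun D f /\ exists B : R, forall t, D t -> `|f t| <= B.

Lemma bmD f g : bounded_meas f -> bounded_meas g -> bounded_meas (fun t => f t + g t).
Proof.
move=> [mf [B fB]] [mg [C gC]]; split; first exact: measurable_funD.
by exists (B + C) => t Dt; rewrite (le_trans (ler_normD _ _)) // lerD ?fB ?gC.
Qed.

Lemma bmM f g : bounded_meas f -> bounded_meas g -> bounded_meas (fun t => f t * g t).
Proof.
move=> [mf [B fB]] [mg [C gC]]; split; first exact: measurable_funM.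
by exists (B * C) => t Dt; rewrite normrM ler_pM ?fB ?gC.
Qed.

Lemma bm_cst (c : R) : bounded_meas (fun=> c).
Proof. by split; [exact: measurable_cst|exists `|c|]. Qed.

Lemma bmX f a : bounded_meas f -> bounded_meas (fun t => f t ^+ a).
Proof.
move=> bf; elim: a => [|a IH]; first exact: bm_cst.
by under eq_fun do rewrite exprS; exact: bmM.
Qed.

Lemma bm_sum I (r : seq I) (f : I -> T -> R) :
  (forall i, bounded_meas (f i)) -> bounded_meas (fun t => \sum_(i <- r) f i t).
Proof.
move=> bf; elim: r => [|i r IH].
  by under eq_fun do rewrite big_nil; exact: bm_cst.
by under eq_fun do rewrite big_cons; exact: bmD.
Qed.

Lemma bm_integrable f : bounded_meas f -> mu.-integrable D (EFin \o f).
Proof.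
move=> [mf [B fB]]; apply: measurable_bounded_integrable => //.
by exists B; split; [exact: num_real|move=> M BM t Dt; exact: le_trans (fB t Dt) (ltW BM)].
Qed.

Definition fint f : R := \int[mu]_(t in D) f t.

Lemma eq_fint f g : (forall t, D t -> f t = g t) -> fint f = fint g.
Proof. by move=> fg; apply: eq_Rintegral => t; rewrite inE; exact: fg. Qed.

Lemma fintD f g : bounded_meas f -> bounded_meas g -> fint (fun t => f t + g t) = fint f + fint g.
Proof. by move=> /bm_integrable If /bm_integrable Ig; exact: RintegralD. Qed.

Lemma fintB f g : bounded_meas f -> bounded_meas g -> fint (fun t => f t - g t) = fint f - fint g.
Proof. by move=> /bm_integrable If /bm_integrable Ig; exact: RintegralB. Qed.

Lemma fintZ c f : bounded_meas f -> fint (fun t => c * f t) = c * fint f.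
Proof. by move=> /bm_integrable If; exact: RintegralZl. Qed.

Lemma fint_cst c : fint (fun=> c) = c * fine (mu D).
Proof. by rewrite /fint Rintegral_cst. Qed.

Lemma fint_sum I (r : seq I) (f : I -> T -> R) : (forall i, bounded_meas (f i)) ->
  fint (fun t => \sum_(i <- r) f i t) = \sum_(i <- r) fint (f i).
Proof.
move=> bf; elim: r => [|i r IH].
  rewrite big_nil (eq_fint (g := fun=> 0)); first by rewrite fint_cst mul0r.
  by move=> t _; rewrite big_nil.
rewrite big_cons -IH -fintD //; last exact: bm_sum.
by apply: eq_fint => t _; rewrite big_cons.
Qed.

Lemma le_fint f g : bounded_meas f -> bounded_meas g ->
  (forall t, D t -> f t <= g t) -> fint f <= fint g.
Proof. by move=> /bm_integrable If /bm_integrable Ig fg; exact: le_Rintegral. Qed.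

Lemma norm_fint f (B : R) : bounded_meas f -> (forall t, D t -> `|f t| <= B) ->
  `|fint f| <= B * fine (mu D).
Proof.
move=> bf fB; apply: le_trans (le_normr_Rintegral mD (bm_integrable bf)) _.
rewrite -fint_cst; apply: le_fint => //; last exact: bm_cst.
split; first by apply: measurableT_comp => //; exact: bf.1.
by case: bf => _ [C fC]; exists C => t Dt; rewrite normr_id fC.
Qed.

End FiniteMeasure.
Arguments eq_fint {R d T mu D f g} _.

Section CoefficientNodes.
Context {R : realType}.

(** Lagrange interpolation: the coefficients of a polynomial are fixed combinations
    of its values, so they can be compared under an integral without
    differentiating. *)
Lemma coef_nodes N j : exists w : 'I_N.+1 -> R, forall p : {poly R}, (size p <= N.+1)%N ->
  p`_j = \sum_(i < N.+1) w i * p.[i%:R].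
Proof.
have inj : injective (fun i : nat => i%:R : R) by move=> i k /eqP; rewrite eqr_nat => /eqP.
exists (fun i => (tnth (lagrange N.+1 (fun i : nat => i%:R : R)) i : {poly R})`_j) => p sp.
rewrite {1}(lagrange_gen (ltn0Sn N) inj sp) coef_sum; apply: eq_bigr => i _.
by rewrite coefCM mulrC.
Qed.

Lemma quadratic_coef012 (q u x : R) a :
  let P := (q%:P + (2 * u) *: 'X + x *: 'X^2) in
  [/\ (P ^+ a.+1)`_0 = q ^+ a.+1, (P ^+ a.+1)`_1 = a.+1%:R * q ^+ a * (2 * u) &
   (P ^+ a.+1)`_2 = a.+1%:R * q ^+ a * x + a.+1%:R * a%:R * 2 * u ^+ 2 * q ^+ a.-1].
Proof.
move=> P.
have P0 : P`_0 = q by rewrite !coefD coefC !coefZ coefX coefXn /= !mulr0 !addr0.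
have P1 : P`_1 = 2 * u by rewrite !coefD coefC !coefZ coefX coefXn /= mulr0 addr0 add0r mulr1.
have P2 : P`_2 = x by rewrite !coefD coefC !coefZ coefX coefXn /= !mulr0 add0r add0r mulr1.
elim: a => [|a [IH0 IH1 IH2]].
  by rewrite expr1 P0 P1 P2; split; ring.
rewrite exprS !coefM !big_ord_recl !big_ord0 /= !P0 P1 P2 IH0 IH1 IH2 -!natr1; split.
- by rewrite addr0 -exprS.
- by rewrite !exprS; ring.
by case: a {IH0 IH1 IH2} => [|a] /=; rewrite -?natr1 ?exprS; ring.
Qed.

Lemma size_quadratic_exp (q u x : R) a :
  (size ((q%:P + u *: 'X + x *: 'X^2) ^+ a)%R <= (2 * a).+1)%N.
Proof.
have S3 : (size (q%:P + u *: 'X + x *: 'X^2)%R <= 3)%N.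
  apply: leq_trans (size_polyD _ _) _; rewrite geq_max; apply/andP; split.
    apply: leq_trans (size_polyD _ _) _; rewrite geq_max; apply/andP; split.
      by apply: leq_trans (size_polyC_leq1 _) _.
    by apply: leq_trans (size_scale_leq _ _) _; rewrite size_polyX.
  by apply: leq_trans (size_scale_leq _ _) _; rewrite size_polyXn.
apply: leq_trans (size_poly_exp_leq _ _) _; rewrite ltnS leq_mul2r; apply/orP; right.
by move: S3; case: (size _).
Qed.

End CoefficientNodes.

Section RadialMoments.
Context {R : realType}.

Lemma is_derive_sin_cos p q (t : R) :
  is_derive t 1 (fun t => sin t ^+ p.+1 * cos t ^+ q.+1)
   (p.+1%:R * (sin t ^+ p * cos t ^+ q) - (p + q).+2%:R * (sin t ^+ p.+2 * cos t ^+ q)).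
Proof.
have d1 := is_deriveX p.+1 (is_derive_sin t).
have d2 := is_deriveX q.+1 (is_derive_cos t).
have := is_deriveM d1 d2.
rewrite (_ : (@sin R ^+ p.+1 * @cos R ^+ q.+1) = fun t => sin t ^+ p.+1 * cos t ^+ q.+1); last first.
  by apply/funext => s; rewrite /= !fctE.
move=> D; apply: is_derive_eq D _; rewrite !fctE /GRing.scale /=.
have sc : cos t ^+ 2 = 1 - sin t ^+ 2 by rewrite -(cos2Dsin2 t) addrK.
have c2 : cos t ^+ q.+1 * cos t = cos t ^+ q * (1 - sin t ^+ 2) by rewrite -sc !exprS expr0; ring.
have -> : (p + q).+2%:R = p.+1%:R + q.+1%:R :> R by rewrite -natrD addSn addnS.
rewrite [X in _ + X](_ : _ = p.+1%:R * sin t ^+ p * (cos t ^+ q.+1 * cos t)); last by ring.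
rewrite c2 ![sin t ^+ p.+2]exprS ![sin t ^+ p.+1]exprS; ring.
Qed.

Definition sin_cos_int (p q : nat) : R := segint 0 (pi / 2) (fun t => sin t ^+ p * cos t ^+ q).

Lemma sin_cos_int_rec p q :
  (p + q).+2%:R * sin_cos_int p.+2 q = p.+1%:R * sin_cos_int p q.
Proof.
apply/eqP; rewrite eq_sym -subr_eq0; apply/eqP.
have cZ a b (c : R) : continuous (fun t : R => c * (sin t ^+ a * cos t ^+ b)).
  by apply: cont_mul; [exact: cont_cst|exact: continuous_sin_cos].
rewrite /sin_cos_int -!segintZ; try exact: continuous_sin_cos.
rewrite -segintB // (segint_derive pihalf_ge0 _ (fun t _ => is_derive_sin_cos p q t)).
  by rewrite sin0 cos_pihalf !expr0n /= mulr0 mul0r subr0.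
by apply: cont_add; [exact: cZ|apply: cont_opp; exact: cZ].
Qed.

Lemma radial_avg_pow p q a (rho : R) :
  radial_avg p q (fun t => t ^+ a) rho = rho ^+ a * sin_cos_int (2 * a + p) q.
Proof.
rewrite /sin_cos_int -segintZ; last exact: continuous_sin_cos.
by apply: eq_segint => t _; rewrite exprMn -exprM exprD; ring.
Qed.

Lemma sin_cos_int_gt0 p q : 0 < sin_cos_int p q.
Proof.
have pi2 : 0 < pi / 2 :> R by rewrite divr_gt0 // pi_gt0.
have cf := @continuous_sin_cos R p q.
have [G dG] := primitive (-1) cf.
have dG0 (t : R) : 0 <= t -> is_derive t 1 G (sin t ^+ p * cos t ^+ q).
  by move=> t0; apply: dG; apply: lt_le_trans t0; rewrite oppr_lt0.
have -> : sin_cos_int p q = G (pi / 2) - G 0.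
  by apply: segint_derive (ltW pi2) cf _ => t /andP[t0 _]; exact: dG0.
have [||c c01 ->] := @MVT R G (fun t => sin t ^+ p * cos t ^+ q) 0 (pi / 2) pi2 _ _.
- by move=> x; rewrite in_itv /= => /andP[/ltW x0 _]; exact: dG0.
- apply: derivable_within_continuous => t; rewrite in_itv /= => /andP[t0 _].
  by have [] := dG0 t t0.
move: c01; rewrite in_itv /= => /andP[c0 c1].
rewrite subr0 !mulr_gt0 ?exprn_gt0 //.
  by rewrite sin_gt0_pi // c0 (lt_trans c1) // ltr_pdivrMr // ltr_pMr ?pi_gt0 // ltr1n.
  by rewrite cos_gt0_pihalf // c1 andbT (lt_trans _ c0) // oppr_lt0.
exact: pi_gt0.
Qed.

End RadialMoments.

Section DotProduct.
Context {R : realType} {n : nat}.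

Lemma dotpDr (x y z : 'rV[R]_n) : dotp x (y + z) = dotp x y + dotp x z.
Proof. by rewrite dotpC dotpDl !(dotpC _ x). Qed.

Lemma dotpZr a (x y : 'rV[R]_n) : dotp x (a *: y) = a * dotp x y.
Proof. by rewrite dotpC dotpZl dotpC. Qed.

End DotProduct.

Section ProjectionAverage.
Context {R : realType} d (T : measurableType d) (mu : {measure set T -> \bar R}) (D : set T).
Hypotheses (mD : measurable D) (muD : (mu D < +oo)%E).
Variables (n p q : nat) (X : T -> 'M[R]_n).
Hypotheses (nE : n = (p + q).+2)
  (mX : forall i j, measurable_fun D (fun t => X t i j))
  (symX : forall t, D t -> (X t)^T = X t)
  (idX : forall t, D t -> X t *m X t = X t)
  (trX : forall t, D t -> \tr (X t) = p.+1%:R).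

Definition qform k (M : 'M[R]_k) (z : 'rV[R]_k) := dotp (z *m M) z.

Lemma qform_sqnorm t (z : 'rV[R]_n) : D t -> qform (X t) z = sqnorm (z *m X t).
Proof.
by move=> Dt; rewrite /qform sqnormE !dotpE trmx_mul symX // [in RHS]mulmxA -[in RHS](mulmxA z) idX.
Qed.

Lemma sqnorm_proj_le t (z : 'rV[R]_n) : D t -> sqnorm (z *m X t) <= sqnorm z.
Proof.
move=> Dt; have := sqnorm_ge0 (z + (-1) *: (z *m X t)).
rewrite sqnormD (dotpC z) dotpZl -[dotp _ z]/(qform (X t) z) qform_sqnorm // sqnormZ.
by set a := sqnorm _; set b := sqnorm _; lra.
Qed.

Lemma qform_bound t (z : 'rV[R]_n) : D t -> 0 <= qform (X t) z <= sqnorm z.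
Proof. by move=> Dt; rewrite qform_sqnorm // sqnorm_ge0 sqnorm_proj_le. Qed.

Lemma bm_proj (z : 'rV[R]_n) (i : 'I_n) : bounded_meas D (fun t => (z *m X t) 0 i).
Proof.
split.
  under eq_fun do rewrite mxE.
  by apply: measurable_sum => j; apply: measurable_funM.
exists (Num.sqrt (sqnorm z)) => t Dt; rewrite -sqrtr_sqr ler_sqrt ?sqnorm_ge0 //.
exact: le_trans (coord_le_sqnorm _ _) (sqnorm_proj_le _ Dt).
Qed.

Lemma bm_entry (i j : 'I_n) : bounded_meas D (fun t => X t i j).
Proof.
have [m b] := bm_proj (delta_mx 0 i) j; split => //.
by have [B HB] := b; exists B => t Dt; have := HB t Dt; rewrite -rowE mxE.
Qed.

Lemma bm_qform (z : 'rV[R]_n) : bounded_meas D (fun t => qform (X t) z).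
Proof.
by apply: bm_sum => i; apply: bmM; [exact: bm_proj|exact: bm_cst].
Qed.

Lemma bm_comp (h : R -> R) (z : 'rV[R]_n) : continuous h -> bounded_meas D (fun t => h (qform (X t) z)).
Proof.
move=> ch; split.
  by apply: measurableT_comp (bm_qform z).1; exact: continuous_measurable_fun.
have [B B0 HB] := continuous_bounded_segment 0 (sqnorm z) ch.
by exists B => t Dt; apply: HB; exact: qform_bound.
Qed.

Lemma qform_add_delta t (z : 'rV[R]_n) (s : R) (i : 'I_n) : D t ->
  qform (X t) (z + s *: delta_mx 0 i) =
  qform (X t) z + 2 * (z *m X t) 0 i * s + X t i i * s ^+ 2.
Proof.
move=> Dt; have dd (y : 'rV[R]_n) : dotp y (delta_mx 0 i) = y 0 i.
  by rewrite /dotp (bigD1 i) //= big1 ?addr0 ?mxE ?eqxx ?mulr1 // => j /negPf ji; rewrite mxE ji andbF mulr0.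
rewrite /qform mulmxDl -scalemxAl !dotpDl !dotpDr !dotpZl !dotpZr !dd -rowE.
rewrite [(row i (X t)) 0 i]mxE (_ : dotp (row i (X t)) z = (z *m X t) 0 i); first by ring.
rewrite dotpC mxE /dotp; apply: eq_bigr => j _; congr (_ * _).
by rewrite -{1}(symX Dt) !mxE.
Qed.

Section Moments.
Variable m : nat -> R.
Hypothesis Hm : forall a (z : 'rV[R]_n), fint mu D (fun t => qform (X t) z ^+ a) = m a * sqnorm z ^+ a.

(** Comparing the Laplacians in z of both sides. *)
Lemma moment_rec a : (n%:R + 2 * a%:R) * m a.+1 = (p.+1%:R + 2 * a%:R) * m a.
Proof.
have n0 : (0 < n)%N by rewrite nE.
pose z : 'rV[R]_n := delta_mx 0 (Ordinal n0).
have z1 : sqnorm z = 1.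
  rewrite /sqnorm (bigD1 (Ordinal n0)) //= big1 ?addr0 ?mxE ?eqxx ?expr1n // => j /negPf ji.
  by rewrite mxE ji andbF expr0n.
have [w Hw] := @coef_nodes R (2 * a.+1) 2.
pose P t i : {poly R} := ((qform (X t) z)%:P + (2 * (z *m X t) 0 i) *: 'X + (X t i i) *: 'X^2) ^+ a.+1.
pose Q i : {poly R} := (1%:P + (2 * z 0 i) *: 'X + 1 *: 'X^2) ^+ a.+1.
have HQ i : fint mu D (fun t => (P t i)`_2) = m a.+1 * (Q i)`_2.
  transitivity (\sum_(j < (2 * a.+1).+1) w j * (m a.+1 * sqnorm (z + j%:R *: delta_mx 0 i) ^+ a.+1)).
    under eq_bigr do rewrite -Hm.
    rewrite (eq_fint (g := fun t => \sum_(j < (2 * a.+1).+1) w j * qform (X t) (z + j%:R *: delta_mx 0 i) ^+ a.+1)).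
      rewrite fint_sum // => [|j]; last first.
        by apply: bmM; [exact: bm_cst|apply: bmX; exact: bm_qform].
      by apply: eq_bigr => j _; rewrite fintZ //; apply: bmX; exact: bm_qform.
    move=> t Dt; rewrite Hw ?size_quadratic_exp //; apply: eq_bigr => j _.
    by rewrite qform_add_delta // /P horner_exp !hornerE.
  rewrite Hw ?size_quadratic_exp // mulr_sumr; apply: eq_bigr => j _.
  rewrite mulrCA; congr (_ * (_ * _)); rewrite /Q horner_exp !hornerE; congr (_ ^+ _).
  rewrite sqnormD z1 sqnormZ (dotpC z) dotpZl.
  have -> : sqnorm (delta_mx 0 i : 'rV[R]_n) = 1.
    rewrite /sqnorm (bigD1 i) //= big1 ?addr0 ?mxE ?eqxx ?expr1n // => k /negPf ji.
    by rewrite mxE ji andbF expr0n.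
  have -> : dotp (delta_mx 0 i) z = z 0 i.
    rewrite /dotp (bigD1 i) //= big1 ?addr0 ?mxE ?eqxx ?mul1r // => k /negPf ji.
    by rewrite !mxE ji andbF mul0r.
  by ring.
have E : \sum_i fint mu D (fun t => (P t i)`_2) = \sum_i m a.+1 * (Q i)`_2.
  by apply: eq_bigr => i _; exact: HQ.
have bP i : bounded_meas D (fun t => (P t i)`_2).
  have H t : (P t i)`_2 = a.+1%:R * qform (X t) z ^+ a * X t i i +
      a.+1%:R * a%:R * 2 * (z *m X t) 0 i ^+ 2 * qform (X t) z ^+ a.-1.
    by have [_ _] := quadratic_coef012 (qform (X t) z) ((z *m X t) 0 i) (X t i i) a.
  under eq_fun do rewrite H.
  apply: bmD; apply: bmM; try exact: bm_entry.
  - by apply: bmM; [exact: bm_cst|apply: bmX; exact: bm_qform].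
  - by apply: bmM; [exact: bm_cst|apply: bmX; exact: bm_proj].
  - by apply: bmX; exact: bm_qform.
move: E; rewrite -(fint_sum mD muD) // (eq_fint (g := fun t => (a.+1%:R * (p.+1%:R + 2 * a%:R)) * qform (X t) z ^+ a)); last first.
  move=> t Dt; rewrite (eq_bigr (fun i => a.+1%:R * qform (X t) z ^+ a * X t i i +
      a.+1%:R * a%:R * 2 * qform (X t) z ^+ a.-1 * (z *m X t) 0 i ^+ 2)); last first.
    move=> i _; have [_ _ ->] := quadratic_coef012 (qform (X t) z) ((z *m X t) 0 i) (X t i i) a.
    by congr (_ + _); ring.
  rewrite big_split /= -!mulr_sumr -/(mxtrace (X t)) trX // -/(sqnorm (z *m X t)) -qform_sqnorm //.
  by case: a {w Hw P Q HQ bP} => [|a] /=; rewrite ?exprS; ring.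
rewrite (fintZ mD muD); last by apply: bmX; exact: bm_qform.
rewrite Hm z1 expr1n mulr1.
rewrite (eq_bigr (fun i => m a.+1 * a.+1%:R + m a.+1 * a.+1%:R * a%:R * 2 * z 0 i ^+ 2)); last first.
  move=> i _; have [_ _ ->] := quadratic_coef012 1 (z 0 i) 1 a.
  by rewrite !expr1n; ring.
rewrite big_split /= sumr_const card_ord -mulr_sumr -/(sqnorm z) z1 => E.
have EN (y : R) : y *+ n = y * n%:R by rewrite mulr_natr.
rewrite EN in E.
have a0 : a.+1%:R != 0 :> R by rewrite pnatr_eq0.
by apply: (mulfI a0); rewrite [RHS]mulrA E; ring.
Qed.

Lemma momentE a : m a * sin_cos_int p q = m 0%N * sin_cos_int (2 * a + p) q.
Proof.
elim: a => [|a IH]; first by rewrite muln0 add0n.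
have N0 : n%:R + 2 * a%:R != 0 :> R.
  by rewrite -natrM -natrD pnatr_eq0 addn_eq0 nE.
apply: (mulfI N0); rewrite mulrA moment_rec -mulrA IH.
have := @sin_cos_int_rec R (2 * a + p) q.
have -> : (2 * a + p + q).+2%:R = n%:R + 2 * a%:R :> R.
  by rewrite -natrM -natrD nE; congr (_%:R); lia.
have -> : (2 * a + p).+2 = (2 * a.+1 + p)%N by lia.
have -> : (2 * a + p).+1%:R = p.+1%:R + 2 * a%:R :> R.
  by rewrite -natrM -natrD; congr (_%:R); lia.
by move=> H; rewrite [RHS]mulrCA H; ring.
Qed.

(** The moments of the random variable qform (X t) z satisfy a recursion, hence they
    are the moments of the square of a sine with density proportional to
    sin ^+ p * cos ^+ q; moments determine the integrals of continuous functions by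
    Weierstrass's theorem. *)
Lemma projection_average (h : R -> R) (z : 'rV[R]_n) : continuous h ->
  fint mu D (fun t => h (qform (X t) z)) =
  fine (mu D) / sin_cos_int p q * radial_avg p q h (sqnorm z).
Proof.
move=> ch; have S0 := @sin_cos_int_gt0 R p q.
have m0 : m 0%N = fine (mu D).
  have := Hm 0 z; rewrite expr0 mulr1 => <-.
  by rewrite (eq_fint (g := fun=> 1)) ?fint_cst // ?mul1r // => t _; rewrite expr0.
set K := _ / _; have muD0 : 0 <= fine (mu D) by exact/fine_ge0/measure_ge0.
have K0 : 0 <= K by exact: divr_ge0 muD0 (ltW S0).
have mE a : m a = K * sin_cos_int (2 * a + p) q.
  by rewrite /K -m0 mulrAC -momentE mulfK // gt_eqF.
pose rad (P : {poly R}) := radial_avg p q (fun t => P.[t]) (sqnorm z).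
have cP (P : {poly R}) : continuous (fun t : R => P.[t]).
  by move=> t; exact: continuous_horner.
have polyE (P : {poly R}) : fint mu D (fun t => P.[qform (X t) z]) = K * rad P.
  rewrite (eq_fint (g := fun t => \sum_(i < size P) P`_i * qform (X t) z ^+ i)); last first.
    by move=> t _; rewrite horner_coef.
  have bq i : bounded_meas D (fun t => qform (X t) z ^+ i) by apply: bmX; exact: bm_qform.
  rewrite fint_sum // => [|i]; last by apply: bmM => //; exact: bm_cst.
  rewrite /rad (_ : radial_avg _ _ _ _ = \sum_(i < size P) P`_i * radial_avg p q (fun t => t ^+ i) (sqnorm z)).
    rewrite mulr_sumr; apply: eq_bigr => i _; rewrite fintZ // Hm mE radial_avg_pow; ring.
  have cr i := @continuous_radial_integrand R p q (fun t => t ^+ i) (sqnorm z) (@exprn_continuous _ i).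
  rewrite /radial_avg.
  under [RHS]eq_bigr do rewrite -segintZ //.
  rewrite -(@segint_sum _ 0 (pi / 2) (size P) (fun i t => P`_i *
    ((sqnorm z * sin t ^+ 2) ^+ i * sin t ^+ p * cos t ^+ q))); last first.
    by move=> i; apply: cont_mul => //; exact: cont_cst.
  apply: eq_segint => t _; rewrite horner_coef !mulr_suml; apply: eq_bigr => i _; ring.
apply/eqP; rewrite -subr_eq0 -normr_eq0 eq_le normr_ge0 andbT; apply/ler_addgt0Pr => e e0.
rewrite add0r; pose c := fine (mu D) + K * (pi / 2) + 1.
have c0 : 0 < c by rewrite ltr_wpDl // addr_ge0 // mulr_ge0 // pihalf_ge0.
have e1 : 0 < e / c by rewrite divr_gt0.
have z0 : 0 < sqnorm z + 1 by rewrite ltr_wpDl ?sqnorm_ge0.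
have [P HP] := weierstrass z0 ch e1.
have HP' t : 0 <= t <= sqnorm z -> `|h t - P.[t]| <= e / c.
  by move=> /andP[t0 tz]; apply: HP; rewrite t0 (le_trans tz) // lerDl.
have chP : continuous (fun t => h t - P.[t]) by apply: cont_add => //; exact: cont_opp.
have -> : fint mu D (fun t => h (qform (X t) z)) - K * radial_avg p q h (sqnorm z) =
    fint mu D (fun t => h (qform (X t) z) - P.[qform (X t) z]) -
    K * radial_avg p q (fun t => h t - P.[t]) (sqnorm z).
  rewrite fintB //; try exact: bm_comp.
  rewrite polyE /rad /radial_avg.
  rewrite [X in _ = _ - _ - K * X](_ : _ = segint 0 (pi / 2) (fun t => h (sqnorm z * sin t ^+ 2) * sin t ^+ p * cos t ^+ q) -
    segint 0 (pi / 2) (fun t => P.[sqnorm z * sin t ^+ 2] * sin t ^+ p * cos t ^+ q)); first by ring.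
  rewrite -segintB; first by apply: eq_segint => t _; rewrite !mulrBl.
    exact: continuous_radial_integrand.
  exact: (@continuous_radial_integrand R p q (fun t => P.[t])).
apply: le_trans (ler_normB _ _) _.
apply: (@le_trans _ _ (e / c * fine (mu D) + K * (e / c * (pi / 2)))).
  rewrite normrM (ger0_norm K0) lerD //.
    apply: norm_fint => //; first exact: (bm_comp z chP).
    by move=> t Dt; apply: HP'; exact: qform_bound.
  by rewrite ler_wpM2l // le_radial_avg // sqnorm_ge0.
have -> : e / c * fine (mu D) + K * (e / c * (pi / 2)) = e * ((c - 1) / c).
  by rewrite /c addrK; ring.
by rewrite ler_piMr ?(ltW e0) // ler_pdivrMr // mul1r gerBl.
Qed.

End Moments.
End ProjectionAverage.

Section Rotations.
Context {R : realType}.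

Lemma householder n (u v : 'rV[R]_n) : sqnorm u = sqnorm v ->
  exists2 Q : 'M[R]_n, orthogonal_mx Q & u *m Q = v.
Proof.
move=> uv; have [->|uNv] := eqVneq u v.
  by exists 1%:M; rewrite /orthogonal_mx ?trmx1 mulmx1.
have [w wE] : exists w, w = u - v by exists (u - v).
have w0 : sqnorm w != 0 by rewrite wE sqnorm_eq0 subr_eq0.
have ww : w *m w^T = (sqnorm w)%:M.
  by rewrite [LHS]mx11_scalar sqnormE dotpE.
have uw : 2 * dotp u w = sqnorm w.
  by rewrite wE sqnormD -scaleN1r dotpDr !dotpZr sqnormZ -uv sqnormE; ring.
have [W WE] : exists W, W = w^T *m w by exists (w^T *m w).
have WW : W *m W = sqnorm w *: W.
  by rewrite {1 2}WE mulmxA -(mulmxA w^T) ww mul_mx_scalar -scalemxAl -WE.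
pose Q : 'M[R]_n := 1%:M - (2 / sqnorm w) *: W.
have QT : Q^T = Q by rewrite /Q linearB linearZ /= trmx1 WE trmx_mul trmxK.
exists Q.
  rewrite /orthogonal_mx QT /Q mulmxBl mul1mx mulmxBr mulmx1 -scalemxAl -scalemxAr WW !scalerA.
  have -> : 2 / sqnorm w * (2 / sqnorm w) * sqnorm w = 2 / sqnorm w + 2 / sqnorm w by field.
  by rewrite scalerDl opprB addrK subrK.
rewrite /Q mulmxBr mulmx1 -scalemxAr WE mulmxA.
have -> : u *m w^T = (dotp u w)%:M by rewrite [LHS]mx11_scalar dotpE.
rewrite mul_scalar_mx scalerA mulrAC uw divff // scale1r wE.
by rewrite opprB addrC subrK.
Qed.

(** A reflection exchanges the two unit vectors; if its determinant is -1 it is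
    composed with a reflection fixing the target. *)
Lemma rotation_to n (i0 : 'I_n) (v : 'rV[R]_n) : (2 <= n)%N -> sqnorm v = 1 ->
  exists Q : 'M[R]_n, [/\ Q *m Q^T = 1%:M, \det Q = 1 & delta_mx 0 i0 *m Q = v].
Proof.
move=> n2 v1; have e1 : sqnorm (delta_mx 0 i0 : 'rV[R]_n) = 1.
  rewrite /sqnorm (bigD1 i0) //= big1 ?addr0 ?mxE ?eqxx ?expr1n // => j /negPf ji.
  by rewrite mxE ji andbF expr0n.
have [Q hQ uQ] := householder (etrans e1 (esym v1)).
have : \det Q ^+ 2 == 1 by rewrite expr2 -{2}(det_tr Q) -det_mulmx hQ det1.
rewrite sqrf_eq1 => /orP[/eqP dQ|/eqP dQ]; first by exists Q.
have [i1 i10] : exists i1 : 'I_n, i1 != i0.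
  have [i00|i0N] := eqVneq (i0 : nat) 0%N.
    by exists (Ordinal n2); apply/eqP => /(congr1 val) /=; rewrite i00.
  by exists (Ordinal (ltnW n2)); apply/eqP => /(congr1 val) /= E; rewrite -E in i0N.
pose r : 'rV[R]_n := \row_j (if j == i1 then -1 else 1).
exists (diag_mx r *m Q); split.
- rewrite trmx_mul mulmxA -(mulmxA _ Q) hQ mulmx1 tr_diag_mx mulmx_diag.
  apply/matrixP => i j; rewrite !mxE.
  by case: (i == i1); rewrite ?mulrNN mulr1.
- rewrite det_mulmx det_diag dQ (bigD1 i1) //= big1 ?mulr1 ?mxE ?eqxx ?mulrNN ?mulr1 //.
  by move=> j /negPf ji; rewrite mxE ji.
rewrite mulmxA -rowE (_ : row i0 (diag_mx r) = delta_mx 0 i0) //.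
apply/rowP => j; rewrite !mxE eqxx /= (eq_sym j).
by rewrite eq_sym (negPf i10).
Qed.

(** Rotations act transitively on the unit sphere as soon as the dimension is 2. *)
Lemma rotation_invariant_homogeneous n (i0 : 'I_n) (f : 'rV[R]_n -> R) a : (2 <= n)%N ->
  (forall c z, f (c *: z) = c ^+ (2 * a) * f z) ->
  (forall Q z, Q *m Q^T = 1%:M -> \det Q = 1 -> f (z *m Q) = f z) ->
  forall z, f z = f (delta_mx 0 i0) * sqnorm z ^+ a.
Proof.
move=> n2 fZ fQ z; have [->|z0] := eqVneq z 0.
  rewrite sqnorm0 -(scale0r (delta_mx 0 i0)) fZ.
  by case: a fZ => [|a] fZ; [rewrite muln0 !expr0 mul1r mulr1|rewrite mulnS !expr0n mul0r mulr0].
have s0 : 0 < Num.sqrt (sqnorm z) by rewrite sqrtr_gt0 sqnorm_gt0.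
pose v := (Num.sqrt (sqnorm z))^-1 *: z.
have v1 : sqnorm v = 1.
  by rewrite /v sqnormZ exprVn sqr_sqrtr ?sqnorm_ge0 // mulVf // sqnorm_eq0.
have -> : z = Num.sqrt (sqnorm z) *: v.
  by rewrite /v scalerA divff ?scale1r // gt_eqF.
have [Q [hQ dQ eQ]] := rotation_to i0 n2 v1.
rewrite fZ sqnormZ v1 mulr1 sqr_sqrtr ?sqnorm_ge0 // exprM sqr_sqrtr ?sqnorm_ge0 //.
by rewrite -eQ fQ // mulrC.
Qed.

Lemma qformZ k (M : 'M[R]_k) (c : R) (z : 'rV[R]_k) : qform M (c *: z) = c ^+ 2 * qform M z.
Proof. by rewrite /qform -scalemxAl dotpZl dotpZr mulrA. Qed.

Lemma ge0_integral_orthogonal n (Q : 'M[R]_n) (D : set (borel_rV n)) (f : borel_rV n -> \bar R) :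
  orthogonal_mx Q -> measurable D -> (fun y : borel_rV n => y *m Q) @^-1` D = D ->
  measurable_fun D f -> (forall y, D y -> (0 <= f y)%E) ->
  (\int[lebesgue_rV n]_(y in D) f (y *m Q) = \int[lebesgue_rV n]_(y in D) f y)%E.
Proof.
move=> hQ mD DQ mf f0; have mQ := measurable_mulmxr Q.
pose m : {measure set (borel_rV n) -> \bar R} :=
  measure_function_pushforward__canonical__measure_function_Measure (lebesgue_rV n) mQ.
transitivity (\int[m]_(y in D) f y)%E.
  have := ge0_integral_pushforward mQ (lebesgue_rV n) mD mf.
  by rewrite DQ => ->// y; rewrite inE => /f0.
by apply: eq_measure_integral => A mA _; exact: lebesgue_rV_orthogonal.
Qed.

End Rotations.

(** * Hausdorff measure on planes *)

Section HausdorffMetric.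
Local Open Scope ereal_scope.
Context {R : realType} {n : nat} (k : nat).
Notation gauge := (@hausdorff_gauge R n k).
Notation Hd := (@hausdorff_approx R n k).
Notation H := (@hausdorff R n k).
Implicit Types E F A B : set 'rV[R]_n.

Lemma le_ediam E F : E `<=` F -> ediam E <= ediam F.
Proof.
move=> EF; apply: le_ereal_sup => _ [[x y] /= [Ex Ey] <-].
by exists (x, y) => //=; split; exact: EF.
Qed.

Lemma expe_le (x y : \bar R) m : 0 <= x -> x <= y -> x ^+ m <= y ^+ m.
Proof.
move=> x0 xy; elim: m => [|m IH]; first by rewrite !expe0.
by rewrite !expeS lee_pmul // expe_ge0.
Qed.

Lemma ball_const_ge0 : 0 <= (@ball_volume R k / 2 ^+ k)%:E.
Proof. by rewrite lee_fin divr_ge0 ?ball_volume_ge0 // exprn_ge0. Qed.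

Lemma gauge_le_ediam (d : R) E F : (E !=set0 -> F !=set0) -> ediam E <= ediam F ->
  gauge d E <= gauge d F.
Proof.
move=> EF DEF; have [E0|/eqP/set0P E0] := EM (E = set0).
  by rewrite E0 hausdorff_gauge0 hausdorff_gauge_ge0.
have F0 : F <> set0 by case: (EF E0) => x Fx FE; rewrite FE in Fx.
rewrite /hausdorff_gauge !asboolF //; last by move=> E0'; case: E0; rewrite E0' => x [].
case: (ifPn (ediam F <= _)) => FD; last by rewrite leey.
rewrite (le_trans DEF FD) lee_wpmul2l ?ball_const_ge0 //.
by apply: expe_le => //; exact: ediam_ge0.
Qed.

Lemma le_gauge (d : R) E F : E `<=` F -> gauge d E <= gauge d F.
Proof.
move=> EF; apply: gauge_le_ediam; last exact: le_ediam.
by move=> [x /EF]; exists x.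
Qed.

Lemma gauge_anti (d e : R) E : (d <= e)%R -> gauge e E <= gauge d E.
Proof.
move=> de; rewrite /hausdorff_gauge; case: asboolP => // _.
case: (ifPn (ediam E <= d%:E)) => [Ed|_]; last by rewrite leey.
by rewrite (le_trans Ed) // lee_fin.
Qed.

Lemma approx_anti (d e : R) E : (d <= e)%R -> Hd e E <= Hd d E.
Proof.
move=> de; apply: le_ereal_inf_tmp => _ [F FE <-]; apply: ge_ereal_inf.
exists (\sum_(0 <= i <oo) gauge e (F i)); first by exists F.
by apply: lee_nneseries => i *; [exact: hausdorff_gauge_ge0|exact: gauge_anti].
Qed.

Lemma le_approx_hausdorff (d : R) E : (0 < d)%R -> Hd d E <= H E.
Proof. by move=> d0; apply: ereal_sup_ubound; exists d. Qed.

Lemma approx_ge0 (d : R) E : 0 <= Hd d E.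
Proof. by apply: mu_ext_ge0; exact: hausdorff_gauge_ge0. Qed.

Definition lipschitz1 (g : 'rV[R]_n -> R) := forall x y, (`|g x - g y| <= enorm (x - y))%R.

(** When the cover has small diameters, no set of it meets both parts. *)
Lemma approx_separated (g : 'rV[R]_n -> R) A B (a e d : R) : lipschitz1 g -> (0 < d < e)%R ->
  (forall x, A x -> g x <= a)%R -> (forall x, B x -> a + e <= g x)%R ->
  Hd d A + Hd d B <= Hd d (A `|` B).
Proof.
move=> Lg /andP[d0 de] Aa Bb; apply: le_ereal_inf_tmp => _ [F [_ FE] <-].
pose S := [set x | g x <= a]%R; pose T := [set x | a + e <= g x]%R.
apply: (@le_trans _ _ (\sum_(0 <= i <oo) (gauge d (F i `&` S) + gauge d (F i `&` T)))).
  rewrite nneseriesD; try by move=> *; exact: hausdorff_gauge_ge0.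
  apply: leeD; apply: ereal_inf_lbound.
    exists (fun i => F i `&` S) => //; split=> [i|x Ax]; first exact: sub_sigma_algebra.
    by have [i _ Fx] := FE x (or_introl Ax); exists i => //; split => //; exact: Aa.
  exists (fun i => F i `&` T) => //; split=> [i|x Bx]; first exact: sub_sigma_algebra.
  by have [i _ Fx] := FE x (or_intror Bx); exists i => //; split => //; exact: Bb.
apply: lee_nneseries => [i _ _|i _]; first by rewrite adde_ge0 ?hausdorff_gauge_ge0.
have [FS|/eqP/set0P [x [Fx Sx]]] := EM (F i `&` S = set0).
  by rewrite FS hausdorff_gauge0 add0e le_gauge //; exact: subIsetl.
have [FT|/eqP/set0P [y [Fy Ty]]] := EM (F i `&` T = set0).
  by rewrite FT hausdorff_gauge0 adde0 le_gauge //; exact: subIsetl.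
rewrite {3}/hausdorff_gauge asboolF; last by move=> F0; rewrite F0 in Fx.
case: ifPn => [Fd|_]; last by rewrite leey.
have : (enorm (x - y))%:E <= d%:E.
  by apply: le_trans Fd; apply: ereal_sup_ubound; exists (x, y).
rewrite lee_fin => xyd; have := le_lt_trans (le_trans (Lg x y) xyd) de.
move: Sx Ty; rewrite /S /T /= => Sx Ty.
by rewrite ltr_norml => /andP[? _]; exfalso; lra.
Qed.

Lemma sup_add_le A B (M : \bar R) :
  (forall d : R, (0 < d)%R -> Hd d A + Hd d B <= M) -> H A + H B <= M.
Proof.
move=> HM; have [->|Moo] := eqVneq M +oo; first exact: leey.
have M0 : 0 <= M by apply: le_trans (HM 1%R ltr01); rewrite adde_ge0 ?approx_ge0.
have HM2 (d1 d2 : R) : (0 < d1)%R -> (0 < d2)%R -> Hd d1 A + Hd d2 B <= M.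
  move=> d10 d20; have d0 : (0 < Num.min d1 d2)%R by rewrite lt_min d10.
  apply: le_trans (HM _ d0); apply: leeD; apply: approx_anti; rewrite ge_min lexx //.
  by rewrite orbT.
have Mfin : M \is a fin_num by rewrite ge0_fin_numE // ltey.
have leM (x y : \bar R) : 0 <= x -> 0 <= y -> x + y <= M -> x \is a fin_num.
  move=> x0 y0 xyM; rewrite ge0_fin_numE //; apply: (@le_lt_trans _ _ M); last by rewrite ltey.
  by apply: le_trans xyM; exact: leeDl.
have step (d1 : R) : (0 < d1)%R -> Hd d1 A + H B <= M.
  move=> d10; have fA : Hd d1 A \is a fin_num by exact: leM (approx_ge0 _ _) (approx_ge0 _ _) (HM _ d10).
  rewrite -leeBrDl //; apply: ge_ereal_sup => _ [d2 /= d20 <-].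
  by rewrite leeBrDl // HM2.
have fB : H B \is a fin_num.
  by apply: leM (hausdorff_ge0 _ _) (approx_ge0 1 A) _; rewrite addeC step.
rewrite addeC -leeBrDl //; apply: ge_ereal_sup => _ [d1 /= d10 <-].
by rewrite leeBrDl // addeC step.
Qed.

Lemma hausdorff_separated (g : 'rV[R]_n -> R) A B (a e : R) : lipschitz1 g -> (0 < e)%R ->
  (forall x, A x -> g x <= a)%R -> (forall x, B x -> a + e <= g x)%R ->
  H A + H B <= H (A `|` B).
Proof.
move=> Lg e0 Aa Bb; apply: sup_add_le => d d0.
pose c : R := Num.min d (e / 2)%R.
have c0 : (0 < c)%R by rewrite lt_min d0 divr_gt0.
have ce : (c < e)%R.
  by apply: (@le_lt_trans _ _ (e / 2)%R); rewrite ?ge_min ?lexx ?orbT // ltr_pdivrMr // ltr_pMr // ltr1n.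
apply: le_trans (le_approx_hausdorff (A `|` B) c0).
apply: le_trans (approx_separated Lg _ Aa Bb); last by rewrite c0.
by apply: leeD; apply: approx_anti; rewrite ge_min lexx.
Qed.

(** The part of X just above the level a is cut into thin layers. Every second
    layer belongs to a separated family, so that the measures of the layers are
    summable and those near the level contribute little. *)
Lemma caratheodory_sublevel (g : 'rV[R]_n -> R) (a : R) : lipschitz1 g ->
  (hausdorff_outer k).-caratheodory [set x | g x <= a]%R.
Proof.
move=> Lg; apply: le_caratheodory_measurable => X.
pose S := [set x | g x <= a]%R; change (H (X `&` S) + H (X `&` ~` S) <= H X).
have [HX|HX] := eqVneq (H X) +oo; first by rewrite HX leey.
have H0 := @hausdorff_ge0 R n k.
pose E (r : R) := X `&` [set x | a + r < g x]%R.
pose L j := X `&` [set x | a + j.+2%:R^-1 < g x <= a + j.+1%:R^-1]%R.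
have EX r : H (E r) <= H X by apply: le_hausdorff; exact: subIsetl.
have half o N : \sum_(0 <= i < N) H (L (i.*2 + o)%N) <= H (E ((N.*2 + o)%:R^-1)%R).
  elim: N => [|N IH]; first by rewrite big_nil.
  rewrite big_nat_recr //=.
  have LE : L (N.*2 + o)%N `<=` E ((N.+1.*2 + o)%:R^-1)%R.
    by move=> x [Xx /= /andP[gx _]]; split => //=; rewrite doubleS addSn addSn.
  have [|m0] := posnP (N.*2 + o)%N.
    move=> m0; have N0 : N = 0%N by lia.
    by rewrite N0 in LE *; rewrite big_nil add0e; exact: le_hausdorff LE.
  apply: le_trans (leeD IH (lexx _)) _; rewrite addeC.
  have e0 : (0 < (N.*2 + o)%:R^-1 - (N.*2 + o).+1%:R^-1 :> R)%R.
    by rewrite subr_gt0 ltf_pV2 ?posrE ?ltr0n // ltr_nat.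
  apply: le_trans (hausdorff_separated Lg e0 (a := (a + (N.*2 + o).+1%:R^-1)%R) _ _) _.
  - by move=> x [_ /= /andP[]].
  - by move=> x [_ /= gx]; apply: ltW; apply: le_lt_trans gx; rewrite -addrA subrKC.
  apply: le_hausdorff => x [/LE //|[Xx /= gx]]; split => //=.
  apply: le_lt_trans gx; rewrite lerD2l lef_pV2 ?posrE ?ltr0n // ?ler_nat; lia.
have sumL : \sum_(0 <= j <oo) H (L j) < +oo.
  apply: (@le_lt_trans _ _ (H X + H X)); last by rewrite lte_add_pinfty // ltey.
  apply: lime_le; first exact: is_cvg_nneseries.
  apply: nearW => N; apply: (@le_trans _ _ (\sum_(0 <= j < N.*2) H (L j))).
    rewrite -addnn [leRHS](@big_cat_nat _ _ _ N) ?leq_addr //=.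
    by apply: leeDl; exact: sume_ge0.
  have -> : \sum_(0 <= j < N.*2) H (L j) =
      \sum_(0 <= i < N) H (L (i.*2 + 0)%N) + \sum_(0 <= i < N) H (L (i.*2 + 1)%N).
    elim: N => [|N IH]; first by rewrite double0 !big_nil adde0.
    rewrite doubleS !big_nat_recr //= IH addn0 addn1.
    by rewrite addeACA addeA.
  by apply: leeD; apply: le_trans (half _ _) (EX _).
apply/lee_addgt0Pr => e e0.
have tail0 := nneseries_tail_cvg sumL (fun j _ => H0 (L j)).
have [N HN] : exists N, \sum_(N <= j <oo) H (L j) <= e%:E.
  apply: contrapT => /forallNP Hlt.
  have : e%:E <= 0.
    apply: cvge_ge tail0; apply: nearW => N /=.
    by have /negP := Hlt N; rewrite -ltNge => /ltW.
  by rewrite lee_fin leNgt e0.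
have cov : X `&` ~` S `<=` E (N.+1%:R^-1)%R `|` \bigcup_(j in ~` `I_N) L j.
  move=> x [Xx /negP]; rewrite -ltNge => gx.
  have [gN|gN] := ltP (a + N.+1%:R^-1)%R (g x); first by left.
  right; have s0 : (0 < g x - a)%R by rewrite subr_gt0.
  have si0 : (0 <= (g x - a)^-1)%R by rewrite invr_ge0 ltW.
  have := truncn_itv si0.
  have tN : (N < Num.trunc (g x - a)^-1)%N.
    by rewrite truncn_ge_nat // -[leLHS]invrK lef_pV2 ?posrE ?invr_gt0 // lerBlDl.
  case: (Num.trunc _) tN => // m Nm /andP[t1 t2].
  exists m; first by apply/negP; rewrite /= -leqNgt.
  have m1 : (0 < m.+1%:R :> R)%R by rewrite ltr0n.
  have m2 : (0 < m.+2%:R :> R)%R by rewrite ltr0n.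
  split => //; apply/andP; split.
    by rewrite -ltrBrDl -[ltRHS]invrK ltf_pV2 ?posrE ?invr_gt0.
  by rewrite -lerBlDl -[leLHS]invrK lef_pV2 ?posrE ?invr_gt0.
apply: (@le_trans _ _ (H (X `&` S) + (H (E (N.+1%:R^-1)%R) + e%:E))).
  apply: leeD => //; apply: le_trans (le_hausdorff _ cov) _.
  apply: le_trans (outer_measureU2 (hausdorff_outer k) _ _) _; apply: leeD => //.
  exact: le_trans (outer_measure_sigma_subadditive_tail (hausdorff_outer k) _ _) HN.
rewrite addeA; apply: leeD => //.
have N0 : (0 < N.+1%:R^-1 :> R)%R by rewrite invr_gt0.
apply: le_trans (hausdorff_separated Lg N0 (a := a) _ _) _.
- by move=> x [].
- by move=> x [_ /= /ltW].
by apply: le_hausdorff => x [[]|[]].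
Qed.

Lemma caratheodory_measurable_fun (g : 'rV[R]_n -> R) : lipschitz1 g ->
  measurable_fun setT (g : caratheodory_type (@hausdorff_outer R n k) -> R).
Proof.
move=> Lg; apply: (@measurability _ _ (caratheodory_type (@hausdorff_outer R n k)) _ setT g _ (RGenOInfty.measurableE R)) => _ [_ [x ->] <-].
rewrite setTI (_ : g @^-1` _ = ~` [set y | g y <= x]%R).
  by apply: measurableC; exact: caratheodory_sublevel.
by apply/seteqP; split => y /=; rewrite in_itv /= andbT => gx; [apply/negP; rewrite -ltNge|rewrite ltNge; apply/negP].
Qed.

End HausdorffMetric.

Lemma ge0_integral_restrict_pushforward (R : realType) d d' (X : measurableType d) (Y : measurableType d')
    (mu : {measure set X -> \bar R}) (A : set X) (mA : measurable A) (psi : X -> Y)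
    (mpsi : measurable_fun setT psi) (m : {measure set Y -> \bar R}) :
  (forall B, measurable B -> m B = mu (psi @^-1` B `&` A)) ->
  forall G : Y -> \bar R, measurable_fun setT G -> (forall y, (0 <= G y)%E) ->
  (\int[mu]_(x in A) G (psi x) = \int[m]_y G y)%E.
Proof.
move=> mE G mG G0.
pose nu : {measure set X -> \bar R} := mrestr mu mA.
pose m' : {measure set Y -> \bar R} :=
  measure_function_pushforward__canonical__measure_function_Measure nu mpsi.
transitivity (\int[m']_y G y)%E; last first.
  by apply: eq_measure_integral => B mB _; rewrite mE.
have E := ge0_integral_pushforward mpsi nu measurableT mG (fun y _ => G0 y).
apply: etrans (esym E); rewrite preimage_setT.
have mGp : measurable_fun setT (G \o psi) by exact: measurableT_comp.
rewrite (@ge0_negligible_integral _ _ _ nu setT (~` A)) //; last first.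
- by rewrite /nu /= /mrestr setICl measure0.
- by move=> x _; exact: G0.
- exact: measurableC.
rewrite setTD setCK; apply: eq_measure_integral => B mB BA.
by rewrite /nu /= /mrestr (setIidl BA).
Qed.

Lemma ereal_ratio (R : realType) (x y : \bar R) (a b : R) : 0 < a ->
  (x * a%:E = y * b%:E)%E -> x = ((b / a)%:E * y)%E.
Proof.
move=> a0 E; have -> : x = (x * a%:E * (a^-1)%:E)%E.
  by rewrite -muleA -EFinM divff ?mule1 // gt_eqF.
by rewrite E -muleA -EFinM muleC.
Qed.

Section OrthonormalFrame.
Context {R : realType} {k n : nat}.
Variables (p : 'rV[R]_n) (M : 'M[R]_(k, n)).
Hypothesis MM : M *m M^T = 1%:M.

Lemma sqnorm_frame (t : 'rV[R]_k) : sqnorm (t *m M) = sqnorm t.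
Proof. by rewrite !sqnormE !dotpE trmx_mul mulmxA -(mulmxA t) MM mulmx1. Qed.

Lemma sqnorm_frame_split (w : 'rV[R]_n) :
  sqnorm w = sqnorm (w *m M^T) + sqnorm (w - w *m M^T *m M).
Proof.
rewrite sqnormD sqnormN sqnorm_frame -scaleN1r dotpZr.
have -> : dotp w (w *m M^T *m M) = sqnorm (w *m M^T).
  by rewrite sqnormE !dotpE !trmx_mul !mulmxA.
by ring.
Qed.

Lemma sqnorm_coframe_le (w : 'rV[R]_n) : sqnorm (w *m M^T) <= sqnorm w.
Proof. by rewrite (sqnorm_frame_split w) lerDl sqnorm_ge0. Qed.

Lemma lipschitz1_contraction m (N : 'M[R]_(n, m)) i :
  (forall w, sqnorm (w *m N) <= sqnorm w) ->
  lipschitz1 (fun y : 'rV[R]_n => ((y - p) *m N) 0 i).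
Proof.
move=> HN x y.
have -> : ((x - p) *m N) 0 i - ((y - p) *m N) 0 i = ((x - y) *m N) 0 i.
  rewrite (_ : (x - y) = (x - p) - (y - p)); last by rewrite opprB addrA subrK.
  by rewrite [in RHS]mulmxBl !mxE.
rewrite -sqrtr_sqr /enorm ler_sqrt ?sqnorm_ge0 //.
exact: le_trans (coord_le_sqnorm _ _) (HN _).
Qed.

Let A : set 'rV[R]_n := [set p + t *m M | t in [set: 'rV[R]_k]].
Let phi (t : 'rV[R]_k) := p + t *m M.
Let psi (y : 'rV[R]_n) := (y - p) *m M^T.
Let Hc := caratheodory_type (@hausdorff_outer R n k).

Lemma phiK t : psi (phi t) = t.
Proof. by rewrite /psi /phi addrC addKr -mulmxA MM mulmx1. Qed.

Lemma psiK y : A y -> phi (psi y) = y.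
Proof. by move=> [t _ <-]; rewrite phiK. Qed.

Lemma measurable_psi : measurable_fun setT (psi : Hc -> borel_rV k).
Proof.
apply: measurable_fun_rV => i; apply: caratheodory_measurable_fun.
by apply: lipschitz1_contraction; exact: sqnorm_coframe_le.
Qed.

Lemma measurable_plane : measurable (A : set Hc).
Proof.
pose N : 'M[R]_n := 1%:M - M^T *m M.
have HN w : sqnorm (w *m N) <= sqnorm w.
  by rewrite /N mulmxBr mulmx1 mulmxA (sqnorm_frame_split w) lerDr sqnorm_ge0.
have mN : measurable_fun setT ((fun y => (y - p) *m N) : Hc -> borel_rV n).
  apply: measurable_fun_rV => i; apply: caratheodory_measurable_fun.
  exact: lipschitz1_contraction.
have m0 : measurable ([set (0 : 'rV[R]_n)] : set (borel_rV n)).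
  rewrite (_ : [set (0 : 'rV[R]_n)] = eball n (0 : R)) //; first exact: measurable_eball.
  apply/seteqP; split => [_ ->|x]; rewrite /eball /= ?sqnorm0 // => x0.
  by apply/eqP; rewrite -sqnorm_eq0 eq_le x0 sqnorm_ge0.
have := measurable_preimageT mN m0; congr measurable.
apply/seteqP; split => y.
  rewrite /= /N mulmxBr mulmx1 => /eqP; rewrite subr_eq0 => /eqP yE.
  by exists (psi y) => //; rewrite /psi -mulmxA -yE subrKC.
move=> [t _ <-] /=; rewrite addrC addKr /N mulmxBr mulmx1 mulmxA -(mulmxA t) MM mulmx1.
by rewrite subrr.
Qed.

Definition plane_measure : {measure set (borel_rV k) -> \bar R} :=
  measure_function_pushforward__canonical__measure_function_Measure
    (mrestr (@hausdorff_measure R n k) measurable_plane) measurable_psi.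

Lemma plane_measureE B : plane_measure B = hausdorff k (psi @^-1` B `&` A).
Proof. by []. Qed.

Lemma le_hausdorff_translate (v : 'rV[R]_n) (E : set 'rV[R]_n) :
  (hausdorff k ((fun y => y + v)%R @^-1` E) <= hausdorff k E)%E.
Proof.
apply: ge_ereal_sup => _ [d /= d0 <-]; apply: le_trans (le_approx_hausdorff _ _ d0).
apply: le_ereal_inf_tmp => _ [F [_ FE] <-]; apply: ge_ereal_inf.
exists (\sum_(0 <= i <oo) hausdorff_gauge k d ((fun y => y + v)%R @^-1` F i))%E.
  exists (fun i => (fun y => y + v)%R @^-1` F i) => //; split => [i|y Ey].
    exact: sub_sigma_algebra.
  by have [i _ Fi] := FE _ Ey; exists i.
apply: lee_nneseries => [i *|i _]; first exact: hausdorff_gauge_ge0.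
apply: gauge_le_ediam => [[y Fy]|]; first by exists (y + v).
apply: le_ereal_sup => _ [[x y] /= [Fx Fy] <-]; exists (x + v, y + v) => //=.
by rewrite opprD addrACA subrr addr0.
Qed.

Lemma plane_measure_translate (a : 'rV[R]_k) (B : set (borel_rV k)) :
  plane_measure ((fun y => y + a) @^-1` B) = plane_measure B.
Proof.
have E b C : psi @^-1` ((fun y => y + b) @^-1` C) `&` A =
    (fun y => y + b *m M) @^-1` (psi @^-1` C `&` A).
  have psiD y : psi (y + b *m M) = psi y + b.
    by rewrite /psi addrAC mulmxDl -mulmxA MM mulmx1.
  apply/seteqP; split => y /=; rewrite psiD => -[Cy [t _ yE]]; split => //.
    by exists (t + b) => //; rewrite mulmxDl addrA yE.
  by exists (t - b) => //; rewrite mulmxBl addrA yE addrK.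
apply/le_anti/andP; split; rewrite !plane_measureE.
  by rewrite E; exact: le_hausdorff_translate.
rewrite -[X in (hausdorff k (psi @^-1` X `&` A) <= _)%E]
  (_ : (fun y => y + - a) @^-1` ((fun y => y + a) @^-1` B) = B).
  by rewrite E; exact: le_hausdorff_translate.
by apply/seteqP; split => y /=; rewrite subrK.
Qed.

Lemma gauge_le_diam (d e : R) (E : set 'rV[R]_n) : 0 <= e <= d ->
  (forall x y, E x -> E y -> sqnorm (x - y) <= e ^+ 2) ->
  (hausdorff_gauge k d E <= (ball_volume k / 2 ^+ k * e ^+ k)%:E)%E.
Proof.
move=> /andP[e0 ed] Ee; have C0 : 0 <= ball_volume k / 2 ^+ k :> R.
  by rewrite divr_ge0 ?ball_volume_ge0 // exprn_ge0.
have DE : (ediam E <= e%:E)%E.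
  apply: ge_ereal_sup => _ [[x y] /= [Ex Ey] <-]; rewrite lee_fin.
  by rewrite -(ger0_norm e0) -sqrtr_sqr ler_sqrt ?sqr_ge0 // Ee.
rewrite /hausdorff_gauge; case: asboolP => [_|/eqP/set0P E0].
  by rewrite lee_fin mulr_ge0 // exprn_ge0.
rewrite (le_trans DE) ?lee_fin // [X in (_ <= X)%E]EFinM EFin_expe lee_wpmul2l ?lee_fin //.
by apply: expe_le DE; exact: ediam_ge0.
Qed.

Lemma plane_measure_cube_lty (r : nat) : (plane_measure (cube k r%:R) < +oo)%E.
Proof.
pose s : R := r.+1%:R; have s0 : 0 < s by rewrite ltr0n.
pose C : R := ball_volume k / 2 ^+ k.
have C0 : 0 <= C by rewrite divr_ge0 ?ball_volume_ge0 // exprn_ge0.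
pose K : R := (4 * s * Num.sqrt k%:R) ^+ k * C.
apply: (@le_lt_trans _ _ K%:E); last exact: ltry.
rewrite plane_measureE; apply: ge_ereal_sup => _ [d /= d0 <-].
pose a (N : nat) : R := 2 * s / N.+1%:R.
have [N aN] : exists N, Num.sqrt k%:R * a N <= d.
  exists (Num.trunc (Num.sqrt k%:R * (2 * s) / d)).
  by rewrite /a mulrA ler_pdivrMr ?ltr0n // [leRHS]mulrC -ler_pdivrMr // ltW // truncnS_gt.
have a0 : 0 < a N by rewrite divr_gt0 ?ltr0n // mulr_gt0.
have aE : a N * N.+1%:R = 2 * s by rewrite divfK // pnatr_eq0.
pose cell (g : {ffun 'I_k -> 'I_N.+2}) : set 'rV[R]_n :=
  [set phi t | t in [set t : 'rV[R]_k | forall i, - s + a N * (g i)%:R <= t 0 i <= - s + a N * (g i).+1%:R]].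
pose e := [seq cell g | g <- enum {ffun 'I_k -> 'I_N.+2}].
have se : size e = (N.+2 ^ k)%N by rewrite size_map -cardE card_ffun !card_ord.
apply: (@le_trans _ _ (\sum_(0 <= i <oo) hausdorff_gauge k d (nth set0 e i))%E).
  apply: ereal_inf_lbound; exists (nth set0 e) => //; split => [i|y [cy Ay]].
    exact: sub_sigma_algebra.
  have cyi (i : 'I_k) : - s <= psi y 0 i <= s.
    rewrite -ler_norml; apply: le_trans (coord_le_norm _ _) _; apply: le_trans cy _.
    by rewrite ler_nat.
  have q0 (i : 'I_k) : 0 <= (psi y 0 i + s) / a N.
    by have /andP[h1 h2] := cyi i; rewrite divr_ge0 ?(ltW a0) //; lra.
  have tr (i : 'I_k) : (Num.trunc ((psi y 0%R i + s) / a N)%R < N.+2)%N.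
    have /andP[h1 h2] := cyi i; rewrite (truncn_lt_nat _ (q0 i)).
    rewrite ltr_pdivrMr // -natr1 mulrDl mul1r (mulrC _ (a N)) aE.
    by move: a0 h2; lra.
  pose g : {ffun 'I_k -> 'I_N.+2} := [ffun i => Ordinal (tr i)].
  have gE : g \in enum {ffun 'I_k -> 'I_N.+2} by rewrite mem_enum.
  exists (index g (enum {ffun 'I_k -> 'I_N.+2})) => //=.
  rewrite (nth_map g) ?index_mem // nth_index //.
  exists (psi y); last exact: psiK.
  move=> i; rewrite ffunE /=; have /andP[h1 h2] := cyi i.
  have /andP[t1 /ltW t2] := truncn_itv (q0 i).
  rewrite ler_pdivlMr // mulrC in t1; rewrite ler_pdivrMr // mulrC in t2.
  by apply/andP; split; move: t1 t2; lra.
pose b := C * (Num.sqrt k%:R * a N) ^+ k.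
have b0 : 0 <= b by rewrite mulr_ge0 // exprn_ge0 // mulr_ge0 // ltW.
have gb i : (hausdorff_gauge k d (nth set0 e i) <= (if (i < size e)%N then b else 0)%:E)%E.
  case: ltnP => ie; last by rewrite nth_default // hausdorff_gauge0.
  have /mapP[g _ ->] : nth set0 e i \in e by exact: mem_nth.
  apply: gauge_le_diam; first by rewrite aN mulr_ge0 // ltW.
  move=> _ _ [t tg <-] [u ug <-].
  rewrite /phi opprD addrACA subrr add0r -mulmxBl sqnorm_frame.
  rewrite exprMn sqr_sqrtr //; apply: le_trans (sqnorm_le_norm _) _.
  rewrite ler_wpM2l // ler_sqr ?nnegrE ?(ltW a0) //.
  apply: norm_rV_le; rewrite ?(ltW a0) // => j; rewrite !mxE.
  have := tg j; have := ug j; rewrite -natr1 mulrDr mulr1 ler_norml.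
  move=> /andP[u1 u2] /andP[t1 t2]; apply/andP; split; lra.
apply: lime_le; first by apply: is_cvg_nneseries => i *; exact: hausdorff_gauge_ge0.
apply: nearW => L; apply: le_trans (lee_sum _ (fun i _ => gb i)) _.
rewrite sumEFin lee_fin.
have -> : \sum_(0 <= i < L) (if (i < size e)%N then b else 0) = (minn L (size e))%:R * b.
  elim: L => [|L IH]; first by rewrite big_nil min0n mul0r.
  rewrite big_nat_recr //= IH; case: ltnP => Le.
    by rewrite (minn_idPl Le) -natr1 mulrDl mul1r.
  by rewrite (minn_idPr (leqW Le)) addr0.
apply: (@le_trans _ _ ((size e)%:R * b)); first by rewrite ler_wpM2r // ler_nat geq_minr.
rewrite se /b /K natrX mulrCA -exprMn mulrC ler_wpM2r //.
have sk : 0 <= Num.sqrt k%:R :> R by exact: sqrtr_ge0.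
rewrite lerXn2r ?nnegrE ?mulr_ge0 ?(ltW s0) ?(ltW a0) // mulrCA mulrC ler_wpM2r //.
rewrite -natr1 mulrDl mul1r mulrC aE.
have aN2 : a N <= 2 * s by rewrite -aE ler_peMr ?(ltW a0) // ler1n.
by move: aN2; lra.
Qed.

Lemma plane_measure_cube_gt0 : (0 < plane_measure (cube k (1 : R)))%E.
Proof.
have bv j : 0 < ball_volume j :> R.
  suff /andP[] : (0 < ball_volume j :> R) && (0 < ball_volume j.+1 :> R) by [].
  elim: j => [|j /andP[IH1 IH2]]; first by rewrite /= ltr01 ltr0n.
  by rewrite IH2 /= mulr_gt0 // divr_gt0 // mulr_gt0 // pi_gt0.
pose C : R := ball_volume k / 2 ^+ k.
have C0 : 0 < C by rewrite divr_gt0 // exprn_gt0.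
pose K : R := 2 ^+ k / C; have K0 : 0 < K by rewrite divr_gt0 // exprn_gt0.
apply: (@lt_le_trans _ _ C%:E); first by rewrite lte_fin.
rewrite plane_measureE; apply: le_trans (le_approx_hausdorff _ _ ltr01).
apply: le_ereal_inf_tmp => _ [F [_ FE] <-].
have KE : (0 < K%:E)%E by rewrite lte_fin.
rewrite -(@lee_pmul2l _ K%:E) // -EFinM /K divfK ?gt_eqF //.
have /choice[B HB] : forall i, exists B : set (borel_rV k), [/\ measurable B,
    phi @^-1` F i `<=` B & (lebesgue_rV k B <= K%:E * hausdorff_gauge k 1 (F i))%E].
  move=> i; have [goo|gfin] := eqVneq (hausdorff_gauge k (1 : R) (F i)) +oo%E.
    by exists setT; split => //; rewrite goo gt0_muley // leey.
  have [F0|/eqP/set0P [t0 Ft0]] := EM (phi @^-1` F i = set0).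
    exists set0; split => //; first by rewrite F0.
    by rewrite measure0 mule_ge0 ?hausdorff_gauge_ge0 // ltW.
  have F0 : F i !=set0 by exists (phi t0).
  move: gfin; rewrite /hausdorff_gauge asboolF; last by move=> E; rewrite E in Ft0.
  case: ifPn => [FD _|]; last by rewrite eqxx.
  have De : ediam (F i) \is a fin_num.
    by rewrite ge0_fin_numE ?ediam_ge0 // (le_lt_trans FD) // ltry.
  pose e := fine (ediam (F i)); have e0 : 0 <= e by rewrite fine_ge0 // ediam_ge0.
  have mB : measurable ((fun t => t + - t0) @^-1` cube k e : set (borel_rV k)).
    apply: measurable_preimageT (measurable_norm_le e).
    apply: measurable_fun_rV => j; under eq_fun do rewrite mxE.
    by apply: measurable_funD => //; exact: measurable_coord.
  exists ((fun t => t + - t0) @^-1` cube k e); split => //.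
    move=> t Ft; rewrite /cube /= -ler_sqr ?nnegrE //.
    apply: le_trans (norm_le_sqnorm _) _.
    have : ((enorm (phi t - phi t0))%:E <= ediam (F i))%E.
      by apply: ereal_sup_ubound; exists (phi t, phi t0).
    rewrite -(fineK De) lee_fin -/e -ler_sqr ?nnegrE ?sqrtr_ge0 // /enorm.
    rewrite sqr_sqrtr ?sqnorm_ge0 // /phi opprD addrACA subrr add0r -mulmxBl.
    by rewrite -[X in X <= _]/(sqnorm _) sqnorm_frame.
  rewrite lebesgue_rV_translation //; last exact: measurable_norm_le.
  rewrite lebesgue_cube // -(fineK De) -/e -EFin_expe -!EFinM lee_fin exprMn /K mulrA.
  by rewrite divfK ?gt_eqF.
rewrite -nneseriesZl; last by move=> *; exact: hausdorff_gauge_ge0.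
have -> : (2 ^+ k)%:E = lebesgue_rV k (cube k (1 : R)) by rewrite lebesgue_cube // mulr1.
apply: (@le_trans _ _ (\sum_(0 <= i <oo) lebesgue_rV k (B i))%E).
  apply: measure_sigma_subadditive.
  - by move=> i; have [] := HB i.
  - exact: measurable_norm_le.
  move=> t ct; have [|i _ Fi] := FE (phi t).
    by split; [rewrite /= phiK|exists t].
  by exists i => //; have [_ + _] := HB i; apply.
by apply: lee_nneseries => [i *|i _]; [exact: measure_ge0|have [] := HB i].
Qed.

(** The image of the Hausdorff measure under the isometric parametrization of the
    plane is translation invariant, finite and positive on cubes, so it is a
    multiple of Lebesgue measure. Only the vanishing of integrals is
    transported, so that the constant need not be computed. *)
Lemma ge0_integral_plane : exists2 c : R, 0 < c &
  forall G : borel_rV k -> \bar R, measurable_fun setT G -> (forall t, (0 <= G t)%E) ->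
  (\int[@hausdorff_measure R n k]_(y in A) G (psi y) = c%:E * \int[lebesgue_rV k]_t G t)%E.
Proof.
have m1 : measurable (cube k (1 : R) : set (borel_rV k)) by exact: measurable_norm_le.
have P1 := plane_measure_cube_lty 1.
have Pfin : plane_measure (cube k (1 : R)) \is a fin_num by rewrite ge0_fin_numE.
pose P := fine (plane_measure (cube k (1 : R))).
have P0 : 0 < P by rewrite fine_gt0 // plane_measure_cube_gt0.
have c0 : 0 < P / 2 ^+ k by rewrite divr_gt0 // exprn_gt0.
exists (P / 2 ^+ k) => // G mG G0.
pose cn : {nonneg R} := NngNum (ltW c0).
have mE B : measurable B -> plane_measure B = ((P / 2 ^+ k)%:E * lebesgue_rV k B)%E.
  move=> mB; apply: ereal_ratio; first by rewrite exprn_gt0.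
  have := @translation_invariant_unique R k plane_measure B (cube k (1 : R))
    plane_measure_cube_lty (fun a C _ => plane_measure_translate a C) mB m1.
  by rewrite lebesgue_cube // mulr1 -(fineK Pfin).
apply: etrans (ge0_integral_mscale (lebesgue_rV k) measurableT cn mG (fun t _ => G0 t)).
exact: (@ge0_integral_restrict_pushforward R _ _ Hc (borel_rV k) (@hausdorff_measure R n k) A
  measurable_plane psi measurable_psi (mscale cn (lebesgue_rV k)) (fun B mB => esym (mE B mB)) G mG G0).
Qed.

Lemma plane_integral_eq0 (f : 'rV[R]_n -> R) : litg (fun t => f (p + t *m M)) ->
  \int[@hausdorff_measure R n k]_(y in A) f y = 0 -> lint (fun t => f (p + t *m M)) = 0.
Proof.
have [c c0 Hc'] := ge0_integral_plane => If.
pose g (t : borel_rV k) := (f (p + t *m M))%:E.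
have mg : measurable_fun setT g by exact: measurable_int If.
have E : (\int[@hausdorff_measure R n k]_(y in A) (f y)%:E = c%:E * \int[lebesgue_rV k]_t g t)%E.
  transitivity (\int[@hausdorff_measure R n k]_(y in A) g (psi y))%E.
    by apply: eq_integral => y; rewrite inE => /psiK Ay; rewrite /g -[p + _]/(phi _) Ay.
  rewrite [LHS]integralE [X in (_ = _ * X)%E]integralE.
  rewrite muleBr //; last exact: integrable_add_def If.
  rewrite -(Hc' _ (measurable_funepos mg) (funepos_ge0 g)).
  rewrite -(Hc' _ (measurable_funeneg mg) (funeneg_ge0 g)).
  by congr (_ - _)%E; apply: eq_integral => y _; rewrite ?funeposE ?funenegE.
rewrite /Rintegral E /lint /Rintegral.
have Ifin : (\int[lebesgue_rV k]_t g t)%E \is a fin_num by exact: integrable_fin_num If.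
rewrite fineM //= => /eqP; rewrite mulf_eq0 gt_eqF //= => /eqP; exact.
Qed.

End OrthonormalFrame.

(** * Rapidly decreasing functions *)

Section Bump.
Context {R : realType}.

Definition bump (t : R) : R := flat 1 (1 - t).

Lemma continuous_bump : continuous bump.
Proof.
apply: cont_comp; first exact: continuous_flat.
by apply: cont_add; [exact: cont_cst|apply: cont_opp => x; exact: cvg_id].
Qed.

Lemma bump_eq0 (t : R) : 1 <= t -> bump t = 0.
Proof. by move=> t1; rewrite /bump /flat ltNge subr_le0 t1. Qed.

Lemma bump_gt0 (t : R) : t < 1 -> 0 < bump t.
Proof. by move=> t1; rewrite /bump /flat subr_gt0 t1 hornerC mul1r expR_gt0. Qed.

Lemma bump_ge0 (t : R) : 0 <= bump t.
Proof. by have [/bump_eq0 ->|/bump_gt0/ltW] := leP 1 t. Qed.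

End Bump.

Section RapidDecay.
Context {R : realType}.

(** Unlike [tame], this bound is stable under restriction to affine subspaces. *)
Definition rapid N n (f : 'rV[R]_n -> R) :=
  continuous f /\ exists2 C : R, 0 <= C & forall y, `|f y| <= C * (1 + sqnorm y) ^- N.

Lemma one_sqnorm_gt0 n (y : 'rV[R]_n) : 0 < 1 + sqnorm y.
Proof. by rewrite ltr_wpDr ?sqnorm_ge0. Qed.

Lemma rapid_tame N n (f : 'rV[R]_n -> R) : (n <= N)%N -> rapid N f -> tame f.
Proof.
move=> nN [cf [C C0 fC]]; split => //; exists C => // y; apply: le_trans (fC y) _.
rewrite ler_wpM2l // /decay prodfV lef_pV2 ?posrE ?exprn_gt0 ?one_sqnorm_gt0 //; last first.
  by apply: prodr_gt0 => i _; exact: oneDsqr_gt0.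
apply: (@le_trans _ _ (\prod_(i < n) (1 + sqnorm y))).
  apply: ler_prod => i _; rewrite oneDsqr_ge0 /oneDsqr lerD2l; exact: coord_le_sqnorm.
rewrite prodr_const card_ord ler_weXn2l // lerDl; exact: sqnorm_ge0.
Qed.

Lemma continuous_frame k n (x : 'rV[R]_n) (M : 'M[R]_(k, n)) : M *m M^T = 1%:M ->
  continuous (fun s : 'rV[R]_k => x + s *m M).
Proof.
move=> MM; suff H (s : 'rV[R]_k) : x + t *m M @[t --> s] --> x + s *m M by exact: H.
apply: (proj2 (@cvgrPdist_le R 'rV[R]_n 'rV[R]_k (nbhs s) (nbhs_filter s) (fun t => x + t *m M) (x + s *m M))) => e e0.
have K0 : 0 < Num.sqrt k%:R + 1 :> R by rewrite ltr_wpDl ?sqrtr_ge0.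
have d0 : 0 < e / (Num.sqrt k%:R + 1) by rewrite divr_gt0.
apply: filterS (nbhsx_ballx s _ d0) => t; rewrite -ball_normE /= => st.
rewrite opprD addrACA subrr add0r -mulmxBl.
have H : `|(s - t) *m M| <= Num.sqrt k%:R * `|s - t|.
  rewrite -ler_sqr ?nnegrE ?mulr_ge0 ?sqrtr_ge0 // exprMn sqr_sqrtr //.
  apply: le_trans (norm_le_sqnorm _) _; rewrite sqnorm_frame //; exact: sqnorm_le_norm.
apply: le_trans H _; apply: (@le_trans _ _ ((Num.sqrt k%:R + 1) * `|s - t|)).
  by rewrite ler_wpM2r // lerDl.
by rewrite mulrC -ler_pdivlMr // ltW.
Qed.

Lemma rapid_slice N k n (f : 'rV[R]_n -> R) (x : 'rV[R]_n) (M : 'M[R]_(k, n)) :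
  M *m M^T = 1%:M -> rapid N f -> rapid N (fun s : 'rV[R]_k => f (x + s *m M)).
Proof.
move=> MM [cf [C C0 fC]]; split.
  by move=> s; apply: continuous_comp; [exact: continuous_frame|exact: cf].
pose K := 2 + 2 * sqnorm x; have K0 : 0 < K by rewrite ltr_wpDr // mulr_ge0 // sqnorm_ge0.
exists (C * K ^+ N); first by rewrite mulr_ge0 // exprn_ge0 // ltW.
move=> s; apply: le_trans (fC _) _; rewrite -mulrA ler_wpM2l //.
rewrite -[K ^+ N]invrK -invfM lef_pV2 ?posrE ?mulr_gt0 ?invr_gt0 ?exprn_gt0 ?one_sqnorm_gt0 //.
rewrite ler_pdivrMl ?exprn_gt0 // -exprMn lerXn2r ?nnegrE ?mulr_ge0 ?(ltW K0) ?(ltW (one_sqnorm_gt0 _)) //.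
rewrite -(sqnorm_frame MM s); set y := x + s *m M.
have -> : s *m M = y + (- x) by rewrite /y addrC addKr.
apply: le_trans (_ : 1 + (2 * sqnorm y + 2 * sqnorm (- x)) <= _).
  by rewrite lerD2l sqnormD_le.
have := mulr_ge0 (sqnorm_ge0 x) (sqnorm_ge0 y).
by rewrite sqnormN /K; have := sqnorm_ge0 x; have := sqnorm_ge0 y; lra.
Qed.

End RapidDecay.

Lemma measurable_invr (R : realType) : measurable_fun setT (@GRing.inv R).
Proof.
rewrite (_ : @GRing.inv R = fun x => x * (expR (- ln `|x|)) ^+ 2); last first.
  apply/funext => x; have [->|x0] := eqVneq x 0; first by rewrite mul0r invr0.
  rewrite expRN lnK ?posrE ?normr_gt0 // exprVn real_normK ?num_real //; field.
  exact: x0.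
apply: measurable_funM => //; apply: measurable_funX.
apply: (measurableT_comp (f := @expR R)) => //; apply: measurable_funN.
by apply: (measurableT_comp (f := @ln R)) => //; exact: measurable_ln.
Qed.

Section AverageOverLines.
Context {R : realType} (q : nat).
Let n := q.+2.

Let D : set (borel_rV n) := [set w : 'rV[R]_n | 0 < sqnorm w <= 1].

Definition line_proj (w : 'rV[R]_n) : 'M[R]_n := (sqnorm w)^-1 *: (w^T *m w).

Lemma qform_line w z : qform (line_proj w) z = (sqnorm w)^-1 * dotp z w ^+ 2.
Proof.
have zw : z *m (w^T *m w) = dotp z w *: w.
  by rewrite mulmxA [z *m _]mx11_scalar -dotpE mul_scalar_mx.
by rewrite /qform /line_proj -scalemxAr dotpZl zw dotpZl (dotpC w) expr2.
Qed.

Lemma measurable_sqnorm k : measurable_fun setT (@sqnorm R k : borel_rV k -> R).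
Proof. by apply: continuous_measurable_rV; exact: continuous_sqnorm. Qed.

Lemma measurable_punctured_ball : measurable D.
Proof.
have m0 : measurable (~` [set (0 : 'rV[R]_n)] : set (borel_rV n)).
  apply: measurableC; rewrite (_ : [set (0 : 'rV[R]_n)] = eball n (0 : R)); first exact: measurable_eball.
  apply/seteqP; split => [_ ->|x]; rewrite /eball /= ?sqnorm0 // => x0.
  by apply/eqP; rewrite -sqnorm_eq0 eq_le x0 sqnorm_ge0.
rewrite (_ : D = eball n (1 : R) `&` ~` [set 0]).
  by apply: measurableI => //; exact: measurable_eball.
apply/seteqP; split => w; rewrite /D /eball /= sqnorm_gt0.
  by move=> /andP[/eqP ? ?].
by move=> [-> /eqP ->].
Qed.

Lemma punctured_ball_lty : (lebesgue_rV n D < +oo)%E.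
Proof.
apply: le_lt_trans (lebesgue_eball_lty n (1 : R)); apply: le_measure; rewrite ?inE.
- exact: measurable_punctured_ball.
- exact: measurable_eball.
- by move=> w /andP[].
Qed.

Lemma punctured_ball_gt0 : 0 < fine (lebesgue_rV n D).
Proof.
rewrite fine_gt0 // punctured_ball_lty andbT.
have m0 : measurable (cube n (0 : R) : set (borel_rV n)) by exact: measurable_norm_le.
apply: (lt_le_trans (lebesgue_eball_gt0 n (@ltr01 R))).
apply: (@le_trans _ _ (lebesgue_rV n (D `|` cube n (0 : R)))).
  apply: le_measure; rewrite ?inE.
  - exact: measurable_eball.
  - by apply: measurableU => //; exact: measurable_punctured_ball.
  move=> w; rewrite /D /eball /= => w1; have [->|w0] := eqVneq w 0.
    by right; rewrite /cube /= normr0.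
  by left; rewrite sqnorm_gt0 w0.
apply: le_trans (measureU2 _ _ _) _ => //; first exact: measurable_punctured_ball.
have c0 : lebesgue_rV n (cube n (0 : R)) = 0%E by rewrite lebesgue_cube // mulr0 expr0n.
by rewrite [X in (_ + X)%E](_ : _ = 0%E) ?adde0 //; exact: c0.
Qed.

Lemma line_average (h : R -> R) (z : 'rV[R]_n) : continuous h ->
  fint (lebesgue_rV n) D (fun w => h (qform (line_proj w) z)) =
  fine (lebesgue_rV n D) / sin_cos_int 0 q * radial_avg 0 q h (sqnorm z).
Proof.
have mD := measurable_punctured_ball; have Doo := punctured_ball_lty.
have mX i j : measurable_fun D (fun w : borel_rV n => line_proj w i j).
  apply: (@measurable_funS _ _ _ _ setT) => //.
  rewrite /line_proj; under eq_fun do rewrite mxE mxE big_ord1 mxE.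
  apply: measurable_funM; last by apply: measurable_funM; exact: measurable_coord.
  apply: (measurableT_comp (f := @GRing.inv R)); last exact: measurable_sqnorm.
  exact: measurable_invr.
have sX w : D w -> (line_proj w)^T = line_proj w.
  by move=> _; rewrite /line_proj linearZ /= trmx_mul trmxK.
have ww (w : 'rV[R]_n) : w *m w^T = (sqnorm w)%:M by rewrite [LHS]mx11_scalar sqnormE dotpE.
have iX w : D w -> line_proj w *m line_proj w = line_proj w.
  move=> /andP[w0 _]; rewrite /line_proj -scalemxAl -scalemxAr mulmxA -(mulmxA w^T) ww.
  by rewrite mul_mx_scalar -scalemxAl !scalerA mulVf ?mulr1 // gt_eqF.
have tX w : D w -> \tr (line_proj w) = 1%:R.
  by move=> /andP[w0 _]; rewrite /line_proj mxtraceZ mxtrace_mulC ww mxtrace_scalar mulVf // gt_eqF.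
pose F a z := fint (lebesgue_rV n) D (fun w => qform (line_proj w) z ^+ a).
have bq := bm_qform mX sX iX.
move=> ch; apply: (@projection_average R _ _ (lebesgue_rV n) D mD Doo n 0 q line_proj (erefl _) mX sX iX tX (fun a => F a (delta_mx 0 ord0)) _ h z ch).
move=> a {}z; apply: (@rotation_invariant_homogeneous R n ord0 (F a) a isT) => // [c y|Q y QQ _].
  rewrite /F -fintZ //; last by apply: bmX; exact: bq.
  by apply: eq_fint => w _; rewrite qformZ exprMn exprM.
have QT : orthogonal_mx Q^T by rewrite /orthogonal_mx trmxK; exact: orthogonal_mxC QQ.
have DQ : (fun w : borel_rV n => w *m Q^T) @^-1` D = D.
  by apply/seteqP; split => w; rewrite /D /= sqnorm_orthogonal.
rewrite /F /fint /Rintegral; congr fine.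
have mG : measurable_fun D (fun w => (qform (line_proj w) y ^+ a)%:E).
  by apply/measurable_EFinP; apply: (bmX a (bq y)).1.
have G0 w : D w -> (0 <= (qform (line_proj w) y ^+ a)%:E)%E.
  by move=> Dw; rewrite lee_fin exprn_ge0 // qform_line mulr_ge0 ?invr_ge0 ?sqnorm_ge0 ?sqr_ge0.
rewrite -(ge0_integral_orthogonal QT mD DQ mG G0).
apply: eq_integral => w _; rewrite !qform_line sqnorm_orthogonal //; do 4 congr (_ _).
by rewrite !dotpE trmx_mul trmxK mulmxA.
Qed.

Lemma ge0_integral_isometry (x : 'rV[R]_n) (Q : 'M[R]_n) (f : borel_rV n -> \bar R) :
  orthogonal_mx Q -> measurable_fun setT f -> (forall y, (0 <= f y)%E) ->
  (\int[lebesgue_rV n]_y f y = \int[lebesgue_rV n]_y f (x + y *m Q)%R)%E.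
Proof.
move=> hQ mf f0.
have mT : measurable_fun setT (fun y : borel_rV n => y + x : borel_rV n).
  apply: measurable_fun_rV => i; under eq_fun do rewrite mxE.
  by apply: measurable_funD => //; exact: measurable_coord.
have mQ := measurable_mulmxr Q.
have mfx : measurable_fun setT (fun y : borel_rV n => f (y + x)) by exact: (measurableT_comp mf mT).
transitivity (\int[lebesgue_rV n]_y f (y + x)%R)%E.
  pose m : {measure set (borel_rV n) -> \bar R} :=
    measure_function_pushforward__canonical__measure_function_Measure (lebesgue_rV n) mT.
  transitivity (\int[m]_y f y)%E.
    by apply: eq_measure_integral => A mA _; apply/esym; exact: lebesgue_rV_translation.
  by apply: etrans (ge0_integral_pushforward mT _ measurableT mf (fun y _ => f0 y)) _; rewrite preimage_setT.
apply: esym; under eq_integral do rewrite addrC.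
exact: (ge0_integral_orthogonal (f := fun y => f (y + x)) hQ measurableT (preimage_setT _) mfx (fun y _ => f0 _)).
Qed.

End AverageOverLines.

Section LineSlices.
Context {R : realType} (q : nat).
Let n := q.+2.
Hypothesis q_even : ~~ odd q.
Notation D := [set w : 'rV[R]_n | 0 < sqnorm w <= 1].

Definition pos_part (g : 'rV[R]_n -> R) y := (`|g y| + g y) / 2.

Lemma pos_part_ge0 g y : 0 <= pos_part g y.
Proof.
rewrite divr_ge0 //; have H := ler_norm (- g y); rewrite normrN in H.
by move: H; lra.
Qed.

Lemma pos_part_sub g y : pos_part g y - pos_part (fun y => - g y) y = g y.
Proof. by rewrite /pos_part normrN; field. Qed.

Lemma pos_part_le g y : `|pos_part g y| <= `|g y|.
Proof.
rewrite ger0_norm ?pos_part_ge0 // ler_pdivrMr //; have := ler_norm (g y); lra.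
Qed.

Lemma rapid_pos_part N g : rapid N g -> rapid N (pos_part g).
Proof.
move=> [cg [C C0 gC]]; split.
  apply: cont_mul; last exact: cont_cst.
  by apply: cont_add => //; apply: cont_comp cg; exact: norm_continuous.
by exists C => // y; apply: le_trans (pos_part_le _ _) (gC y).
Qed.

Lemma rapidN N (g : 'rV[R]_n -> R) : rapid N g -> rapid N (fun y => - g y).
Proof.
move=> [cg [C C0 gC]]; split; first exact: cont_opp.
by exists C => // y; rewrite normrN.
Qed.

Lemma measurable_qform_line (z : 'rV[R]_n) :
  measurable_fun setT (fun w : borel_rV n => qform (line_proj w) z).
Proof.
under eq_fun do rewrite qform_line dotpC expr2.
apply: measurable_funM.
  by apply: measurableT_comp; [exact: measurable_invr|exact: measurable_sqnorm].
by apply: measurable_funM; apply: continuous_measurable_rV; exact: continuous_dotp.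
Qed.

Lemma lint_fin k (g : 'rV[R]_k -> R) : litg g -> (\int[lebesgue_rV k]_y (g y)%:E = (lint g)%:E)%E.
Proof. by move=> Ig; rewrite /lint /Rintegral fineK //; exact: integrable_fin_num Ig. Qed.

(** For a direction w, integrate first over the hyperplanes orthogonal to w. *)
Lemma hyperplane_slices g (h : R -> R) (x w : 'rV[R]_n) : rapid n g -> continuous h ->
  (forall t, 0 <= h t) -> 0 < sqnorm w ->
  (forall x' (M : 'M[R]_(q.+1, n)), M *m M^T = 1%:M -> h (sqnorm (x' - x)) != 0 ->
     lint (fun t => g (x' + t *m M)) = 0) ->
  (\int[lebesgue_rV n]_y (pos_part g y * h (qform (line_proj w) (y - x)))%:E =
   \int[lebesgue_rV n]_y (pos_part (fun y => - g y) y * h (qform (line_proj w) (y - x)))%:E)%E.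
Proof.
move=> rg ch h0 w0 H.
pose v := (Num.sqrt (sqnorm w))^-1 *: w.
have v1 : sqnorm v = 1 by rewrite /v sqnormZ exprVn sqr_sqrtr ?(ltW w0) // mulVf // gt_eqF.
have e1 : sqnorm (delta_mx 0 ord0 : 'rV[R]_n) = 1.
  rewrite /sqnorm (bigD1 ord0) //= big1 ?addr0 ?mxE ?eqxx ?expr1n // => j /negPf ji.
  by rewrite mxE ji andbF expr0n.
have [Q hQ eQ] := householder (etrans e1 (esym v1)).
pose M : 'M[R]_(q.+1, n) := dsubmx (Q : 'M[R]_(1 + q.+1, n)).
have QE : Q = col_mx v M :> 'M[R]_(1 + q.+1, n).
  suff -> : v = usubmx (Q : 'M[R]_(1 + q.+1, n)) by rewrite /M vsubmxK.
  rewrite -eQ -rowE; apply/rowP => j; rewrite !mxE; congr (Q _ _).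
  exact/val_inj.
have MM : M *m M^T = 1%:M.
  have : col_mx v M *m (col_mx v M)^T = 1%:M :> 'M[R]_(1 + q.+1) by rewrite -QE; exact: hQ.
  by rewrite tr_col_mx mul_col_row scalar_mx_block => /eq_block_mx[_ _ _].
have qE (s : R) (t : 'rV[R]_q.+1) : qform (line_proj w) (rVcons s t *m Q) = s ^+ 2.
  have wE : w = Num.sqrt (sqnorm w) *: v by rewrite /v scalerA divff ?scale1r // gt_eqF // sqrtr_gt0.
  rewrite qform_line {2}wE dotpZr exprMn sqr_sqrtr ?(ltW w0) // mulKf ?gt_eqF //.
  rewrite -eQ dotp_orthogonal // /dotp (bigD1 ord0) //= big1 ?addr0 => [|j /negPf ji].
    by rewrite rVcons0 mxE eqxx mulr1.
  by rewrite mxE ji andbF mulr0.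
have slice f : rapid n f -> (forall y, 0 <= f y) ->
   (\int[lebesgue_rV n]_y (f y * h (qform (line_proj w) (y - x)))%:E =
    \int[lebesgue_measure]_s ((h (s ^+ 2) * lint (fun t => f ((x + s *: v) + t *m M)))%:E))%E.
  move=> rf f0.
  have cq : continuous (fun y : 'rV[R]_n => h (qform (line_proj w) (y - x))).
    apply: cont_comp ch _; under eq_fun do rewrite qform_line.
    apply: cont_mul; first exact: cont_cst.
    apply: cont_exp; under eq_fun do rewrite dotpDl.
    by apply: cont_add; [exact: continuous_dotp|exact: cont_cst].
  have mf : measurable_fun setT (fun y : borel_rV n => (f y * h (qform (line_proj w) (y - x)))%:E).
    apply/measurable_EFinP; apply: continuous_measurable_rV; apply: cont_mul => //; exact: rf.1.
  have G0 y : (0 <= (f y * h (qform (line_proj w) (y - x)))%:E)%E by rewrite lee_fin mulr_ge0.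
  rewrite (ge0_integral_isometry x hQ mf G0).
  have E y : (f (x + y *m Q) * h (qform (line_proj w) (x + y *m Q - x)))%R =
     f (x + y *m Q) * h (qform (line_proj w) (y *m Q)) by rewrite (addrAC x) subrr add0r.
  under eq_integral do rewrite E.
  rewrite ge0_integral_lebesgue_rVS; last first.
  - by move=> y; rewrite lee_fin mulr_ge0.
  - apply/measurable_EFinP; apply: continuous_measurable_rV; apply: cont_mul.
      have cQ : continuous (fun s : 'rV[R]_n => x + s *m Q) by exact: continuous_frame.
      by move=> s; apply: continuous_comp; [exact: cQ|exact: rf.1].
    have cQ : continuous (fun s : 'rV[R]_n => x + s *m Q) by exact: continuous_frame.
    rewrite (_ : (fun s : 'rV[R]_n => h (qform (line_proj w) (s *m Q))) =
      (fun y => h (qform (line_proj w) (y - x))) \o (fun s => x + s *m Q)); last first.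
      by apply/funext => s /=; rewrite (addrAC x) subrr add0r.
    by move=> s; apply: continuous_comp; [exact: cQ|exact: cq].
  have E2 s (t : 'rV[R]_q.+1) : f (x + rVcons s t *m Q) * h (qform (line_proj w) (rVcons s t *m Q)) =
      h (s ^+ 2) * f (x + s *: v + t *m M).
    by rewrite qE mulrC QE (mul_rVcons s t v M) addrA.
  apply: eq_integral => s _; under eq_integral do rewrite E2 EFinM.
  have rs := rapid_slice (x + s *: v) MM rf.
  have Is : litg (fun t => f (x + s *: v + t *m M)).
    by apply: tame_integrable; apply: rapid_tame rs.
  rewrite ge0_integralZl //; last first.
  - by rewrite lee_fin.
  - by move=> t _; rewrite lee_fin.
  - exact: measurable_int Is.
  by rewrite lint_fin // -EFinM.
have rp := rapid_pos_part rg; have rm := rapid_pos_part (rapidN rg).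
rewrite (slice _ rp (pos_part_ge0 g)) (slice _ rm (pos_part_ge0 _)).
apply: eq_integral => s _; congr (_%:E).
have [->|hs] := eqVneq (h (s ^+ 2)) 0; first by rewrite !mul0r.
congr (_ * _); apply/eqP; rewrite -subr_eq0 -lintB; last 2 first.
- by apply: tame_integrable; apply: rapid_tame (rapid_slice _ MM rp).
- by apply: tame_integrable; apply: rapid_tame (rapid_slice _ MM rm).
rewrite (_ : (fun t => _) = fun t => g (x + s *: v + t *m M)); last first.
  by apply/funext => t; rewrite pos_part_sub.
by rewrite H // addrC addKr sqnormZ v1 mulr1.
Qed.

(** The hyperplane case. The integral of g against h (<y - x, w>^2 / |w|^2) is an
    integral over hyperplanes orthogonal to w, and it vanishes for every w when h
    has small support; averaging over w produces a radial average of h. *)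
Lemma rapid_slices_eq0 g (r : R) : rapid n g -> 0 < r ->
  (forall y, sqnorm y < r -> g y = 0) ->
  (forall x (M : 'M[R]_(q.+1, n)), M *m M^T = 1%:M -> sqnorm x < r ->
     lint (fun t => g (x + t *m M)) = 0) ->
  forall z, g z = 0.
Proof.
move=> rg r0 g0 H.
have tg : tame g by exact: rapid_tame rg.
have r4 : 0 < r / 4 by rewrite divr_gt0.
have rr : r / 4 <= r by rewrite ler_pdivrMr // ler_peMr ?(ltW r0) // ler1n.
apply: (@radial_orthogonal_eq0 R n bump 0 q continuous_bump (@bump_eq0 R) (@bump_gt0 R) q_even
   g 0 (r / 4) (r / 4) tg r4 r4).
  by move=> y; rewrite subr0 => yr; apply: g0; exact: lt_le_trans yr rr.
move=> l x l0 lr; rewrite subr0 => xr.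
pose h t := bump (l^-1 * t).
have ch : continuous h.
  by apply: cont_comp; [exact: continuous_bump|apply: cont_mul; [exact: cont_cst|move=> ?; exact: cvg_id]].
have h0 t : 0 <= h t by exact: bump_ge0.
have hne t : h t != 0 -> t < l.
  by apply: contraNT; rewrite -leNgt => lt; rewrite /h bump_eq0 // ler_pdivlMl // mulr1.
have [B B0 HB] := continuous_bounded_segment 0 1 (@continuous_bump R).
have hB t : 0 <= t -> h t <= B.
  move=> t0; have lt0 : 0 <= l^-1 * t by rewrite mulr_ge0 ?invr_ge0 ?(ltW l0).
  have [t1|/ltW t1] := leP (l^-1 * t) 1; first by apply: le_trans (ler_norm _) (HB _ _); rewrite lt0.
  by rewrite /h bump_eq0.
have K0 : 0 < fine (lebesgue_rV n D) / sin_cos_int 0 q.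
  by rewrite divr_gt0 ?punctured_ball_gt0 // sin_cos_int_gt0.
set K := _ / _ in K0.
have radE t : radial_avg 0 q bump (l^-1 * t) = radial_avg 0 q h t.
  by rewrite /radial_avg /h; congr (segint _ _ _); apply/funext => u; rewrite (mulrA l^-1).
have mD := @measurable_punctured_ball R q.
have avg y : (\int[lebesgue_rV n]_(w in D) (h (qform (line_proj w) (y - x)))%:E =
   (K * radial_avg 0 q h (sqnorm (y - x)))%:E)%E.
  rewrite -line_average // /fint /Rintegral fineK //.
  apply: integrable_fin_num => //; apply: measurable_bounded_integrable => //.
  - exact: punctured_ball_lty.
  - apply: measurableT_comp; first exact: continuous_measurable_fun.
    apply: (@measurable_funS _ _ _ _ setT) => //.
    exact: measurable_qform_line.
  exists B; split => [|C BC w _]; first exact: num_real.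
  apply: le_trans (ltW BC); rewrite ger0_norm // hB // qform_line.
  by rewrite mulr_ge0 ?invr_ge0 ?sqnorm_ge0 ?sqr_ge0.
pose P (f : 'rV[R]_n -> R) (y w : 'rV[R]_n) : R := f y * h (qform (line_proj w) (y - x)) * \1_D w.
have main f : rapid n f -> (forall y, 0 <= f y) ->
  ((lint (fun y => f y * (K * radial_avg 0 q h (sqnorm (y - x)))))%:E =
   \int[lebesgue_rV n]_w (\int[lebesgue_rV n]_y (P f y w)%:E))%E /\
   litg (fun y => f y * (K * radial_avg 0 q h (sqnorm (y - x)))).
  move=> rf f0.
  have cr : continuous (fun y : 'rV[R]_n => K * radial_avg 0 q h (sqnorm (y - x))).
    apply: cont_mul; first exact: cont_cst.
    by apply: cont_comp; [exact: continuous_radial_avg|exact: continuous_sqdist].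
  have I : litg (fun y => f y * (K * radial_avg 0 q h (sqnorm (y - x)))).
    apply: (litg_tameM (B := K * (B * (pi / 2)))) => //; first exact: rapid_tame rf.
    move=> y; rewrite normrM (gtr0_norm K0) ler_pM2l //; apply: le_radial_avg => //; first exact: sqnorm_ge0.
    by move=> t /andP[t0 _]; rewrite ger0_norm // hB.
  split => //; rewrite -lint_fin //.
  transitivity (\int[lebesgue_rV n]_y (\int[lebesgue_rV n]_w (P f y w)%:E))%E.
    apply: eq_integral => y _; rewrite EFinM -avg -ge0_integralZl //; last 3 first.
    - apply/measurable_EFinP; apply: measurableT_comp; first exact: continuous_measurable_fun.
      apply: (@measurable_funS _ _ _ _ setT) => //.
      exact: measurable_qform_line.
    - by move=> w _; rewrite lee_fin.
    - by rewrite lee_fin.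
    rewrite [LHS]integral_mkcond; apply: eq_integral => w _; rewrite /P indicE patchE.
    by case: (w \in D); rewrite ?mulr1 ?mulr0.
  have mP : measurable_fun setT (fun yw : borel_rV n * borel_rV n => (P f yw.1 yw.2)%:E).
    apply/measurable_EFinP; apply: measurable_funM; last first.
      by apply: measurableT_comp; [exact: measurable_indic|exact: measurable_snd].
    apply: measurable_funM.
      apply: measurableT_comp; last exact: measurable_fst.
      by apply: continuous_measurable_rV; exact: rf.1.
    apply: measurableT_comp; first exact: continuous_measurable_fun.
    under eq_fun do rewrite qform_line expr2.
    apply: measurable_funM.
      apply: measurableT_comp; first exact: measurable_invr.
      by apply: measurableT_comp; [exact: measurable_sqnorm|exact: measurable_snd].
    have md : measurable_fun setT (fun yw : borel_rV n * borel_rV n => dotp (yw.1 - x) yw.2).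
      rewrite /dotp; apply: measurable_sum => i; apply: measurable_funM.
        under eq_fun do rewrite mxE.
        apply: measurable_funD => //.
        by apply: (measurableT_comp (f := fun y : borel_rV n => y 0 i)); [exact: measurable_coord|exact: measurable_fst].
      by apply: (measurableT_comp (f := fun y : borel_rV n => y 0 i)); [exact: measurable_coord|exact: measurable_snd].
    exact: measurable_funM.
  have P0 yw : (0 <= (P f yw.1 yw.2)%:E)%E by rewrite lee_fin /P !mulr_ge0.
  exact: (@fubini_tonelli _ _ _ _ _ (lebesgue_rV n) (lebesgue_rV n) (fun yw => (P f yw.1 yw.2)%:E) mP P0).
have rp := rapid_pos_part rg; have rm := rapid_pos_part (rapidN rg).
have [Ep Ip] := main _ rp (pos_part_ge0 g).
have [Em Im] := main _ rm (pos_part_ge0 (fun y => - g y)).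
suff E : lint (fun y => pos_part g y * (K * radial_avg 0 q h (sqnorm (y - x)))) =
    lint (fun y => pos_part (fun y => - g y) y * (K * radial_avg 0 q h (sqnorm (y - x)))).
  have : lint (fun y => K * (g y * radial_avg 0 q bump (l^-1 * sqnorm (y - x)))) = 0.
    have L := lintB Ip Im; rewrite E subrr in L.
    rewrite -[RHS]L; congr lint; apply/funext => y.
    by rewrite -mulrBl pos_part_sub radE mulrCA.
  have cr : continuous (fun y : 'rV[R]_n => radial_avg 0 q bump (l^-1 * sqnorm (y - x))).
    apply: cont_comp; first by apply: continuous_radial_avg; exact: continuous_bump.
    by apply: cont_mul; [exact: cont_cst|exact: continuous_sqdist].
  rewrite lintZ => [/eqP|].
    by rewrite mulf_eq0 gt_eqF //= => /eqP.
  apply: (litg_tameM (B := B * (pi / 2))) => // y; rewrite radE.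
  apply: le_radial_avg => //; first exact: sqnorm_ge0.
  by move=> t /andP[t0 _]; rewrite ger0_norm // hB.
apply: EFin_inj; rewrite Ep Em; apply: eq_integral => w _.
have [wD|wD] := boolP (w \in D); last first.
  by congr (integral _ _ _); apply/funext => y; rewrite /P indicE (negPf wD) !mulr0.
have PE f y : P f y w = f y * h (qform (line_proj w) (y - x)) by rewrite /P indicE wD mulr1.
under eq_integral do rewrite PE.
under [RHS]eq_integral do rewrite PE.
apply: hyperplane_slices => //; first by move: wD; rewrite inE => /andP[].
move=> x' M MM hx; apply: H => //.
have := hne _ hx; have -> : x' = (x' - x) + x by rewrite subrK.
by rewrite addrK => xl; apply: le_lt_trans (sqnormD_le _ _) _; move: xl lr xr; lra.
Qed.

End LineSlices.

Section FunctionCase.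
Context {R : realType} {n : nat}.

Lemma rapid_le N N' k (f : 'rV[R]_k -> R) : (N' <= N)%N -> rapid N f -> rapid N' f.
Proof.
move=> NN [cf [C C0 fC]]; split => //; exists C => // y; apply: le_trans (fC y) _.
rewrite ler_wpM2l // lef_pV2 ?posrE ?exprn_gt0 ?one_sqnorm_gt0 //.
by rewrite ler_weXn2l // lerDl sqnorm_ge0.
Qed.

Lemma row_free_orthonormal k (M : 'M[R]_(k, n)) : M *m M^T = 1%:M -> row_free M.
Proof. by move=> MM; apply/row_freeP; exists M^T. Qed.

(** A point z outside V and x0 lie in a common (d+1)-plane; the restriction of g to
    it satisfies the assumptions of the hyperplane case. *)
Lemma function_case (d : 'I_n) (V : set 'rV[R]_n) (x0 : 'rV[R]_n) (g : 'rV[R]_n -> R) :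
  open V -> V x0 -> odd d -> rapid n g -> (forall x, V x -> g x = 0) ->
  (forall A : dplane d, planes_meeting V A ->
     \int[@hausdorff_measure R n d]_(y in dplane_set A) g y = 0) ->
  forall z, g z = 0.
Proof.
case: d => -[//|q] qn /= Vo Vx0 q_even rg gV gA z.
have [e e0 He] : exists2 e : R, 0 < e & forall y, sqnorm (y - x0) < e ^+ 2 -> V y.
  have /nbhs_ballP[e /= e0 He] : nbhs x0 V by exact: open_nbhs_nbhs.
  exists e => // y ye; apply: He; rewrite -ball_normE /= distrC -ltr_sqr ?nnegrE ?(ltW e0) //.
  exact: le_lt_trans (norm_le_sqnorm _) ye.
have [->|zx] := eqVneq z x0; first exact: gV.
pose a := Num.sqrt (sqnorm (z - x0)).
have a0 : 0 < a by rewrite sqrtr_gt0 sqnorm_gt0 subr_eq0.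
pose v := a^-1 *: (z - x0).
have v1 : sqnorm v = 1.
  by rewrite /v sqnormZ exprVn sqr_sqrtr ?sqnorm_ge0 // mulVf // sqnorm_eq0 subr_eq0.
pose i0 : 'I_n := Ordinal (ltn_trans (ltn0Sn q) qn).
have e1 : sqnorm (delta_mx 0 i0 : 'rV[R]_n) = 1.
  rewrite /sqnorm (bigD1 i0) //= big1 ?addr0 ?mxE ?eqxx ?expr1n // => j /negPf ji.
  by rewrite mxE ji andbF expr0n.
have [Q hQ eQ] := householder (etrans e1 (esym v1)).
pose wd (i : 'I_q.+2) : 'I_n := widen_ord qn i.
pose N : 'M[R]_(q.+2, n) := \matrix_(i, j) Q (wd i) j.
have NN : N *m N^T = 1%:M.
  apply/matrixP => i j; rewrite !mxE.
  have := congr1 (fun A : 'M[R]_n => A (wd i) (wd j)) hQ; rewrite !mxE => QQ.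
  transitivity ((wd i == wd j)%:R : R); last by congr (_%:R).
  by rewrite -QQ; apply: eq_bigr => l _; rewrite !mxE.
have vN : delta_mx 0 ord0 *m N = v.
  rewrite -eQ -!rowE; apply/rowP => j; rewrite !mxE; congr (Q _ _).
  exact/val_inj.
pose G (s : 'rV[R]_q.+2) := g (x0 + s *m N).
have rG : rapid q.+2 G by exact: (rapid_le qn (rapid_slice x0 NN rg)).
have -> : z = x0 + (a *: delta_mx 0 ord0) *m N.
  by rewrite -scalemxAl vN /v scalerA divff ?gt_eqF // scale1r subrKC.
apply: (rapid_slices_eq0 (q := q) _ rG (r := e ^+ 2)); first by rewrite -[~~ _]/(odd q.+1).
- by rewrite exprn_gt0.
- by move=> y ye; apply: gV; apply: He; rewrite addrC addKr sqnorm_frame.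
move=> x M MM xe; rewrite /G.
have MN : (M *m N) *m (M *m N)^T = 1%:M by rewrite trmx_mul mulmxA -(mulmxA M) NN mulmx1.
have E (t : 'rV[R]_q.+1) : x0 + (x + t *m M) *m N = (x0 + x *m N) + t *m (M *m N).
  by rewrite mulmxDl addrA mulmxA.
under [X in lint X]funext do rewrite E.
apply: plane_integral_eq0 => //.
  by apply: tame_integrable; apply: rapid_tame (rapid_slice _ MN rg); exact: ltnW.
pose A := @mk_dplane R n (Ordinal qn) (x0 + x *m N) (M *m N) (row_free_orthonormal MN).
apply: (gA A); exists (x0 + x *m N); split.
  by exists 0 => //; rewrite mul0mx addr0.
by apply: He; rewrite addrC addKr sqnorm_frame.
Qed.

Lemma normc_ge_part (z : R[i]) : `|complex.Re z| <= ComplexField.Normc.normc z /\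
  `|complex.Im z| <= ComplexField.Normc.normc z.
Proof.
case: z => a b /=; rewrite -!sqrtr_sqr; split; rewrite ler_wsqrtr //.
  by rewrite lerDl sqr_ge0.
by rewrite lerDr sqr_ge0.
Qed.

Lemma C_infty_rapid (f : 'rV[R]_n -> R[i]) : C_infty f -> rapid n (cRe f) /\ rapid n (cIm f).
Proof.
move=> [[cre cim] H]; have [B HB] := H (2 * n)%N.
have K y : ComplexField.Normc.normc (f y) <= `|B| * (1 + sqnorm y) ^- n.
  have := HB y; rewrite /enorm sqr_sqrtr ?sqnorm_ge0 //.
  have -> : (2 * n)%:R / 2 = n%:R :> R by rewrite natrM mulrC mulKf.
  rewrite powR_mulrn ?(ltW (one_sqnorm_gt0 _)) // => Hy.
  by rewrite ler_pdivlMr ?exprn_gt0 ?one_sqnorm_gt0 // mulrC (le_trans Hy) // ler_norm.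
split; split => //; exists `|B| => // y; apply: le_trans (K y).
  exact: (normc_ge_part (f y)).1.
exact: (normc_ge_part (f y)).2.
Qed.

End FunctionCase.

(** * Smooth functions *)

Section SmoothCalculus.
Context {R : realType} {E : normedModType R}.
Implicit Types f g : E -> R.

Lemma is_derive_line f x v (df : R) :
  is_derive x v f df <-> is_derive (0 : R) 1 (fun t : R => f (t *: v + x)) df.
Proof.
pose F (t : R) := f (t *: v + x).
have EQ : (fun h : R => h^-1 *: ((F \o shift (0 : R)) (h *: (1 : R)) - F 0)) =
    (fun h => h^-1 *: ((f \o shift x) (h *: v) - f x)).
  by apply/funext => h; rewrite /F /= scale0r addr0 add0r -[h *: 1]/(h * 1) mulr1.
have PE : derivable F 0 1 = derivable f x v := congr1 (fun q => cvg (q @ 0^')) EQ.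
have DE : 'D_1 F 0 = 'D_v f x := congr1 (fun q => lim (q @ 0^')) EQ.
split=> -[d e].
  have d' : derivable F 0 1 by rewrite PE.
  by apply: (DeriveDef d'); rewrite DE.
have d' : derivable f x v by rewrite -PE.
by apply: (DeriveDef d'); rewrite -DE.
Qed.

Lemma is_derive_chain (h : R -> R) f x v (dh df : R) :
  is_derive (f x) 1 h dh -> is_derive x v f df -> is_derive x v (fun y => h (f y)) (dh * df).
Proof.
move=> dhx /is_derive_line dfx; apply/is_derive_line.
have dh0 : is_derive ((fun t : R => f (t *: v + x)) 0) 1 h dh by rewrite scale0r add0r.
exact: (is_derive1_comp (f := h) (g := fun t : R => f (t *: v + x))).
Qed.

Variable O : set E.
Hypothesis hO : open O.

(** Derivatives in all directions up to order k. The induction on k makes products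
    and composites tractable, which direct work with iterated derivatives does
    not. *)
Fixpoint Ck k f : Prop :=
  (forall x, O x -> {for x, continuous f}) /\
  if k is k'.+1 then
    (forall x v, O x -> derivable f x v) /\ forall v, Ck k' ('D_v f)
  else True.

Lemma Ck_continuous k f : Ck k f -> forall x, O x -> {for x, continuous f}.
Proof. by case: k => [|k] []. Qed.

Lemma Ck_derivable k f : Ck k.+1 f -> forall x v, O x -> derivable f x v.
Proof. by case=> _ []. Qed.

Lemma Ck_derive k f v : Ck k.+1 f -> Ck k ('D_v f).
Proof. by move=> [_ [_ H]]; exact: H. Qed.

Lemma CkW k f : Ck k.+1 f -> Ck k f.
Proof.
elim: k f => [|k IH] f [cf [df Df]]; first by split.
by split => //; split => // v; exact: IH.
Qed.

Lemma smooth_Ck f : smooth_on O f <-> forall k, Ck k f.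
Proof.
split=> [sf k|Cf].
  suff H vs : Ck k (iter_derive vs f) by exact: (H [::]).
  elim: k vs => [|k IH] vs; first by split => // x /(sf vs)[].
  split; first by move=> x /(sf vs)[].
  by split=> [x v /(sf vs)[_]|v]; [exact|exact: (IH (v :: vs))].
have H vs : forall k, Ck k (iter_derive vs f).
  by elim: vs => [//|v vs IH] k; exact: Ck_derive (IH k.+1).
by move=> vs x Ox; split=> [|v]; [exact: Ck_continuous (H vs 0%N) x Ox|exact: Ck_derivable (H vs 1%N) x v Ox].
Qed.

Lemma near_open x : O x -> \near x, O x.
Proof. by move=> Ox; exact: open_nbhs_nbhs. Qed.

Lemma is_derive_eq_on f g x v (df : R) : (forall x, O x -> f x = g x) -> O x ->
  is_derive x v f df -> is_derive x v g df.
Proof.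
move=> fg Ox; apply: near_eq_is_derive.
by apply: filterS (near_open Ox) => y /fg.
Qed.

Lemma Ck_eq k f g : (forall x, O x -> f x = g x) -> Ck k f -> Ck k g.
Proof.
have contE f' g' : (forall x, O x -> f' x = g' x) ->
    (forall x, O x -> {for x, continuous f'}) -> forall x, O x -> {for x, continuous g'}.
  move=> fg cf x Ox; have := cf x Ox; rewrite /prop_for /continuous_at (fg x Ox).
  apply: cvg_trans; apply: near_eq_cvg.
  by apply: filterS (near_open Ox) => y /fg.
elim: k f g => [|k IH] f g fg [cf H]; first by split => //; exact: contE cf.
have der x v : O x -> is_derive x v g ('D_v f x).
  by move=> Ox; apply: (is_derive_eq_on fg Ox); exact/derivableP/(H.1 x v Ox).
split; first exact: contE cf.
split=> [x v Ox|v]; first by have [] := der x v Ox.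
apply: IH (H.2 v) => x Ox.
by have D := der x v Ox; rewrite [RHS]derive_val.
Qed.

Lemma Ck_cst k (c : R) : Ck k (fun _ => c).
Proof.
elim: k c => [|k IH] c; first by split => // x _; exact: cvg_cst.
split; first by move=> x _; exact: cvg_cst.
split=> [x v _|v]; first exact: derivable_cst.
by apply: Ck_eq (IH 0) => x _; rewrite derive_cst.
Qed.

Lemma Ck_linear k f : continuous f -> (forall (h : R) v x, f (h *: v + x) = h * f v + f x) -> Ck k f.
Proof.
move=> cf lf; case: k => [|k]; first by split => // x _; exact: cf.
have D x v : is_derive x v f (f v).
  apply/is_derive_line.
  have -> : (fun t : R => f (t *: v + x)) = (fun t => f v * t + f x).
    by apply/funext => t; rewrite lf mulrC.
  have D1 : is_derive (0 : R) 1 (fun t : R => f v * t) (f v * 1) by exact: is_deriveZ.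
  have D2 := is_deriveD D1 (is_derive_cst (f x) (0 : R) 1).
  by move: D2; rewrite addr0 mulr1.
split; first by move=> x _; exact: cf.
split=> [x v _|v]; first by have [] := D x v.
by apply: Ck_eq (Ck_cst k (f v)) => x _; have Dx := D x v; rewrite derive_val.
Qed.

Lemma Ck_add k f g : Ck k f -> Ck k g -> Ck k (fun x => f x + g x).
Proof.
elim: k f g => [|k IH] f g Cf Cg.
  by split => // x Ox; apply: cvgD; [exact: Ck_continuous Cf x Ox|exact: Ck_continuous Cg x Ox].
have D x v : O x -> is_derive x v (fun x => f x + g x) ('D_v f x + 'D_v g x).
  move=> Ox; apply: is_deriveD; apply/derivableP.
    exact: Ck_derivable Cf x v Ox.
  exact: Ck_derivable Cg x v Ox.
split.
  by move=> x Ox; apply: cvgD; [exact: Ck_continuous Cf x Ox|exact: Ck_continuous Cg x Ox].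
split=> [x v Ox|v]; first by have [] := D x v Ox.
apply: Ck_eq (IH _ _ (Ck_derive v Cf) (Ck_derive v Cg)) => x Ox.
by have Dx := D x v Ox; rewrite [RHS]derive_val.
Qed.

Lemma Ck_mul k f g : Ck k f -> Ck k g -> Ck k (fun x => f x * g x).
Proof.
elim: k f g => [|k IH] f g Cf Cg.
  by split => // x Ox; apply: cvgM; [exact: Ck_continuous Cf x Ox|exact: Ck_continuous Cg x Ox].
have D x v : O x -> is_derive x v (fun x => f x * g x) (f x * 'D_v g x + g x * 'D_v f x).
  move=> Ox; have df : is_derive x v f ('D_v f x) by exact/derivableP/(Ck_derivable Cf).
  have dg : is_derive x v g ('D_v g x) by exact/derivableP/(Ck_derivable Cg).
  exact: is_deriveM df dg.
split.
  by move=> x Ox; apply: cvgM; [exact: Ck_continuous Cf x Ox|exact: Ck_continuous Cg x Ox].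
split=> [x v Ox|v]; first by have [] := D x v Ox.
apply: Ck_eq (Ck_add (IH _ _ (CkW Cf) (Ck_derive v Cg)) (IH _ _ (CkW Cg) (Ck_derive v Cf))) => x Ox.
by have Dx := D x v Ox; rewrite [RHS]derive_val.
Qed.

(** The predicate P is a class of functions closed under differentiation. *)
Lemma Ck_comp (P : (R -> R) -> Prop) (U : set R) k f h :
  (forall h, P h -> exists2 h', P h' & forall t, U t -> is_derive t 1 h (h' t)) ->
  (forall x, O x -> U (f x)) -> Ck k f -> P h -> Ck k (fun x => h (f x)).
Proof.
move=> HP fU.
have hc h' x : P h' -> O x -> {for x, continuous f} -> {for x, continuous (fun x => h' (f x))}.
  move=> Ph Ox cf; apply: continuous_comp cf _.
  have [h'' _ Dh] := HP _ Ph; have [dh _] := Dh _ (fU x Ox).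
  by apply: differentiable_continuous; exact/derivable1_diffP.
elim: k f h fU hc => [|k IH] f h fU hc Cf Ph.
  by split => // x Ox; apply: hc => //; exact: Ck_continuous Cf x Ox.
have [h' Ph' Dh] := HP _ Ph.
have D x v : O x -> is_derive x v (fun x => h (f x)) (h' (f x) * 'D_v f x).
  move=> Ox; apply: is_derive_chain; first exact: Dh (fU x Ox).
  exact/derivableP/(Ck_derivable Cf).
split; first by move=> x Ox; apply: hc => //; exact: Ck_continuous Cf x Ox.
split=> [x v Ox|v]; first by have [] := D x v Ox.
apply: Ck_eq (Ck_mul (IH f h' fU hc (CkW Cf) Ph') (Ck_derive v Cf)) => x Ox.
by have Dx := D x v Ox; rewrite [RHS]derive_val.
Qed.

Lemma Ck_sum k I (r : seq I) (f : I -> E -> R) :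
  (forall i, Ck k (f i)) -> Ck k (fun x => \sum_(i <- r) f i x).
Proof.
move=> Cf; elim: r => [|i r IH].
  by apply: Ck_eq (Ck_cst k 0) => x _; rewrite big_nil.
by apply: Ck_eq (Ck_add (Cf i) IH) => x _; rewrite big_cons.
Qed.

Lemma Ck_prod k I (r : seq I) (f : I -> E -> R) :
  (forall i, Ck k (f i)) -> Ck k (fun x => \prod_(i <- r) f i x).
Proof.
move=> Cf; elim: r => [|i r IH].
  by apply: Ck_eq (Ck_cst k 1) => x _; rewrite big_nil.
by apply: Ck_eq (Ck_mul (Cf i) IH) => x _; rewrite big_cons.
Qed.

End SmoothCalculus.

Section SmoothFunctions.
Context {R : realType} {E : normedModType R}.
Implicit Types f g : E -> R.

Definition smooth f := smooth_on setT f.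

Lemma smoothP f : smooth f <-> forall k, Ck setT k f.
Proof. exact: (@smooth_Ck R E setT f). Qed.

Lemma smooth_continuous f : smooth f -> continuous f.
Proof. by move=> sf x; have [] := sf [::] x I. Qed.

Lemma smooth_cst (c : R) : smooth (fun _ => c).
Proof. by apply/smoothP => k; apply: Ck_cst; exact: openT. Qed.

Lemma smooth_add f g : smooth f -> smooth g -> smooth (fun x => f x + g x).
Proof. by move=> /smoothP sf /smoothP sg; apply/smoothP => k; apply: Ck_add; [exact: openT| |]. Qed.

Lemma smooth_mul f g : smooth f -> smooth g -> smooth (fun x => f x * g x).
Proof. by move=> /smoothP sf /smoothP sg; apply/smoothP => k; apply: Ck_mul; [exact: openT| |]. Qed.

Lemma smooth_scale (c : R) f : smooth f -> smooth (fun x => c * f x).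
Proof. by move=> sf; exact: (smooth_mul (smooth_cst c) sf). Qed.

Lemma smooth_sub f g : smooth f -> smooth g -> smooth (fun x => f x - g x).
Proof.
move=> sf sg; rewrite (_ : (fun x => _) = fun x => f x + -1 * g x).
  exact: (smooth_add sf (smooth_scale (-1) sg)).
by apply/funext => x; rewrite mulN1r.
Qed.

Lemma smooth_derive f v : smooth f -> smooth ('D_v f).
Proof. by move=> /smoothP sf; apply/smoothP => k; exact: Ck_derive (sf k.+1). Qed.

Lemma smooth_is_derive f x v : smooth f -> is_derive x v f ('D_v f x).
Proof. by move=> sf; apply/derivableP; have [_ ] := sf [::] x I. Qed.

Lemma derive_add f g x v : smooth f -> smooth g ->
  'D_v (fun x => f x + g x) x = 'D_v f x + 'D_v g x.
Proof.
move=> sf sg; have D := is_deriveD (smooth_is_derive x v sf) (smooth_is_derive x v sg).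
by have := @derive_val _ _ _ _ _ _ _ D.
Qed.

Lemma derive_scale (c : R) f x v : smooth f -> 'D_v (fun x => c * f x) x = c * 'D_v f x.
Proof.
move=> sf; have D := is_deriveZ c (smooth_is_derive x v sf).
by have := @derive_val _ _ _ _ _ _ _ D.
Qed.

Lemma iter_derive_lin (c : R) f g vs : smooth f -> smooth g ->
  iter_derive vs (fun x => c * f x + g x) = fun x => c * iter_derive vs f x + iter_derive vs g x.
Proof.
move=> sf sg; elim: vs => [//|v vs IH] /=; rewrite IH; apply/funext => x.
have si h : smooth h -> smooth (iter_derive vs h).
  by move=> sh; elim: (vs) => [//|w ws IHw] /=; exact: smooth_derive.
have s1 := si f sf; have s2 := si g sg.
by rewrite (derive_add x v (smooth_scale c s1) s2) (derive_scale c x v s1).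
Qed.

Definition shiftf (v : E) f := fun w => f (w + v).

Lemma derive_shiftf v e f : 'D_e (shiftf v f) = shiftf v ('D_e f).
Proof.
apply/funext => w.
have EQ : (fun h : R => h^-1 *: ((shiftf v f \o shift w) (h *: e) - shiftf v f w)) =
    (fun h => h^-1 *: ((f \o shift (w + v)) (h *: e) - f (w + v))).
  by apply/funext => h; rewrite /shiftf /= addrA.
exact: (congr1 (fun q => lim (q @ (0 : R)^')) EQ).
Qed.

Lemma iter_derive_shiftf v vs f : iter_derive vs (shiftf v f) = shiftf v (iter_derive vs f).
Proof. by elim: vs => [//|e vs IH] /=; rewrite IH derive_shiftf. Qed.

Lemma smooth_shiftf v f : smooth f -> smooth (shiftf v f).
Proof.
move=> sf vs x _; rewrite iter_derive_shiftf; have [c d] := sf vs (x + v) I; split.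
  by apply: continuous_comp; [apply: cvgD; [exact: cvg_id|exact: cvg_cst]|exact: c].
move=> e; have EQ : (fun h : R => h^-1 *: ((shiftf v (iter_derive vs f) \o shift x) (h *: e) - shiftf v (iter_derive vs f) x)) =
    (fun h => h^-1 *: ((iter_derive vs f \o shift (x + v)) (h *: e) - iter_derive vs f (x + v))).
  by apply/funext => h; rewrite /shiftf /= addrA.
have PE : derivable (shiftf v (iter_derive vs f)) x e = derivable (iter_derive vs f) (x + v) e :=
  congr1 (fun q => cvg (q @ (0 : R)^')) EQ.
by rewrite PE.
Qed.

Lemma cont_addl (w : E) : continuous (fun v : E => w + v).
Proof. by move=> v; apply: cvgD; [exact: cvg_cst|exact: cvg_id]. Qed.

End SmoothFunctions.

Lemma mean_value_bound (R : realType) (F F' : R -> R) (h c e : R) :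
  (forall t : R, is_derive t 1 F (F' t)) -> (forall t : R, `|t| <= `|h| -> `|F' t - c| <= e) ->
  `|F h - F 0 - h * c| <= e * `|h|.
Proof.
move=> dF He; have [h0|h0] := leP 0 h.
  have [t /andP[t0 th] E] := MVT_le h0 (fun t _ => dF t).
  rewrite E subr0 mulrC -mulrBr normrM mulrC ler_wpM2r // He //.
  by rewrite !ger0_norm // (le_trans t0).
have [t /andP[t0 th] E] := MVT_le (ltW h0) (fun t _ => dF t).
have -> : F h - F 0 = h * F' t.
  by rewrite -opprB E sub0r mulrN opprK mulrC.
rewrite -mulrBr normrM mulrC ler_wpM2r // He //.
by rewrite !ler0_norm ?lerN2 // ltW.
Qed.

Lemma finite_delta (R : realType) (T : finType) (P : T -> R -> Prop) :
  (forall i, exists2 d : R, 0 < d & P i d) ->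
  (forall i (d d' : R), d' <= d -> P i d -> P i d') -> exists2 d : R, 0 < d & forall i, P i d.
Proof.
move=> HP mono; suff [d d0 Hd] : exists2 d : R, 0 < d & forall i, i \in enum T -> P i d.
  by exists d => // i; apply: Hd; rewrite mem_enum.
elim: (enum T) => [|i s [d d0 Hd]]; first by exists 1.
have [d' d'0 Hd'] := HP i; exists (Num.min d d'); first by rewrite lt_min d0.
move=> j; rewrite inE => /orP[/eqP ->|js].
  by apply: mono Hd'; rewrite ge_min lexx orbT.
by apply: mono (Hd j js); rewrite ge_min lexx.
Qed.

Section Convolution.
Context {R : realType} {n : nat}.
Notation E := 'rV[R]_n.+1.
Implicit Types phi : E -> R.

Lemma compact_cube (r : R) : compact (cube n.+1 r).
Proof.
apply: bounded_closed_compact.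
  by exists r; split => [|M rM x xr]; [exact: num_real|exact: le_trans xr (ltW rM)].
rewrite (_ : cube n.+1 r = (fun x : E => `|x|) @^-1` [set y | y <= r]) //.
by apply: closed_comp; [move=> x _; exact: norm_continuous|exact: closed_le].
Qed.

Lemma partial_uniform N phi (rho e : R) : smooth phi -> 0 < e ->
  exists2 d : R, 0 < d & forall (alpha : seq 'I_n.+1) (x y : E), (size alpha <= N)%N ->
    `|x| <= rho -> `|y| <= rho -> `|x - y| < d -> `|partial alpha phi x - partial alpha phi y| <= e.
Proof.
move=> + e0; elim: N phi => [|N IH] phi sp;
  have [d d0 Hd] := compact_unif_continuous (@compact_cube rho) (smooth_continuous sp) e0.
  exists d => // alpha x y; case: alpha => // _ xr _ xy.
  exact: ltW (Hd x y xr xy).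
have [d' d'0 Hd'] := finite_delta (P := fun i (d : R) => forall (alpha : seq 'I_n.+1) (x y : E), (size alpha <= N)%N ->
    `|x| <= rho -> `|y| <= rho -> `|x - y| < d ->
    `|partial alpha ('D_('e_i) phi) x - partial alpha ('D_('e_i) phi) y| <= e)
  (fun i => IH _ (smooth_derive 'e_i sp))
  (fun i d d' dd H alpha x y sa xr yr xy => H alpha x y sa xr yr (lt_le_trans xy dd)).
exists (Num.min d d'); first by rewrite lt_min d0.
move=> alpha x y + xr yr; rewrite lt_min; case/lastP: alpha => [|alpha i] sa /andP[xd xd'].
  exact: ltW (Hd x y xr xd).
rewrite size_rcons ltnS in sa.
by have := Hd' i alpha x y sa xr yr xd'; rewrite /partial map_rcons /iter_derive foldr_rcons.
Qed.

Variables (a : E -> R) (A rho : R).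
Hypotheses (ma : measurable_fun setT (a : borel_rV n.+1 -> R))
  (aA : forall v, `|a v| <= A) (a0 : forall v, rho < `|v| -> a v = 0).

Lemma litg_window (g : E -> R) : continuous g -> litg (fun v => a v * g v).
Proof.
move=> cg; have [B B0 HB] : exists2 B : R, 0 <= B & forall v, `|v| <= rho -> `|g v| <= B.
  have := @continuous_compact _ _ g _ (continuous_subspaceT cg) (@compact_cube rho).
  move=> /compact_bounded[M [Mr MP]]; exists (`|M| + 1); first by rewrite addr_ge0.
  move=> x xr; apply: MP => /=; first by rewrite ltr_pwDr // ler_norm.
  by exists x.
have mc : measurable (cube n.+1 rho : set (borel_rV n.+1)) by exact: measurable_norm_le.
have Ic : litg (fun v : E => A * B * \1_(cube n.+1 rho) v).
  apply: litgZ; apply/integrableP; split; first by apply/measurable_EFinP; exact: measurable_indic.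
  under eq_integral do rewrite /= ger0_norm //.
  rewrite integral_indic // setIT.
  have [r0|r0] := leP 0 rho.
    exact: (eq_ind_r (fun z => (z < +oo)%E) (ltry _) (lebesgue_cube n.+1 r0)).
  rewrite (_ : cube n.+1 rho = set0) ?measure0 ?ltry //.
  by apply/seteqP; split => x //=; rewrite /cube /= => xr; have := le_lt_trans xr r0; rewrite ltNge normr_ge0.
have A0 : 0 <= A by apply: le_trans (aA 0).
apply: le_integrable Ic => //.
  apply/measurable_EFinP; apply: measurable_funM => //.
  exact: continuous_measurable_rV.
move=> v _; rewrite /= lee_fin normrM indicE.
have [vr|vr] := leP `|v| rho.
  rewrite mem_set // mulr1 [leRHS]ger0_norm ?mulr_ge0 //.
  by rewrite ler_pM // ?aA // HB.
by rewrite a0 // normr0 mul0r.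
Qed.

Lemma litg_norm_window : litg (fun v => `|a v|).
Proof.
apply: litg_norm; rewrite (_ : a = fun v => a v * 1); first exact: litg_window (@cont_cst _ _ 1).
by apply/funext => v; rewrite mulr1.
Qed.

Definition mass := lint (fun v => `|a v|).

Lemma mass_ge0 : 0 <= mass.
Proof. exact: lint_ge0. Qed.

Lemma lint_window_le (g : E -> R) (e : R) : continuous g ->
  (forall v, a v != 0 -> `|g v| <= e) -> `|lint (fun v => a v * g v)| <= e * mass.
Proof.
move=> cg ge; apply: le_trans (norm_lint (litg_window cg)) _.
rewrite -lintZ; last exact: litg_norm_window.
apply: le_lint.
- exact/litg_norm/litg_window.
- exact/litgZ/litg_norm_window.
move=> v; rewrite normrM mulrC; have [->|av] := eqVneq (a v) 0.
  by rewrite normr0 !mulr0.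
by rewrite ler_wpM2r // ge.
Qed.

Definition convol phi (w : E) : R := lint (fun v => a v * phi (w + v)).

Lemma cont_shift phi (w : E) : continuous phi -> continuous (fun v => phi (w + v)).
Proof.
move=> cp v; apply: (@continuous_comp _ _ _ (fun v => w + v) phi); last exact: cp.
exact: cont_addl.
Qed.

Lemma window_le v : a v != 0 -> `|v| <= rho.
Proof. by apply: contraNT; rewrite -ltNge => /a0 ->. Qed.

Lemma continuous_convol phi : smooth phi -> continuous (convol phi).
Proof.
move=> sp w; have cp := smooth_continuous sp.
suff H : convol phi x @[x --> w] --> convol phi w by exact: H.
apply: (proj2 (@cvgrPdist_le R R^o E (nbhs w) (nbhs_filter w) (convol phi) (convol phi w))) => e e0.
have m1 : 0 < mass + 1 by rewrite ltr_wpDl ?mass_ge0.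
have [d d0 Hd] := partial_uniform 0 (`|w| + 1 + rho) sp (divr_gt0 e0 m1).
have d1 : 0 < Num.min d 1 by rewrite lt_min d0 ltr01.
apply: filterS (nbhsx_ballx w _ d1) => x; rewrite -ball_normE /= lt_min => /andP[xd x1].
rewrite /convol -lintB; try exact/litg_window/cont_shift.
under [X in lint X]funext do rewrite -mulrBr.
apply: (@le_trans _ _ (e / (mass + 1) * mass)); last first.
  by rewrite -mulrA ler_piMr ?(ltW e0) // mulrC ler_pdivrMr // mul1r lerDl.
apply: lint_window_le; first by apply: cont_add; [|apply: cont_opp]; exact: cont_shift.
move=> v /window_le vr; apply: (Hd [::]) => //.
- by apply: le_trans (ler_normD _ _) _; rewrite lerD // lerDl.
- apply: le_trans (ler_normD _ _) _; rewrite lerD // -(subrK w x) addrC.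
  by apply: le_trans (ler_normD _ _) _; rewrite lerD2l distrC ltW.
- by rewrite opprD addrACA subrr addr0.
Qed.

Lemma is_derive_convol phi w e : smooth phi -> is_derive w e (convol phi) (convol ('D_e phi) w).
Proof.
move=> sp; have cp := smooth_continuous sp; have sD := smooth_derive e sp.
have cD := smooth_continuous sD.
have lineD (x : E) (t : R) : is_derive t 1 (fun t : R => phi (t *: e + x)) ('D_e phi (t *: e + x)).
  have /is_derive_line := smooth_is_derive (t *: e + x) e sp.
  move=> D; have D2 : is_derive (t - t) 1 (fun s : R => phi (s *: e + (t *: e + x))) ('D_e phi (t *: e + x)).
    by rewrite subrr.
  have D3 : is_derive t 1 (fun s : R => s - t) (1 - 0) by exact: is_deriveB.
  rewrite subr0 in D3.
  have := @is_derive1_comp _ (fun s : R => phi (s *: e + (t *: e + x))) (fun s : R => s - t) t _ _ D2 D3.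
  rewrite mulr1; congr is_derive; apply/funext => s /=.
  by rewrite addrA -scalerDl subrK.
apply/is_derive_line.
suff H : (fun h : R => h^-1 * (convol phi (h *: e + w) - convol phi w)) @ (0:R)^' --> convol ('D_e phi) w.
  have EQ : (fun h : R => h^-1 *: (((fun t : R => convol phi (t *: e + w)) \o shift (0 : R)) (h *: (1 : R)) -
      convol phi ((0 : R) *: e + w))) = (fun h : R => h^-1 * (convol phi (h *: e + w) - convol phi w)).
    by apply/funext => h /=; rewrite scale0r addr0 add0r -[h *: 1]/(h * 1) mulr1.
  have d : derivable (fun t : R => convol phi (t *: e + w)) 0 1.
    by rewrite /derivable; apply/cvg_ex; exists (convol ('D_e phi) w); move: H; rewrite -EQ.
  by apply: (DeriveDef d); rewrite /derive; apply: cvg_lim => //; move: H; rewrite -EQ.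
apply/cvgrPdist_le => eps eps0.
have m1 : 0 < mass + 1 by rewrite ltr_wpDl ?mass_ge0.
have [d d0 Hd] := partial_uniform 0 (`|e| + `|w| + rho) sD (divr_gt0 eps0 m1).
pose d' := Num.min 1 (d / (`|e| + 1)).
have e1 : 0 < `|e| + 1 by rewrite ltr_wpDl.
have d'0 : 0 < d' by rewrite lt_min ltr01 divr_gt0.
have N1 : \forall h \near (0 : R)^', `|h| < d' by exact: dnbhs0_lt.
have N2 : \forall h \near (0 : R)^', h != 0 by exact: nbhs_dnbhs_neq.
move: N1 N2; apply: filterS2 => h; rewrite lt_min => /andP[h1 hd] h0.
have -> : convol ('D_e phi) w - h^-1 * (convol phi (h *: e + w) - convol phi w) =
    - (h^-1 * lint (fun v => a v * (phi (h *: e + w + v) - phi (w + v) - h * 'D_e phi (w + v)))).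
  have I1 := litg_window (cont_shift (w := h *: e + w) cp).
  have I2 := litg_window (cont_shift (w := w) cp).
  have I3 := litg_window (cont_shift (w := w) cD).
  rewrite (_ : lint _ = convol phi (h *: e + w) - convol phi w - h * convol ('D_e phi) w).
    by field.
  rewrite /convol -lintB // -lintZ // -lintB //; try exact: litgB; try exact: litgZ.
  by congr lint; apply/funext => v; ring.
rewrite normrN normrM normfV ler_pdivrMl ?normr_gt0 //.
apply: (@le_trans _ _ ((eps / (mass + 1) * `|h|) * mass)); last first.
  rewrite mulrAC mulrC ler_wpM2l // -mulrA ler_piMr ?(ltW eps0) //.
  by rewrite mulrC ler_pdivrMr // mul1r lerDl.
apply: lint_window_le.
  apply: cont_add; last first.
    exact: (cont_opp (cont_mul (@cont_cst _ _ h) (cont_shift (w := w) cD))).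
  by apply: cont_add; [|apply: cont_opp]; exact: cont_shift.
move=> v /window_le vr.
have := @mean_value_bound R (fun t => phi (t *: e + (w + v))) (fun t => 'D_e phi (t *: e + (w + v)))
  h ('D_e phi (w + v)) (eps / (mass + 1)) (lineD _).
rewrite scale0r add0r addrA; apply => t th; apply: (Hd [::]) => //.
- apply: le_trans (ler_normD _ _) _; rewrite -addrA lerD //.
    rewrite normrZ ler_piMl // (le_trans th) // ltW //.
  by apply: le_trans (ler_normD _ _) _; rewrite lerD.
- by apply: le_trans (ler_normD _ _) _; rewrite lerD // lerDr.
rewrite addrK normrZ; apply: (@le_lt_trans _ _ (`|h| * (`|e| + 1))).
  by rewrite ler_pM // lerDl.
by rewrite -ltr_pdivlMr.
Qed.

Lemma iter_derive_convol vs phi : smooth phi ->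
  iter_derive vs (convol phi) = convol (iter_derive vs phi).
Proof.
move=> sp; elim: vs => [//|e vs IH] /=; rewrite IH; apply/funext => w.
have si : smooth (iter_derive vs phi) by elim: (vs) => [//|v ws IHw] /=; exact: smooth_derive.
by have D := is_derive_convol w e si; rewrite derive_val.
Qed.

Lemma smooth_convol phi : smooth phi -> smooth (convol phi).
Proof.
move=> sp vs x _; rewrite iter_derive_convol //.
have si : smooth (iter_derive vs phi) by elim: vs => [//|v ws IHw] /=; exact: smooth_derive.
split; first exact: continuous_convol.
by move=> v; have [] := is_derive_convol x v si.
Qed.

End Convolution.

Section SmoothRadial.
Context {R : realType}.

Lemma is_derive_radial_avg p q (h h' : R -> R) (rho : R) :
  (forall t : R, is_derive t 1 h (h' t)) -> continuous h' ->
  is_derive rho 1 (radial_avg p q h) (radial_avg p.+2 q h' rho).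
Proof.
move=> dh ch'; have ch : continuous h by exact: is_derive_continuous dh.
suff H : (fun u : R => u^-1 * (radial_avg p q h (u + rho) - radial_avg p q h rho)) @ (0 : R)^'
    --> radial_avg p.+2 q h' rho.
  have EQ : (fun u : R => u^-1 *: ((radial_avg p q h \o shift rho) (u *: (1 : R)) - radial_avg p q h rho)) =
      (fun u : R => u^-1 * (radial_avg p q h (u + rho) - radial_avg p q h rho)).
    by apply/funext => u /=; rewrite -[u *: 1]/(u * 1) mulr1.
  have d : derivable (radial_avg p q h) rho 1.
    by rewrite /derivable; apply/cvg_ex; exists (radial_avg p.+2 q h' rho); move: H; rewrite -EQ.
  by apply: (DeriveDef d); rewrite /derive; apply: cvg_lim => //; move: H; rewrite -EQ.
apply/cvgrPdist_le => e e0.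
have c0 : 0 < e / (pi / 2) by rewrite divr_gt0 // divr_gt0 // pi_gt0.
have [d d0 Hd] := compact_unif_continuous
  (@segment_compact R (- (`|rho| + 1)) (`|rho| + 1)) ch' c0.
have d1 : 0 < Num.min 1 d by rewrite lt_min ltr01.
have N1 : \forall u \near (0 : R)^', `|u| < Num.min 1 d by exact: dnbhs0_lt.
have N2 : \forall u \near (0 : R)^', u != 0 by exact: nbhs_dnbhs_neq.
move: N1 N2; apply: filterS2 => u; rewrite lt_min => /andP[u1 ud] u0.
have cf x := @continuous_radial_integrand R p q h x ch.
have cf' := @continuous_radial_integrand R p.+2 q h' rho ch'.
have cZ : continuous (fun t => u * (h' (rho * sin t ^+ 2) * sin t ^+ p.+2 * cos t ^+ q)).
  exact: (cont_mul (@cont_cst _ _ u) cf').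
have -> : radial_avg p.+2 q h' rho - u^-1 * (radial_avg p q h (u + rho) - radial_avg p q h rho) =
    - (u^-1 * (radial_avg p q h (u + rho) - radial_avg p q h rho - u * radial_avg p.+2 q h' rho)).
  by field.
rewrite normrN normrM normfV ler_pdivrMl ?normr_gt0 // {1 2 3}/radial_avg.
rewrite -segintZ // -segintB // -segintB //; last by apply: cont_add => //; exact: cont_opp.
have cT : continuous (fun t => h ((u + rho) * sin t ^+ 2) * sin t ^+ p * cos t ^+ q -
    h (rho * sin t ^+ 2) * sin t ^+ p * cos t ^+ q -
    u * (h' (rho * sin t ^+ 2) * sin t ^+ p.+2 * cos t ^+ q)).
  by apply: cont_add; [apply: cont_add => //|]; exact: cont_opp.
apply: le_trans (norm_segint _ _ cT) _.
have -> : `|u| * e = segint 0 (pi / 2) (fun=> e / (pi / 2) * `|u|).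
  by rewrite segint_cst ?pihalf_ge0 // subr0 mulrAC divfK ?gt_eqF ?divr_gt0 ?pi_gt0 // mulrC.
apply: le_segint; [by apply: cont_comp; [exact: norm_continuous|]|exact: cont_cst|].
move=> t t01; have /andP[sc0 sc1] := sin_pow_cos_pow_le1 p q t01.
have s1 := sqr_sin_le1 t; have s0 := sqr_ge0 (sin t).
set s := sin t in s0 s1 sc0 sc1 *.
have -> : h ((u + rho) * s ^+ 2) * s ^+ p * cos t ^+ q - h (rho * s ^+ 2) * s ^+ p * cos t ^+ q -
    u * (h' (rho * s ^+ 2) * s ^+ p.+2 * cos t ^+ q) =
    (h ((u + rho) * s ^+ 2) - h (rho * s ^+ 2) - u * (s ^+ 2 * h' (rho * s ^+ 2))) * (s ^+ p * cos t ^+ q).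
  by rewrite (exprD s 2 p : s ^+ p.+2 = _); ring.
rewrite normrM (ger0_norm sc0); apply: le_trans (ler_piMr (normr_ge0 _) sc1) _.
have dF (tau : R) : is_derive tau 1 (fun tau => h ((tau + rho) * s ^+ 2)) (s ^+ 2 * h' ((tau + rho) * s ^+ 2)).
  have D1 : is_derive tau 1 (fun tau : R => s ^+ 2 * (tau + rho)) (s ^+ 2 * 1).
    apply: is_deriveZ; have := is_deriveD (is_derive_id tau (1 : R)) (is_derive_cst rho tau 1).
    by rewrite addr0.
  have D2 : is_derive (s ^+ 2 * (tau + rho)) 1 h (h' (s ^+ 2 * (tau + rho))) by exact: dh.
  have := @is_derive1_comp _ h (fun tau : R => s ^+ 2 * (tau + rho)) tau _ _ D2 D1.
  rewrite mulr1 [s ^+ 2 * (tau + rho)]mulrC (mulrC (h' _)); congr is_derive.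
  by apply/funext => x /=; rewrite mulrC.
have := @mean_value_bound R _ _ u (s ^+ 2 * h' (rho * s ^+ 2)) (e / (pi / 2)) dF.
rewrite add0r; apply => tau tu.
rewrite -mulrBr normrM (ger0_norm s0); apply: le_trans (ler_piMl (normr_ge0 _) s1) _.
rewrite distrC; apply: ltW; apply: Hd.
  rewrite /= in_itv /= -ler_norml normrM (ger0_norm s0).
  by apply: le_trans (ler_piMr (normr_ge0 _) s1) _; rewrite lerDl.
rewrite -mulrBl normrM (ger0_norm s0); apply: le_lt_trans (ler_piMr (normr_ge0 _) s1) _.
by rewrite opprD addrCA subrr addr0 normrN (le_lt_trans tu).
Qed.

Definition flat1 (P : {poly R}) (t : R) := flat P (1 - t).

Lemma is_derive_flat1 P (t : R) : is_derive t 1 (flat1 P) (flat1 (- ('X^2 * (P - P^`()))) t).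
Proof.
have D1 : is_derive t 1 (fun t : R => 1 - t) (- 1).
  have := is_deriveB (is_derive_cst (1 : R) t 1) (is_derive_id t (1 : R)).
  by rewrite sub0r.
have D2 := is_derive_flat P (1 - t).
have := @is_derive1_comp _ (flat P) (fun t : R => 1 - t) t _ _ D2 D1.
congr is_derive; rewrite /flat1 /flat mulrN1; case: ifP => _; last by rewrite oppr0.
by rewrite hornerN mulNr.
Qed.

Lemma continuous_flat1 P : continuous (flat1 P).
Proof. exact: is_derive_continuous (is_derive_flat1 P). Qed.

Lemma scaled_derive (h : R -> R) (c l t dh : R) : is_derive (l * t) 1 h dh ->
  is_derive t 1 (fun t => c * h (l * t)) (c * l * dh).
Proof.
move=> D; have D1 : is_derive t 1 (fun t : R => l * t) (l * 1).
  exact: (is_deriveZ l (is_derive_id t (1 : R))).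
rewrite mulr1 in D1.
have D2 := @is_derive1_comp _ h (fun t : R => l * t) t _ _ D D1.
by have := is_deriveZ c D2; congr is_derive; rewrite -[_ *: _]/(_ * _); ring.
Qed.

Section Composition.
Context {E : normedModType R}.
Variable O : set E.
Hypothesis hO : open O.

Lemma Ck_flat1 k P (l : R) f : Ck O k f -> Ck O k (fun x => flat1 P (l * f x)).
Proof.
move=> Cf; apply: (@Ck_comp R E O hO (fun h => exists c P, h = fun t => c * flat1 P (l * t)) setT k f
  (fun t => flat1 P (l * t))) => //.
  move=> _ [c [Q ->]]; exists (fun t => c * l * flat1 (- ('X^2 * (Q - Q^`()))) (l * t)).
    by exists (c * l), (- ('X^2 * (Q - Q^`()))).
  by move=> t _; apply: scaled_derive; exact: is_derive_flat1.
by exists 1, P; apply/funext => t; rewrite mul1r.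
Qed.

Lemma Ck_radial k p q P (l : R) f : Ck O k f ->
  Ck O k (fun x => radial_avg p q (flat1 P) (l * f x)).
Proof.
move=> Cf; apply: (@Ck_comp R E O hO
  (fun h => exists c p P, h = fun t => c * radial_avg p q (flat1 P) (l * t)) setT k f
  (fun t => radial_avg p q (flat1 P) (l * t))) => //.
  move=> _ [c [p' [Q ->]]].
  exists (fun t => c * l * radial_avg p'.+2 q (flat1 (- ('X^2 * (Q - Q^`())))) (l * t)).
    by exists (c * l), p'.+2, (- ('X^2 * (Q - Q^`()))).
  move=> t _; apply: scaled_derive; apply: is_derive_radial_avg; first exact: is_derive_flat1.
  exact: continuous_flat1.
by exists 1, p, P; apply/funext => t; rewrite mul1r.
Qed.

End Composition.

Lemma Ck_sqnorm n k (O : set 'rV[R]_n) (x : 'rV[R]_n) : open O -> Ck O k (fun y : 'rV[R]_n => sqnorm (y - x)).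
Proof.
move=> hO; apply: Ck_sum => // i.
have Cc : Ck O k (fun y : 'rV[R]_n => y 0 i).
  by apply: Ck_linear => // [y|h v y]; [exact: coord_continuous|rewrite !mxE].
have Cd : Ck O k (fun y : 'rV[R]_n => (y - x) 0 i).
  apply: (Ck_eq hO _ (Ck_add hO Cc (Ck_cst hO k (- x 0 i)))) => y _.
  by rewrite !mxE.
by apply: (Ck_eq hO _ (Ck_mul hO Cd Cd)) => y _; rewrite expr2.
Qed.

Lemma smooth_bump n (l : R) (x : 'rV[R]_n) : smooth (fun y : 'rV[R]_n => bump (l * sqnorm (y - x))).
Proof. by apply/smoothP => k; apply: Ck_flat1; [exact: openT|apply: Ck_sqnorm; exact: openT]. Qed.

Lemma smooth_radial n p q (l : R) (x : 'rV[R]_n) :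
  smooth (fun y : 'rV[R]_n => radial_avg p q bump (l * sqnorm (y - x))).
Proof. by apply/smoothP => k; apply: Ck_radial; [exact: openT|apply: Ck_sqnorm; exact: openT]. Qed.

End SmoothRadial.

Section Functional.
Context {R : realType} {n : nat}.
Notation E := 'rV[R]_n.+1.
Variables (L : (E -> R) -> R) (r : R) (N : nat) (C : R).

(** The real linear forms of compact support and finite order. *)
Definition functional :=
  (forall (c : R) phi psi, smooth phi -> smooth psi ->
     L (fun x => c * phi x + psi x) = c * L phi + L psi) /\
  (forall phi (B : R), smooth phi -> 0 <= B ->
     (forall (alpha : seq 'I_n.+1) (x : E), (size alpha <= N)%N -> `|x| <= r ->
        `|partial alpha phi x| <= B) -> `|L phi| <= C * B).

Hypothesis hL : functional.

Lemma functional0 : L (fun=> 0) = 0.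
Proof.
have := hL.1 1 (fun=> 0) (fun=> 0) (smooth_cst 0) (smooth_cst 0).
rewrite (_ : (fun x => 1 * 0 + 0) = fun=> 0); last by apply/funext => x; rewrite mulr0 addr0.
by rewrite mul1r => /eqP; rewrite -subr_eq0 opprD addrA subrr sub0r oppr_eq0 => /eqP.
Qed.

Lemma functional_add phi psi : smooth phi -> smooth psi ->
  L (fun x => phi x + psi x) = L phi + L psi.
Proof.
move=> sp sq; have := hL.1 1 phi psi sp sq; rewrite mul1r => <-.
by congr L; apply/funext => x; rewrite mul1r.
Qed.

Lemma functional_sub c phi psi : smooth phi -> smooth psi ->
  L (fun x => psi x - c * phi x) = L psi - c * L phi.
Proof.
move=> sp sq; have := hL.1 (- c) phi psi sp sq; rewrite mulNr addrC => <-.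
by congr L; apply/funext => x; rewrite mulNr addrC.
Qed.

Lemma functional_const_ge0 : 0 <= C.
Proof.
have := hL.2 (fun=> 0) 1 (smooth_cst 0) ler01; rewrite mulr1 functional0 normr0; apply.
move=> alpha x _ _; have H vs : iter_derive vs (fun _ : E => 0 : R) = fun=> 0.
  by elim: vs => [//|v vs /= ->]; apply/funext => y; rewrite derive_cst.
by rewrite /partial H normr0.
Qed.

Lemma partial_smooth_lin c phi psi alpha (x : E) : smooth phi -> smooth psi ->
  partial alpha (fun x => psi x - c * phi x) x = partial alpha psi x - c * partial alpha phi x.
Proof.
move=> sp sq; rewrite /partial (_ : (fun x => _) = fun x => - c * phi x + psi x); last first.
  by apply/funext => y; rewrite mulNr addrC.
by rewrite iter_derive_lin // mulNr addrC.
Qed.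

Lemma iter_derive_eq_on (O : set E) vs phi psi : open O -> smooth phi -> smooth psi ->
  (forall x, O x -> phi x = psi x) -> forall x, O x -> iter_derive vs phi x = iter_derive vs psi x.
Proof.
move=> hO sp sq pq; elim: vs => [//|v vs IH] x Ox /=.
have si h : smooth h -> smooth (iter_derive vs h).
  by move=> sh; elim: (vs) => [//|w ws IHw] /=; exact: smooth_derive.
have D := is_derive_eq_on hO IH Ox (smooth_is_derive x v (si _ sp)).
by rewrite [RHS]derive_val.
Qed.

(** On the cube of radius r the partial derivatives of phi and psi agree, and L is
    bounded by them. *)
Lemma functional_local phi psi (r' : R) : r < r' -> smooth phi -> smooth psi ->
  (forall x, `|x| < r' -> phi x = psi x) -> L phi = L psi.
Proof.
move=> rr sp sq pq; apply/eqP; rewrite -subr_eq0 -(mul1r (L psi)) -functional_sub // -normr_eq0.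
rewrite eq_le normr_ge0 andbT -[leRHS](mulr0 C); apply: (hL.2 _ 0 _ (lexx 0)).
  exact: (smooth_sub sp (smooth_scale 1 sq)).
move=> alpha x _ xr; rewrite partial_smooth_lin // mul1r /partial.
rewrite (@iter_derive_eq_on [set x | `|x| < r'] _ phi psi) // ?subrr ?normr0 //.
  rewrite (_ : [set x : E | _] = (fun x : E => `|x|) @^-1` [set y | y < r']) //.
  by apply: open_comp; [move=> y _; exact: norm_continuous|exact: open_lt].
exact: le_lt_trans xr rr.
Qed.

Lemma continuous_functional_shift phi : smooth phi -> continuous (fun v => L (shiftf v phi)).
Proof.
move=> sp v.
suff H : L (shiftf u phi) @[u --> v] --> L (shiftf v phi) by exact: H.
apply: (proj2 (@cvgrPdist_le R R^o E (nbhs v) (nbhs_filter v) (fun u => L (shiftf u phi)) (L (shiftf v phi)))) => e e0.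
have C1 : 0 < C + 1 by rewrite ltr_wpDl ?functional_const_ge0.
have [d d0 Hd] := partial_uniform N (r + `|v| + 1) sp (divr_gt0 e0 C1).
have d1 : 0 < Num.min d 1 by rewrite lt_min d0 ltr01.
apply: filterS (nbhsx_ballx v _ d1) => u; rewrite -ball_normE /= lt_min => /andP[ud u1].
rewrite -[X in `|_ - X|]mul1r -functional_sub; try exact: smooth_shiftf.
apply: (@le_trans _ _ (C * (e / (C + 1)))); last first.
  by rewrite mulrCA ler_piMr ?(ltW e0) // ler_pdivrMr // mul1r lerDl.
apply: hL.2.
- by apply: smooth_sub; [|apply: smooth_scale]; exact: smooth_shiftf.
- by rewrite ltW // divr_gt0.
move=> alpha x sa xr; rewrite partial_smooth_lin; try exact: smooth_shiftf.
rewrite mul1r /partial !iter_derive_shiftf; apply: Hd => //.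
- apply: le_trans (ler_normD _ _) _; rewrite -addrA lerD // lerDl //.
- apply: le_trans (ler_normD _ _) _; rewrite -addrA lerD //.
  rewrite -{1}(subrK v u); apply: le_trans (ler_normD _ _) _.
  by rewrite [leLHS]addrC lerD2l distrC ltW.
- by rewrite opprD addrACA subrr add0r.
Qed.

End Functional.

(** * Linear forms of compact support *)

Section Commutation.
Context {R : realType} {n : nat}.
Notation E := 'rV[R]_n.+1.
Variables (L : (E -> R) -> R) (r : R) (N : nat) (C : R).
Hypothesis hL : functional L r N C.
Variables (A rho : R).

Definition window (a : E -> R) :=
  [/\ measurable_fun setT (a : borel_rV n.+1 -> R), forall v, `|a v| <= A &
      forall v : E, rho < `|v| -> a v = 0].

Variable phi : E -> R.
Hypothesis sp : smooth phi.
Notation F := (fun v => L (shiftf v phi)).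

Definition defect (a : E -> R) := L (convol a phi) - lint (fun v => a v * F v).

Lemma defect_small (a : E -> R) (v0 : E) (d e : R) : window a -> 0 <= e -> `|v0| <= rho ->
  (forall (alpha : seq 'I_n.+1) (x y : E), (size alpha <= N)%N ->
     `|x| <= r + rho -> `|y| <= r + rho -> `|x - y| < d ->
     `|partial alpha phi x - partial alpha phi y| <= e) ->
  (forall v, a v != 0 -> `|v - v0| < d) ->
  `|defect a| <= 2 * C * e * mass a.
Proof.
move=> [ma aA a0] e0 v0r He av.
have cp := smooth_continuous sp.
have C0 := functional_const_ge0 hL.
have cF : continuous F by exact: (continuous_functional_shift hL sp).
have wle := window_le a0.
have cc : continuous (fun _ : E => L (shiftf v0 phi)) by exact: cont_cst.
have HF v : a v != 0 -> `|F v - L (shiftf v0 phi)| <= C * e.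
  move=> avn; rewrite -[X in _ - X]mul1r -(functional_sub hL); try exact: smooth_shiftf.
  apply: hL.2 => //.
    by apply: smooth_sub; [|apply: smooth_scale]; exact: smooth_shiftf.
  move=> alpha x sa xr; rewrite partial_smooth_lin; try exact: smooth_shiftf.
  rewrite mul1r /partial !iter_derive_shiftf; apply: He => //.
  - by apply: le_trans (ler_normD _ _) _; rewrite lerD // wle.
  - by apply: le_trans (ler_normD _ _) _; rewrite lerD.
  - by rewrite opprD addrACA subrr add0r av.
pose m := lint a.
have Ia : litg a.
  have := litg_window ma aA a0 (@cont_cst _ _ 1).
  by rewrite (_ : (fun v => a v * 1) = a) //; apply/funext => v; rewrite mulr1.
have E1 : `|L (convol a phi) - m * L (shiftf v0 phi)| <= C * (e * mass a).
  rewrite -(functional_sub hL) //; [|exact: smooth_shiftf|exact: (smooth_convol ma aA a0)].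
  apply: hL.2.
  - apply: smooth_sub; first exact: (smooth_convol ma aA a0).
    by apply: smooth_scale; exact: smooth_shiftf.
  - by rewrite mulr_ge0 // mass_ge0.
  move=> alpha x sa xr; rewrite partial_smooth_lin; [|exact: smooth_shiftf|exact: (smooth_convol ma aA a0)].
  rewrite /partial iter_derive_shiftf (iter_derive_convol ma aA a0) // /convol /shiftf /m.
  have si vs : smooth (iter_derive vs phi).
    by elim: vs => [//|w ws IHw] /=; exact: smooth_derive.
  have ci vs := smooth_continuous (si vs).
  set D := iter_derive _ phi.
  have cD : continuous D by exact: ci.
  rewrite mulrC -lintZ // -lintB; last 2 first.
  - exact: (litg_window ma aA a0 (cont_shift cD)).
  - exact: litgZ.
  rewrite (_ : (fun v => _) = fun v => a v * (D (x + v) - D (x + v0))); last first.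
    by apply/funext => v; ring.
  apply: (lint_window_le ma aA a0).
    by apply: cont_add; [exact: cont_shift cD|exact: cont_cst].
  move=> v avn; apply: He => //.
  - by apply: le_trans (ler_normD _ _) _; rewrite lerD // wle.
  - by apply: le_trans (ler_normD _ _) _; rewrite lerD.
  - by rewrite opprD addrACA subrr add0r av.
have E2 : `|lint (fun v => a v * F v) - m * L (shiftf v0 phi)| <= C * e * mass a.
  rewrite mulrC -lintZ // -lintB; [|exact: (litg_window ma aA a0 cF)|exact: litgZ].
  rewrite (_ : (fun v => _) = fun v => a v * (F v - L (shiftf v0 phi))); last first.
    by apply/funext => v; ring.
  by apply: (lint_window_le ma aA a0) HF; apply: cont_add => //; exact: cont_cst.
rewrite /defect (_ : _ - _ = (L (convol a phi) - m * L (shiftf v0 phi)) -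
  (lint (fun v => a v * F v) - m * L (shiftf v0 phi))); last by ring.
by apply: le_trans (ler_normB _ _) _; move: E1 E2; set a1 := `|_|; set a2 := `|_|; lra.
Qed.

Lemma window_indic a S : window a -> measurable (S : set (borel_rV n.+1)) ->
  window (fun v => a v * \1_S v).
Proof.
move=> [ma aA a0] mS; split.
- by apply: measurable_funM => //; exact: measurable_indic.
- move=> v; rewrite indicE; case: (v \in S); rewrite ?mulr1 ?mulr0 ?normr0 //.
  exact: le_trans (normr_ge0 (a v)) (aA v).
- by move=> v /a0 ->; rewrite mul0r.
Qed.

Lemma defect_add a b : window a -> window b ->
  defect (fun v => a v + b v) = defect a + defect b.
Proof.
move=> [ma aA a0] [mb bA b0]; have cp := smooth_continuous sp.
have cF : continuous F by exact: (continuous_functional_shift hL sp).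
rewrite /defect (_ : convol (fun v => a v + b v) phi = fun w => convol a phi w + convol b phi w).
  rewrite (functional_add hL); [|exact: (smooth_convol ma aA a0)|exact: (smooth_convol mb bA b0)].
  rewrite (_ : (fun v => (a v + b v) * F v) = fun v => a v * F v + b v * F v); last first.
    by apply/funext => v; rewrite mulrDl.
  rewrite lintD; [|exact: (litg_window ma aA a0 cF)|exact: (litg_window mb bA b0 cF)].
  by ring.
apply/funext => w; rewrite /convol -lintD;
  [|exact: (litg_window ma aA a0 (cont_shift cp))|exact: (litg_window mb bA b0 (cont_shift cp))].
by congr lint; apply/funext => v; rewrite mulrDl.
Qed.

Lemma defect_cover (a : E -> R) (d e : R) : window a -> 0 <= e ->
  (forall (alpha : seq 'I_n.+1) (x y : E), (size alpha <= N)%N ->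
     `|x| <= r + rho -> `|y| <= r + rho -> `|x - y| < d ->
     `|partial alpha phi x - partial alpha phi y| <= e) ->
  forall s : seq E, (forall c, c \in s -> `|c| <= rho) ->
  forall S, measurable (S : set (borel_rV n.+1)) ->
  (forall v, S v -> `|v| <= rho -> exists2 c, c \in s & `|v - c| < d) ->
  `|defect (fun v => a v * \1_S v)| <= 2 * C * e * mass (fun v => a v * \1_S v).
Proof.
move=> wa e0 He; have C0 := functional_const_ge0 hL.
have [ma aA a0] := wa.
elim=> [|c s IH] sr S mS HS.
  rewrite (_ : (fun v => _) = fun=> 0); last first.
    apply/funext => v; rewrite indicE; case: (boolP (v \in S)) => vS; last by rewrite mulr0.
    rewrite mulr1; apply: a0; rewrite ltNge; apply/negP => vr.
    by have [] := HS v (set_mem vS) vr.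
  rewrite /defect (_ : convol _ phi = fun=> 0).
    rewrite (functional0 hL) (_ : (fun v => 0 * _) = fun=> 0); last by apply/funext => v; rewrite mul0r.
    rewrite lint0 subrr normr0 !mulr_ge0 //; exact: mass_ge0.
  apply/funext => w; rewrite /convol (_ : (fun v => _) = fun=> 0) ?lint0 //.
  by apply/funext => v; rewrite mul0r.
pose B : set E := [set v | `|v - c| < d].
have mB : measurable (B : set (borel_rV n.+1)).
  apply: open_borel_rV; rewrite (_ : B = (fun v : E => `|v - c|) @^-1` [set y | y < d]) //.
  apply: open_comp; last exact: open_lt.
  move=> v _; apply: (@continuous_comp _ _ _ (fun v : E => v - c) (fun v => `|v|)); last exact: norm_continuous.
  by rewrite (_ : (fun v : E => v - c) = fun v => - c + v); [exact: cont_addl|apply/funext => x; rewrite addrC].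
have mS1 : measurable (S `&` B : set (borel_rV n.+1)) by exact: measurableI.
have mS2 : measurable (S `\` B : set (borel_rV n.+1)) by exact: measurableD.
have w1 := window_indic wa mS1; have w2 := window_indic wa mS2.
have split_ v : \1_S v = \1_(S `&` B) v + \1_(S `\` B) v :> R.
  rewrite !indicE in_setI in_setD; case: (v \in S); case: (v \in B); rewrite ?addr0 ?add0r //.
rewrite (_ : (fun v => a v * \1_S v) = fun v => a v * \1_(S `&` B) v + a v * \1_(S `\` B) v); last first.
  by apply/funext => v; rewrite split_ mulrDr.
rewrite defect_add //; apply: le_trans (ler_normD _ _) _.
have mE : mass (fun v => a v * \1_(S `&` B) v + a v * \1_(S `\` B) v) =
    mass (fun v => a v * \1_(S `&` B) v) + mass (fun v => a v * \1_(S `\` B) v).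
  have [m1 A1 z1] := w1; have [m2 A2 z2] := w2.
  rewrite /mass -lintD; [|exact: (litg_norm_window m1 A1 z1)|exact: (litg_norm_window m2 A2 z2)].
  congr lint; apply/funext => v; rewrite !indicE in_setI in_setD.
  by case: (v \in S); case: (v \in B); rewrite /= ?mulr0 ?normr0 ?addr0 ?add0r ?normr0 ?addr0.
rewrite mE mulrDr; apply: lerD.
  apply: (defect_small (v0 := c) w1 e0 _ He); first by apply: sr; rewrite mem_head.
  move=> v; rewrite indicE in_setI mulf_eq0 negb_or => /andP[_].
  by case: (boolP (v \in B)) => vB; [move=> _; exact: (set_mem vB)|rewrite andbF eqxx].
apply: IH => // [c' cs|v [Sv nBv] vr]; first by apply: sr; rewrite inE cs orbT.
have [c' + vc'] := HS v Sv vr; rewrite inE => /orP[/eqP cE|cs]; last by exists c'.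
by case: nBv; rewrite /B /= -cE.
Qed.

(** Both sides are additive in the weight a, and agree up to an error relative to
    the mass of a when a lives on a small set. *)
Lemma functional_convol a : window a -> L (convol a phi) = lint (fun v => a v * F v).
Proof.
move=> wa; have C0 := functional_const_ge0 hL; have [ma aA a0] := wa.
apply/eqP; rewrite -subr_eq0 -normr_eq0 eq_le normr_ge0 andbT -/(defect a).
apply/ler_addgt0Pr => eps eps0; rewrite add0r.
have M0 : 0 < 2 * C * mass a + 1 by rewrite ltr_wpDl // !mulr_ge0 // mass_ge0.
have e0 : 0 < eps / (2 * C * mass a + 1) by rewrite divr_gt0.
have [d d0 Hd] := partial_uniform N (r + rho) sp e0.
have cK : cover_compact (cube n.+1 rho : set E) by rewrite -compact_cover; exact: compact_cube.
have [] := cK E (cube n.+1 rho) (fun c => ball c d).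
- by move=> c _; exact: ball_open.
- by move=> v vr; exists v => //; exact: ballxx.
move=> s ss cov.
have sr c : c \in finmap.enum_fset s -> `|c| <= rho by move=> cs; have := ss c cs; rewrite inE.
have mT := @measurableT _ (@borel_rV R n.+1).
have HT v : [set: E] v -> `|v| <= rho -> exists2 c, c \in finmap.enum_fset s & `|v - c| < d.
  move=> _ vr; have [c cs vc] := cov v vr; exists c => //.
  by move: vc; rewrite -ball_normE /= distrC.
have := defect_cover wa (ltW e0) Hd sr mT HT.
rewrite (_ : (fun v => a v * \1_setT v) = a); last by apply/funext => v; rewrite indicT mulr1.
move=> H; apply: le_trans H _; rewrite mulrAC mulrCA ler_piMr ?(ltW eps0) //.
by rewrite ler_pdivrMr // mul1r lerDl.
Qed.

End Commutation.

Section Mollification.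
Context {R : realType} {m : nat}.
Notation E := 'rV[R]_m.+2.

Lemma lint_isometry (x : E) (Q : 'M[R]_m.+2) (g : E -> R) : orthogonal_mx Q -> continuous g ->
  lint g = lint (fun y => g (x + y *m Q)).
Proof.
move=> hQ cg; rewrite /lint /Rintegral; congr fine.
have mg : measurable_fun setT (fun y : borel_rV m.+2 => (g y)%:E).
  by apply/measurable_EFinP; exact: continuous_measurable_rV.
rewrite integralE [RHS]integralE.
rewrite (ge0_integral_isometry x hQ (measurable_funepos mg) (funepos_ge0 _)).
rewrite (ge0_integral_isometry x hQ (measurable_funeneg mg) (funeneg_ge0 _)).
by congr (_ - _)%E; apply: eq_integral => y _; rewrite ?funeposE ?funenegE.
Qed.

Lemma orthogonal_opp1 k : orthogonal_mx (- 1%:M : 'M[R]_k).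
Proof. by rewrite /orthogonal_mx linearN /= trmx1 mulmxN mulNmx opprK mulmx1. Qed.

Lemma window_tame (A rho : R) (a : E -> R) : continuous a -> (forall v, `|a v| <= A) ->
  (forall v : E, rho < `|v| -> a v = 0) -> tame a.
Proof.
move=> ca aA a0; split => //; have A0 : 0 <= A by exact: le_trans (normr_ge0 _) (aA 0).
have K0 : 0 < 1 + rho ^+ 2 by rewrite ltr_pwDl // sqr_ge0.
exists (A * (1 + rho ^+ 2) ^+ m.+2); first by rewrite mulr_ge0 // exprn_ge0 // ltW.
move=> v; have [vr|vr] := leP `|v| rho; last first.
  rewrite a0 // normr0; apply: mulr_ge0; last exact/ltW/decay_gt0.
  by apply: mulr_ge0 => //; exact/exprn_ge0/ltW.
rewrite -mulrA; apply: le_trans (aA v) _; rewrite ler_peMr //.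
have D0 : 0 < \prod_i oneDsqr (v 0 i) by apply: prodr_gt0 => i _; exact: oneDsqr_gt0.
rewrite /decay prodfV ler_pdivlMr // mul1r.
have -> : (1 + rho ^+ 2) ^+ m.+2 = \prod_(i < m.+2) (1 + rho ^+ 2) by rewrite prodr_const card_ord.
apply: ler_prod => i _; rewrite (ltW (oneDsqr_gt0 _)) /= lerD2l -[v 0 i ^+ 2]real_normK ?num_real //.
have rho0 : 0 <= rho := le_trans (normr_ge0 v) vr.
by apply: lerXn2r; rewrite ?nnegrE //; exact: le_trans (coord_le_norm v i) vr.
Qed.

Lemma bounded_cube (rho : R) (g : E -> R) : continuous g ->
  exists2 B : R, 0 <= B & forall v, `|v| <= rho -> `|g v| <= B.
Proof.
move=> cg.
have := @continuous_compact _ _ g _ (continuous_subspaceT cg) (@compact_cube R m.+1 rho).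
move=> /compact_bounded[M [Mr MP]]; exists (`|M| + 1); first by rewrite addr_ge0.
move=> x xr; apply: MP => /=; first by rewrite ltr_pwDr // ler_norm.
by exists x.
Qed.

Section Eta.
Variable delta : R.
Hypothesis delta0 : 0 < delta.

Definition eta (w : E) : R := bump (delta^-1 * sqnorm w).

Lemma smooth_eta : smooth eta.
Proof.
have := smooth_bump delta^-1 (0 : E); congr smooth.
by apply/funext => w; rewrite subr0.
Qed.

Lemma eta_ge0 w : 0 <= eta w. Proof. exact: bump_ge0. Qed.

Lemma eta_opp w : eta (- w) = eta w. Proof. by rewrite /eta sqnormN. Qed.

Lemma eta_support w : eta w != 0 -> sqnorm w < delta.
Proof.
apply: contraNT; rewrite -leNgt => dw; rewrite /eta bump_eq0 //.
by rewrite ler_pdivlMl // mulr1.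
Qed.

Lemma eta_norm w : eta w != 0 -> `|w| <= Num.sqrt delta.
Proof.
move=> /eta_support wd; rewrite -ler_sqr ?nnegrE ?sqrtr_ge0 // sqr_sqrtr ?(ltW delta0) //.
exact: le_trans (norm_le_sqnorm _) (ltW wd).
Qed.

Lemma eta_bounded : exists2 B : R, 0 <= B & forall w, `|eta w| <= B.
Proof.
have [B B0 HB] := continuous_bounded_segment 0 1 (@continuous_bump R); exists B => // w.
have t0 : 0 <= delta^-1 * sqnorm w by rewrite mulr_ge0 ?invr_ge0 ?sqnorm_ge0 // ltW.
have [t1|/ltW t1] := leP (delta^-1 * sqnorm w) 1; first by apply: HB; rewrite t0.
by rewrite /eta bump_eq0 // normr0.
Qed.

Lemma continuous_eta : continuous eta. Proof. exact: smooth_continuous smooth_eta. Qed.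

Lemma measurable_eta : measurable_fun setT (eta : borel_rV m.+2 -> R).
Proof. exact: continuous_measurable_rV continuous_eta. Qed.

Lemma eta0 v : Num.sqrt delta < `|v| -> eta v = 0.
Proof. by move=> vd; apply: contraTeq vd => /eta_norm; rewrite leNgt. Qed.

Lemma mass_eta_gt0 : 0 < mass eta.
Proof.
have [B B0 HB] := eta_bounded.
have te : tame eta by exact: window_tame continuous_eta HB eta0.
rewrite lt_def mass_ge0 andbT; apply/negP => /eqP M0.
have : eta 0 = 0.
  apply: gaussian_orthogonal_eq0 => // c c0.
  have g1 (y : E) : `|expR (- c * sqnorm (y - 0))| <= 1 by rewrite ger0_norm ?expR_ge0 // gaussian_le1.
  have I1 := litg_tameM te (@continuous_gaussian R m.+2 c 0) g1.
  have I2 : litg (fun y => `|eta y|) by apply: litg_norm; exact: tame_integrable.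
  apply/eqP; rewrite eq_le; apply/andP; split; last first.
    by apply: lint_ge0 => y; rewrite mulr_ge0 ?eta_ge0 ?expR_ge0.
  rewrite -M0; apply: le_lint => // y; rewrite ger0_norm ?eta_ge0 // ler_piMr ?eta_ge0 //.
  exact: gaussian_le1.
by move=> /eqP; rewrite /eta sqnorm0 mulr0 gt_eqF // bump_gt0.
Qed.

End Eta.

Variables (L : (E -> R) -> R) (r : R) (N : nat) (C : R).
Hypothesis hL : functional L r N C.
Variables (p q : nat) (x0 : E) (r0 l0 : R).
Hypotheses (q_even : ~~ odd q) (r00 : 0 < r0) (l00 : 0 < l0).
Hypothesis H1 : forall phi, smooth phi -> (forall y, r0 <= sqnorm (y - x0) -> phi y = 0) -> L phi = 0.
Hypothesis H2 : forall (l : R) x, 0 < l -> l < l0 -> sqnorm (x - x0) < r0 ->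
  L (fun y => radial_avg p q bump (l^-1 * sqnorm (y - x))) = 0.

Section Fixed.
Variable delta : R.
Hypotheses (delta0 : 0 < delta) (delta1 : delta < r0 / 4).
Notation eta := (eta delta).
Let rho := r + 1 + Num.sqrt delta.
Let f v := L (shiftf v eta).

Lemma near_support (v w : E) : `|w| < r + 1 -> eta (w + v) != 0 -> `|v| <= rho.
Proof.
move=> wr /(eta_norm delta0) H; have -> : v = (w + v) - w by rewrite addrC addKr.
by apply: le_trans (ler_normB _ _) _; rewrite /rho addrC lerD // ltW.
Qed.

Lemma functional_window_eq0 v : rho < `|v| -> f v = 0.
Proof.
move=> vr; rewrite /f -(functional0 hL); apply: (functional_local hL (r' := r + 1)).
- by rewrite ltrDl.
- exact/smooth_shiftf/smooth_eta.
- exact: smooth_cst.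
move=> w wr; apply: contraTeq vr => /(near_support wr); rewrite leNgt //.
Qed.

(** The function f is tame, since it is continuous of bounded support. It vanishes
    near - x0 as L vanishes on the test functions near x0, and by the commutation
    of L with convolutions its integral against a radial average is an integral of
    values of L on translated radial averages. *)
Lemma mollified_eq0 v : f v = 0.
Proof.
have se := smooth_eta delta.
have cf : continuous f by exact: (continuous_functional_shift hL se).
have [B B0 HB] := bounded_cube rho cf.
have tf : tame f.
  apply: (@window_tame B rho) => // [w|w]; last exact: functional_window_eq0.
  have [wr|wr] := leP `|w| rho; first exact: HB.
  by rewrite functional_window_eq0 // normr0.
have r4 : 0 < r0 / 4 by rewrite divr_gt0.
apply: (@radial_orthogonal_eq0 R m.+2 bump p q (@continuous_bump R) (@bump_eq0 R) (@bump_gt0 R) q_even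
   f (- x0) (r0 / 4) l0 tf r4 l00).
  move=> y; rewrite opprK => yx; apply: H1; first exact: smooth_shiftf.
  move=> z zx; apply: contraTeq zx => /(eta_support delta0) zy; rewrite -ltNge.
  have -> : z - x0 = (z + y) + (- (y + x0)) by rewrite opprD addrA addrK.
  by apply: le_lt_trans (sqnormD_le _ _) _; rewrite sqnormN; move: zy yx delta1; lra.
move=> l x' lp ll; rewrite opprK => xx.
pose rad (v : E) := radial_avg p q bump (l^-1 * sqnorm (v - x')).
have crad : continuous rad by exact: smooth_continuous (smooth_radial p q l^-1 x').
have [Bb Bb0 HBb] := continuous_bounded_segment 0 1 (@continuous_bump R).
have rad_le u : `|rad u| <= Bb * (pi / 2).
  apply: le_radial_avg; first exact: continuous_bump.
    by rewrite mulr_ge0 ?invr_ge0 ?sqnorm_ge0 // ltW.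
  move=> t /andP[t0 _]; have [t1|/ltW t1] := leP t 1; first by apply: HBb; rewrite t0.
  by rewrite bump_eq0 // normr0.
have mc : measurable (cube m.+2 rho : set (borel_rV m.+2)) by exact: measurable_norm_le.
pose a (v : E) := rad v * \1_(cube m.+2 rho) v.
have wa : window (Bb * (pi / 2)) rho a.
  split.
  - apply: measurable_funM; last exact: measurable_indic.
    exact: continuous_measurable_rV.
  - move=> u; rewrite /a indicE; case: (u \in _); rewrite ?mulr1 ?mulr0 ?normr0 //.
    exact: le_trans (normr_ge0 _) (rad_le 0).
  - move=> u ur; rewrite /a indicE memNset ?mulr0 // => uc.
    by have := lt_le_trans ur uc; rewrite ltxx.
rewrite (_ : (fun y => _) = fun y => a y * L (shiftf y eta)); last first.
  apply/funext => y; rewrite /a indicE -/(f y) mulrC.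
  have [yr|yr] := leP `|y| rho; first by rewrite mem_set // mulr1.
  by rewrite functional_window_eq0 // !mulr0.
rewrite -(functional_convol hL se wa).
have [Be Be0 HBe] := eta_bounded delta0.
have we : window Be (Num.sqrt delta) eta.
  by split; [exact: measurable_eta|exact: HBe|exact: eta0].
pose x := - x'.
pose Psi (w : E) := radial_avg p q bump (l^-1 * sqnorm (w - x)).
have sPsi : smooth Psi by exact: smooth_radial.
have [ma aA a0] := wa; have [me eA e0] := we.
have -> : L (convol a eta) = L (convol eta Psi).
  apply: (functional_local hL (r' := r + 1)); first by rewrite ltrDl.
  - exact: (smooth_convol ma aA a0).
  - exact: (smooth_convol me eA e0).
  move=> w wr; rewrite /convol (_ : (fun v => a v * _) = fun v => rad v * eta (w + v)); last first.
    apply/funext => u; rewrite /a indicE.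
    have [->|/(near_support wr) ur] := eqVneq (eta (w + u)) 0; first by rewrite !mulr0.
    by rewrite mem_set // mulr1.
  have ce : continuous (fun v : E => eta (w + v)) by exact: (cont_shift (@continuous_eta delta)).
  rewrite (lint_isometry (- w) (orthogonal_opp1 m.+2) (cont_mul crad ce)).
  congr lint; apply/funext => t; rewrite mulmxN mulmx1 addrA subrr add0r eta_opp mulrC.
  have tE : sqnorm (- w - t - x') = sqnorm (w + t - x).
    by rewrite -sqnormN /x !opprD !opprK.
  exact: (congr1 (fun s => eta t * radial_avg p q bump (l^-1 * s)) tE).
rewrite (functional_convol hL sPsi we) -[RHS](@lint0 R m.+2); congr lint; apply/funext => t.
have [->|/(eta_support delta0) td] := eqVneq (eta t) 0; first by rewrite mul0r.
rewrite (_ : shiftf t Psi = fun y => radial_avg p q bump (l^-1 * sqnorm (y - (x - t)))); last first.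
  by apply/funext => y; rewrite /shiftf /Psi opprB addrA.
rewrite H2 ?mulr0 //.
have -> : x - t - x0 = - (x' + x0) + - t by rewrite /x opprD addrAC.
by apply: le_lt_trans (sqnormD_le _ _) _; rewrite !sqnormN; move: td xx delta1; lra.
Qed.

(** The two ways to convolve phi and eta agree near the support of L. *)
Lemma functional_mollify phi : smooth phi -> lint (fun v => eta v * L (shiftf v phi)) = 0.
Proof.
move=> sp; have cp := smooth_continuous sp; have se := smooth_eta delta.
have [Be Be0 HBe] := eta_bounded delta0.
have we : window Be (Num.sqrt delta) eta.
  by split; [exact: measurable_eta|exact: HBe|exact: eta0].
have cn : continuous (fun v : E => phi (- v)).
  by move=> v; apply: continuous_comp; [exact: opp_continuous|exact: cp].
have [B B0 HB] := bounded_cube rho cn.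
have mc : measurable (cube m.+2 rho : set (borel_rV m.+2)) by exact: measurable_norm_le.
pose a (v : E) := phi (- v) * \1_(cube m.+2 rho) v.
have wa : window B rho a.
  split.
  - apply: measurable_funM; last exact: measurable_indic.
    exact: continuous_measurable_rV.
  - move=> u; rewrite /a indicE; have [ur|ur] := leP `|u| rho.
      by rewrite mem_set // mulr1 HB.
    rewrite memNset ?mulr0 ?normr0 // => uc.
    by have := lt_le_trans ur uc; rewrite ltxx.
  - move=> u ur; rewrite /a indicE memNset ?mulr0 // => uc.
    by have := lt_le_trans ur uc; rewrite ltxx.
have [ma aA a0] := wa; have [me eA e0] := we.
rewrite -(functional_convol hL sp we).
have -> : L (convol eta phi) = L (convol a eta).
  apply: (functional_local hL (r' := r + 1)); first by rewrite ltrDl.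
  - exact: (smooth_convol me eA e0).
  - exact: (smooth_convol ma aA a0).
  move=> w wr; rewrite /convol (lint_isometry (- w) (orthogonal_opp1 m.+2)); last first.
    by apply: cont_mul; [exact: continuous_eta|exact: (cont_shift cp)].
  congr lint; apply/funext => t; rewrite mulmxN mulmx1 addrA subrr add0r -opprD eta_opp mulrC /a indicE.
  have [->|/(near_support wr) ur] := eqVneq (eta (w + t)) 0; first by rewrite !mulr0.
  by rewrite mem_set // mulr1.
rewrite (functional_convol hL se wa) -[RHS](@lint0 R m.+2); congr lint; apply/funext => t.
by rewrite -/(f t) mollified_eq0 mulr0.
Qed.

End Fixed.

(** L phi is the limit, for delta tending to 0, of normalized integrals of
    L (shiftf v phi) against eta, and these integrals vanish. *)
Theorem functional_eq0 phi : smooth phi -> L phi = 0.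
Proof.
move=> sp; apply/eqP; apply/negPn/negP => L0.
pose F v := L (shiftf v phi).
have F0 : F 0 = L phi by rewrite /F; congr L; apply/funext => w; rewrite /shiftf addr0.
have cF : continuous F by exact: (continuous_functional_shift hL sp).
have e0 : 0 < `|L phi| / 2 by rewrite divr_gt0 // normr_gt0.
have /cvgrPdist_le/(_ _ e0)/nbhs_ballP[d /= d0 Hd] := cF 0.
pose delta := Num.min (r0 / 8) (d ^+ 2 / 4).
have delta0 : 0 < delta by rewrite lt_min !divr_gt0 ?exprn_gt0.
have delta1 : delta < r0 / 4.
  by apply: (@le_lt_trans _ _ (r0 / 8)); [rewrite ge_min lexx|move: r00; lra].
have [Be Be0 HBe] := eta_bounded delta0.
have ee := eta0 delta0; have me := measurable_eta delta.
have ce := @continuous_eta delta.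
have cc : continuous (fun v => F v - F 0) by apply: cont_add => //; exact: cont_cst.
have Ie : litg (eta delta).
  have := litg_window me HBe ee (@cont_cst _ _ 1).
  by rewrite (_ : (fun v => eta delta v * 1) = eta delta) //; apply/funext => v; rewrite mulr1.
have := lint_window_le (e := `|L phi| / 2) me HBe ee cc _.
have -> : lint (fun v => eta delta v * (F v - F 0)) = - (L phi * mass (eta delta)).
  rewrite (_ : (fun v => _) = fun v => eta delta v * F v - L phi * eta delta v); last first.
    by apply/funext => v; rewrite F0; ring.
  rewrite lintB ?lintZ //; [|exact: (litg_window me HBe ee cF)|exact: litgZ].
  rewrite functional_mollify // sub0r; congr (- (_ * lint _)).
  by apply/funext => v; rewrite ger0_norm // eta_ge0.
have M0 := mass_eta_gt0 delta0.
rewrite normrN normrM (gtr0_norm M0) ler_pM2r // => H.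
have : `|L phi| <= `|L phi| / 2.
  apply: H => v /(eta_support delta0) vd; rewrite distrC; apply: Hd.
  rewrite -ball_normE /= sub0r normrN -ltr_sqr ?nnegrE ?(ltW d0) //.
  apply: le_lt_trans (norm_le_sqnorm _) _; apply: lt_le_trans vd _.
  by apply: (@le_trans _ _ (d ^+ 2 / 4)); [rewrite ge_min lexx orbT|have := exprn_gt0 2 d0; lra].
by move: e0; lra.
Qed.

End Mollification.

(** * The manifold of planes *)

Section Coprojection.
Context {R : realType} {n : nat}.

(** The orthogonal projection of R^n onto the complement of the row space of M;
    its quadratic form is the squared distance to that space. *)
Definition coproj k (M : 'M[R]_(k, n)) : 'M[R]_n :=
  1%:M - M^T *m invmx (M *m M^T) *m M.

Lemma gram_unit k (M : 'M[R]_(k, n)) : row_free M = (M *m M^T \in unitmx).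
Proof.
apply/idP/idP => [fM|uM]; last first.
  rewrite -kermx_eq0; apply/eqP; rewrite -(mulmxK uM (kermx M)).
  by rewrite mulmxA mulmx_ker mul0mx mul0mx.
rewrite -row_free_unit; apply: inj_row_free => v v0.
have : sqnorm (v *m M) = 0.
  by rewrite sqnormE dotpE trmx_mul -[_ *m (_ *m _)]mulmxA [M *m (_ *m _)]mulmxA mulmxA v0 mul0mx mxE.
move=> /eqP; rewrite sqnorm_eq0 => /eqP vM; apply: (row_free_inj fM).
by rewrite vM mul0mx.
Qed.

Section RowFree.
Variables (k : nat) (M : 'M[R]_(k, n)).
Hypothesis fM : row_free M.

Lemma coproj_sym : (coproj M)^T = coproj M.
Proof.
rewrite /coproj linearB /= trmx1 !trmx_mul trmxK trmx_inv trmx_mul trmxK; congr (_ - _).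
exact: mulmxA.
Qed.

Lemma mul_coproj : M *m coproj M = 0.
Proof.
rewrite mulmxBr mulmx1 !mulmxA mulmxV ?mul1mx ?subrr //.
by rewrite -gram_unit.
Qed.

Lemma coproj_fixed m (B : 'M[R]_(m, n)) : B *m M^T = 0 -> B *m coproj M = B.
Proof. by move=> B0; rewrite mulmxBr mulmx1 !mulmxA B0 !mul0mx subr0. Qed.

Lemma coproj_idem : coproj M *m coproj M = coproj M.
Proof.
apply: coproj_fixed; rewrite -[coproj M]trmxK -trmx_mul coproj_sym.
by rewrite mul_coproj trmx0.
Qed.

Lemma coproj_trace : \tr (coproj M) = n%:R - k%:R.
Proof.
rewrite linearB /= mxtrace1 -mulmxA mxtrace_mulC -mulmxA mulVmx ?mxtrace1 //.
by rewrite -gram_unit.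
Qed.

Lemma coproj_rotate (Q : 'M[R]_n) : orthogonal_mx Q -> coproj (M *m Q) = Q^T *m coproj M *m Q.
Proof.
move=> hQ; have GE : M *m Q *m (M *m Q)^T = M *m M^T.
  by rewrite trmx_mul mulmxA -(mulmxA M Q) (hQ : Q *m Q^T = 1%:M) mulmx1.
rewrite /coproj GE trmx_mul.
rewrite mulmxBr mulmxBl mulmx1 (orthogonal_mxC hQ); congr (_ - _).
by rewrite !mulmxA.
Qed.

Lemma coproj_sub z : exists t : 'rV[R]_k, z = z *m coproj M + t *m M.
Proof. by exists (z *m M^T *m invmx (M *m M^T)); rewrite mulmxBr mulmx1 !mulmxA subrK. Qed.

Lemma qform_coproj z : qform (coproj M) z = sqnorm (z *m coproj M).
Proof.
rewrite /qform sqnormE !dotpE trmx_mul coproj_sym [in RHS]mulmxA -[in RHS](mulmxA z).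
by rewrite coproj_idem.
Qed.

End RowFree.

(** Each projection absorbs the other, so both products are computed, and transposing
    one of them gives the other. *)
Lemma coproj_eq k (M M' : 'M[R]_(k, n)) : row_free M -> row_free M' ->
  M *m coproj M' = 0 -> M' *m coproj M = 0 -> coproj M = coproj M'.
Proof.
move=> fM fM' h h'.
have e1 : coproj M *m coproj M' = coproj M'.
  by rewrite {1}/coproj mulmxBl mul1mx -!mulmxA h !mulmx0 subr0.
have e2 : coproj M' *m coproj M = coproj M.
  by rewrite {1}/coproj mulmxBl mul1mx -!mulmxA h' !mulmx0 subr0.
by have /(congr1 trmx) := e2; rewrite trmx_mul !coproj_sym e1 => ->.
Qed.

(** Gram-Schmidt. *)
Lemma orthonormal_frame k (M : 'M[R]_(k, n)) : row_free M ->
  exists2 N : 'M[R]_(k, n), N *m N^T = 1%:M & (N <= M)%MS /\ (M <= N)%MS.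
Proof.
move=> fM; suff [N NN NM] : exists2 N : 'M[R]_(k, n), N *m N^T = 1%:M & (N <= M)%MS.
  exists N => //; split=> //; have fN : row_free N by rewrite gram_unit NN unitmx1.
  have [_ H] := mxrank_leqif_sup NM; rewrite -H.
  by move: fM fN; rewrite /row_free => /eqP -> /eqP ->.
elim: k M fM => [|k IH] M fM; first by exists M => //; apply/matrixP => -[].
move: M fM; rewrite -[k.+1]/(1 + k)%N => M; rewrite -(vsubmxK M).
move: (usubmx M) (dsubmx M) => u N fM.
have fN : row_free N.
  apply: inj_row_free => v vN; have : row_mx 0 v *m col_mx u N = 0.
    by rewrite mul_row_col mul0mx add0r.
  rewrite -[RHS](mul0mx _ (col_mx u N)) => /(row_free_inj fM)/(congr1 rsubmx).
  by rewrite row_mxKr linear0.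
have [B BB BN] := IH N fN.
pose v := u - u *m B^T *m B.
have vB : v *m B^T = 0 by rewrite /v mulmxBl -(mulmxA (u *m B^T)) BB mulmx1 subrr.
have v0 : v != 0.
  apply/eqP => /eqP; rewrite subr_eq0 => /eqP uB.
  have uN : (col_mx u N <= N)%MS.
    by rewrite col_mx_sub submx_refl andbT uB (submx_trans (submxMl _ _)).
  have := mxrankS uN; move: fM; rewrite /row_free => /eqP ->.
  by move=> /leq_trans /(_ (rank_leq_row N)); rewrite ltnn.
pose c := (Num.sqrt (sqnorm v))^-1.
have sv : 0 < sqnorm v by rewrite lt_def sqnorm_eq0 v0 sqnorm_ge0.
have vv : v *m v^T = (sqnorm v)%:M by rewrite [LHS]mx11_scalar -dotpE -sqnormE.
exists (col_mx (c *: v) B).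
  have vB' : (c *: v) *m B^T = 0 by rewrite -scalemxAl vB scaler0.
  have Bv : B *m (c *: v)^T = 0 by rewrite -[LHS]trmxK trmx_mul trmxK vB' trmx0.
  rewrite tr_col_mx mul_col_row vB' Bv BB.
  rewrite linearZ /= -scalemxAl -scalemxAr scalerA vv scale_scalar_mx -expr2 exprVn sqr_sqrtr ?(ltW sv) //.
  by rewrite mulVf ?gt_eqF // -scalar_mx_block.
have NM : (N <= col_mx u N)%MS by rewrite -addsmxE addsmxSr.
have BM := submx_trans BN NM.
rewrite col_mx_sub BM andbT scalemx_sub // addmx_sub //; first by rewrite -addsmxE addsmxSl.
by rewrite eqmx_opp (submx_trans (submxMl _ _)).
Qed.

End Coprojection.

Section PlaneGeometry.
Context {R : realType} {n : nat} {d : 'I_n}.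
Notation E := 'rV[R]_n.
Notation frames := ('rV[R]_n * 'M[R]_(d, n))%type.

Lemma plane_set_sub (p p' : E) (M M' : 'M[R]_(d, n)) : row_free M' ->
  plane_set p M `<=` plane_set p' M' -> M *m coproj M' = 0 /\ (p - p') *m coproj M' = 0.
Proof.
move=> fM' H.
have P0 (t : 'rV[R]_d) : (p - p' + t *m M) *m coproj M' = 0.
  have [s _ sE] := H (p + t *m M) (ex_intro2 _ _ t I erefl).
  have -> : p - p' + t *m M = s *m M' by rewrite addrAC -sE addrAC subrr add0r.
  by rewrite -mulmxA mul_coproj // mulmx0.
have pp : (p - p') *m coproj M' = 0 by rewrite -(P0 0) mul0mx addr0.
split => //; apply/row_matrixP => i; rewrite row_mul row0 rowE.
by have := P0 (delta_mx 0 i); rewrite mulmxDl pp add0r.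
Qed.

Lemma dplane_frame (A : dplane d) : exists F : frames,
  row_free F.2 /\ dplane_set A = plane_set F.1 F.2.
Proof. by have [p [M H]] := dplaneP A; exists (p, M). Qed.

Definition frame_of (A : dplane d) : frames := projT1 (cid (dplane_frame A)).

Lemma frame_ofP (A : dplane d) : row_free (frame_of A).2 /\
  dplane_set A = plane_set (frame_of A).1 (frame_of A).2.
Proof. exact: projT2 (cid (dplane_frame A)). Qed.

(** The projection to the normal space; it is independent of the chosen frame. *)
Definition normal_mx (A : dplane d) : 'M[R]_n := coproj (frame_of A).2.

(** The squared distance of x to A. *)
Definition dist2 (A : dplane d) (x : E) : R := qform (normal_mx A) (x - (frame_of A).1).

Definition frame_dist2 (x : E) (F : frames) : R := qform (coproj F.2) (x - F.1).

Lemma normal_mxE (A : dplane d) (p : E) (M : 'M[R]_(d, n)) : row_free M ->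
  dplane_set A = plane_set p M -> normal_mx A = coproj M.
Proof.
move=> fM AE; have [fN AN] := frame_ofP A; apply: coproj_eq => //.
  by apply: (plane_set_sub (p := (frame_of A).1) (p' := p) fM _).1; rewrite -AN AE.
by apply: (plane_set_sub (p := p) (p' := (frame_of A).1) fN _).1; rewrite -AN AE.
Qed.

Lemma dist2E (A : dplane d) (x p : E) (M : 'M[R]_(d, n)) : row_free M ->
  dplane_set A = plane_set p M -> dist2 A x = frame_dist2 x (p, M).
Proof.
move=> fM AE; rewrite /dist2 (normal_mxE fM AE) /frame_dist2 /=.
have [fN AN] := frame_ofP A.
have P0 : ((frame_of A).1 - p) *m coproj M = 0.
  by apply: (plane_set_sub (M := (frame_of A).2) fM _).2; rewrite -AN AE.
have -> : x - p = (x - (frame_of A).1) + ((frame_of A).1 - p) by rewrite addrA subrK.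
by rewrite !qform_coproj // [in RHS]mulmxDl P0 addr0.
Qed.

Lemma dist2_foot (A : dplane d) (x : E) : exists2 y, dplane_set A y & sqnorm (x - y) = dist2 A x.
Proof.
have [fM ->] := frame_ofP A; rewrite /dist2 qform_coproj //; set p := (frame_of A).1.
have [t tE] := coproj_sub (frame_of A).2 (x - p).
exists (p + t *m (frame_of A).2); first by exists t.
by rewrite opprD addrA {1}tE addrK.
Qed.

Lemma dist2_eq0 (A : dplane d) (x : E) : (dist2 A x == 0) = `[< dplane_set A x >].
Proof.
apply/idP/asboolP => [/eqP d0|Ax].
  have [y Ay] := dist2_foot A x; rewrite d0 => /eqP; rewrite sqnorm_eq0 subr_eq0 => /eqP ->.
  exact: Ay.
have [fM AE] := frame_ofP A; rewrite /dist2 qform_coproj // sqnorm_eq0; apply/eqP.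
move: Ax; rewrite AE => -[t _ <-]; rewrite addrAC subrr add0r.
by rewrite -mulmxA mul_coproj // mulmx0.
Qed.

Lemma eq_plane_set (p p' : E) (M M' : 'M[R]_(d, n)) :
  (M <= M')%MS -> (M' <= M)%MS -> (p - p' <= M')%MS -> plane_set p M = plane_set p' M'.
Proof.
move=> /submxP[B BE] /submxP[C CE] /submxP[s sE].
have pE : p = p' + s *m M' by rewrite -sE addrC subrK.
apply/seteqP; split => [_ [t _ <-]|_ [t _ <-]].
  by exists (s + t *m B) => //; rewrite mulmxDl -mulmxA -BE addrA -pE.
exists ((t - s) *m C) => //; rewrite -mulmxA -CE pE mulmxBl.
by rewrite -addrA; congr (_ + _); rewrite addrC subrK.
Qed.

(** Frames in this normal form with bounded distance to x form a compact set. *)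
Lemma orthonormal_plane (A : dplane d) (x : E) : exists F : frames,
  [/\ F.2 *m F.2^T = 1%:M, dplane_set A = plane_set F.1 F.2 & sqnorm (x - F.1) = dist2 A x].
Proof.
have [fM AE] := frame_ofP A; have [y Ay yd] := dist2_foot A x.
have [N NN [NM MN]] := orthonormal_frame fM.
exists (y, N); split => //=; rewrite AE; apply: eq_plane_set => //.
move: Ay; rewrite AE => -[t _ <-]; rewrite opprD addrA subrr add0r eqmx_opp.
exact: submx_trans (submxMl _ _) MN.
Qed.

Definition plane_of (F : frames) : dplane d :=
  if pselect (row_free F.2) is left h then mk_dplane F.1 h else point.

Lemma plane_ofE (F : frames) : row_free F.2 -> dplane_set (plane_of F) = plane_set F.1 F.2.
Proof. by move=> h; rewrite /plane_of; case: pselect. Qed.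

Lemma frame_planeE (F : set_type (@frame_set R n d)) : frame_plane F = plane_of (val F).
Proof.
apply: dplane_eq; rewrite plane_ofE //.
exact: (set_mem (valP F)).
Qed.

Section SmoothFrames.
Variable O : set frames.
Hypothesis hO : open O.

Lemma Ck_frame_entry k i j : Ck O k (fun F : frames => F.2 i j).
Proof.
apply: (Ck_linear hO) => [F|h v x]; last by rewrite /= !mxE.
by apply: (@continuous_comp _ _ _ (@snd E 'M[R]_(d, n)) (fun M : 'M[R]_(d, n) => M i j) F);
  [exact: cvg_snd|exact: coord_continuous].
Qed.

Lemma Ck_base_entry k (x : E) i : Ck O k (fun F : frames => (x - F.1) 0 i).
Proof.
have C1 : Ck O k (fun F : frames => F.1 0 i).
  apply: (Ck_linear hO) => [F|h v y]; last by rewrite /= !mxE.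
  by apply: (@continuous_comp _ _ _ (@fst E 'M[R]_(d, n)) (fun p : E => p 0 i) F);
    [exact: cvg_fst|exact: coord_continuous].
apply: (Ck_eq hO _ (Ck_add hO (Ck_cst hO k (x 0 i)) (Ck_mul hO (Ck_cst hO k (-1)) C1))) => F _.
by rewrite !mxE mulN1r.
Qed.

Lemma Ck_gram k i j : Ck O k (fun F : frames => (F.2 *m F.2^T) i j).
Proof.
apply: (Ck_eq hO (f := fun F : frames => \sum_l F.2 i l * F.2 j l)) => [F _|].
  by rewrite mxE; apply: eq_bigr => l _; rewrite mxE.
by apply: (Ck_sum hO) => l; apply: (Ck_mul hO); exact: Ck_frame_entry.
Qed.

Lemma Ck_det k m (A : frames -> 'M[R]_m) : (forall i j, Ck O k (fun F => A F i j)) ->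
  Ck O k (fun F => \det (A F)).
Proof.
move=> CA; apply: (Ck_sum hO) => s; apply: (Ck_mul hO); first exact: (Ck_cst hO).
by apply: (Ck_prod hO) => i; exact: CA.
Qed.

Lemma Ck_adj k m (A : frames -> 'M[R]_m) i j : (forall i j, Ck O k (fun F => A F i j)) ->
  Ck O k (fun F => (\adj (A F)) i j).
Proof.
move=> CA; apply: (Ck_eq hO (f := fun F => (-1) ^+ (j + i) * \det (row' j (col' i (A F))))) => [F _|].
  by rewrite mxE /cofactor.
apply: (Ck_mul hO); first exact: (Ck_cst hO).
apply: Ck_det => a b.
by apply: (Ck_eq hO (f := fun F => A F (lift j a) (lift i b))) => // F _; rewrite !mxE.
Qed.

Lemma Ck_inv k (f : frames -> R) : (forall F, O F -> f F != 0) -> Ck O k f ->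
  Ck O k (fun F => (f F)^-1).
Proof.
move=> f0 Cf; apply: (@Ck_comp R _ O hO (fun h => exists c j, h = fun t : R => c * t^-1 ^+ j)
  [set t : R | t != 0] k f (fun t => t^-1)) => //; last first.
  by exists 1, 1%N; apply/funext => t; rewrite mul1r expr1.
move=> _ [c [j ->]]; exists (fun t => - (c * j%:R) * t^-1 ^+ j.+1); first by exists (- (c * j%:R)), j.+1.
move=> t /= t0; have DV : is_derive t 1 (fun t : R => t^-1) (- t ^- 2).
  have := is_deriveV t0 (is_derive_id t (1 : R)); congr is_derive.
  by rewrite -[_ *: _]/(_ * _) mulr1.
have D2 : is_derive t 1 (fun t : R => t^-1 ^+ j) (- (j%:R * t^-1 ^+ j.+1)).
  elim: j => [|j IH].
    by have := is_derive_cst (1 : R) t 1; rewrite mul0r oppr0.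
  have := is_deriveM DV IH; congr is_derive.
    by apply/funext => u; rewrite exprS.
  change (t^-1 * - (j%:R * t^-1 ^+ j.+1) + t^-1 ^+ j * - t ^- 2 = - (j.+1%:R * t^-1 ^+ j.+2)).
  by rewrite -exprVn -natr1 !exprS expr0; ring.
have := is_deriveZ c D2; congr is_derive.
by rewrite -[_ *: _]/(_ * _) mulrN mulNr mulrA.
Qed.

End SmoothFrames.

Lemma open_frame_set : open (@frame_set R n d).
Proof.
have -> : @frame_set R n d = (fun F : frames => \det (F.2 *m F.2^T)) @^-1` [set t : R | t != 0].
  by apply/seteqP; split => F /=; rewrite /frame_set /= gram_unit unitmxE unitfE.
apply: open_comp; last exact: open_neq.
move=> F _; have := Ck_det openT (Ck_gram openT 0).
by move=> /Ck_continuous/(_ F I).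
Qed.

Lemma Ck_coproj k i j : Ck (@frame_set R n d) k (fun F : frames => coproj F.2 i j).
Proof.
have hO := open_frame_set; pose G (F : frames) := F.2 *m F.2^T.
apply: (Ck_eq hO (f := fun F : frames => (1%:M : 'M[R]_n) i j +
   (-1) * \sum_b (\sum_a F.2 a i * ((\det (G F))^-1 * (\adj (G F)) a b)) * F.2 b j)).
  move=> F fF; have uG : G F \in unitmx by rewrite -gram_unit.
  have GE a b : (invmx (G F)) a b = (\det (G F))^-1 * (\adj (G F)) a b by rewrite /invmx uG mxE.
  rewrite /coproj -/(G F) [in RHS]mxE [X in _ = _ + X]mxE mulN1r; congr (_ - _).
  rewrite [RHS]mxE; apply: eq_bigr => b _; congr (_ * _).
  by rewrite [RHS]mxE; apply: eq_bigr => a _; rewrite -GE [F.2^T i a]mxE.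
apply: (Ck_add hO (Ck_cst hO k _)); apply: (Ck_mul hO (Ck_cst hO k _)).
apply: (Ck_sum hO) => b; apply: (Ck_mul hO); last exact: Ck_frame_entry.
apply: (Ck_sum hO) => a; apply: (Ck_mul hO); first exact: Ck_frame_entry.
apply: (Ck_mul hO); last by apply: Ck_adj => // *; exact: Ck_gram.
apply: Ck_inv => //; last by apply: Ck_det => // *; exact: Ck_gram.
by move=> F; rewrite /frame_set /= gram_unit unitmxE unitfE.
Qed.

Lemma Ck_frame_dist2 k (x : E) : Ck (@frame_set R n d) k (frame_dist2 x).
Proof.
have hO := open_frame_set.
apply: (Ck_eq hO (f := fun F : frames =>
    \sum_i (\sum_j (x - F.1) 0 j * coproj F.2 j i) * (x - F.1) 0 i)).
  by move=> F _; rewrite /frame_dist2 /qform /dotp; apply: eq_bigr => i _; congr (_ * _); rewrite [RHS]mxE.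
apply: (Ck_sum hO) => i; apply: (Ck_mul hO); last exact: Ck_base_entry.
by apply: (Ck_sum hO) => j; apply: (Ck_mul hO); [exact: Ck_base_entry|exact: Ck_coproj].
Qed.

(** The topology on planes is defined through the subtype of frames; since frames
    form an open set, continuity may be tested in the ambient vector space. *)
Lemma continuous_plane_of (F : frames) : frame_set F -> {for F, continuous plane_of}.
Proof.
move=> fF U; rewrite nbhsE => -[W [oW WF] WU].
have [G1 oO OE] : exists2 G1 : set frames, open G1 & set_val @^-1` G1 = (@frame_plane R n d) @^-1` W by exact: oW.
have FO : G1 F.
  have : (set_val @^-1` G1) (SigSub (mem_set fF) : set_type (@frame_set R n d)).
    by rewrite OE /= frame_planeE.
  by [].
apply: filterS (open_nbhs_nbhs (conj (openI oO open_frame_set) (conj FO fF))) => H [OG fG].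
apply: WU; have : (set_val @^-1` G1) (SigSub (mem_set fG) : set_type (@frame_set R n d)) by [].
by rewrite OE /= frame_planeE.
Qed.

Lemma open_dplane (W : set (dplane d)) :
  open (plane_of @^-1` W `&` @frame_set R n d) -> open W.
Proof.
move=> oW; exists (plane_of @^-1` W `&` @frame_set R n d) => //.
apply/seteqP; split => F /=; rewrite frame_planeE; first by case.
by move=> WF; split => //; exact: (set_mem (valP F)).
Qed.

Lemma continuous_dplane (g : dplane d -> R) :
  (forall F, frame_set F -> {for F, continuous (g \o plane_of)}) -> continuous g.
Proof.
move=> H; apply/continuousP => W oW; apply: open_dplane.
rewrite openE => F [WF fF]; apply: filterI; last exact: open_nbhs_nbhs (conj open_frame_set fF).
by apply: (H F fF); exact: open_nbhs_nbhs.
Qed.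

End PlaneGeometry.

(** * Bumps of the distance to a point *)

Section PlaneBump.
Context {R : realType} {n : nat} {d : 'I_n}.
Notation E := 'rV[R]_n.
Notation frames := ('rV[R]_n * 'M[R]_(d, n))%type.

Lemma continuous_dist2 (x : E) : continuous (fun A : dplane d => dist2 A x).
Proof.
apply: continuous_dplane; apply: (@Ck_continuous R _ (@frame_set R n d) 0).
apply: (Ck_eq open_frame_set _ (Ck_frame_dist2 0 x)) => F fF.
by rewrite /= (dist2E x fF (plane_ofE fF)); case: F fF.
Qed.

Lemma continuous_normal_mx (i j : 'I_n) : continuous (fun A : @dplane R n d => normal_mx A i j).
Proof.
apply: continuous_dplane; apply: (@Ck_continuous R _ (@frame_set R n d) 0).
apply: (Ck_eq open_frame_set _ (Ck_coproj 0 i j)) => F fF.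
by rewrite /= (normal_mxE fF (plane_ofE fF)).
Qed.

Lemma continuous_vec_mx a b : continuous (vec_mx : 'rV[R]_(a * b) -> 'M[R]_(a, b)).
Proof.
have le (v : 'rV[R]_(a * b)) : `|vec_mx v : 'M[R]_(a, b)| <= `|v|.
  rewrite [leLHS]/Num.norm /= mx_normrE; apply: bigmax_le => //= -[i j] _ /=.
  by rewrite mxE; exact: coord_le_norm.
move=> v; apply: (proj2 (@cvgrPdist_le R _ _ (nbhs v) (nbhs_filter v) vec_mx (vec_mx v))) => e e0.
have : \forall w \near v, `|v - w| <= e.
  exact: (proj1 (@cvgrPdist_le R _ _ (nbhs v) (nbhs_filter v) id v) cvg_id e e0).
by apply: filterS => w vw; rewrite -linearB /=; exact: le_trans (le _) vw.
Qed.

Lemma compact_mx_box a b (c : R) : compact [set M : 'M[R]_(a, b) | forall i j, `|M i j| <= c].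
Proof.
have cv : compact [set v : 'rV[R]_(a * b) | forall k, `[- c, c]%classic (v ord0 k)].
  by apply: (@rV_compact _ _ (fun=> `[- c, c]%classic)) => k; exact: segment_compact.
have := @continuous_compact _ _ (vec_mx : 'rV[R]_(a * b) -> 'M[R]_(a, b)) _ (continuous_subspaceT (@continuous_vec_mx a b)) cv.
congr compact; apply/seteqP; split => [_ [v /= Hv <-] i j|M /= HM].
  by rewrite mxE ler_norml; have := Hv (mxvec_index i j); rewrite /= in_itv.
exists (mxvec M); last exact: mxvecK.
by move=> k /=; case/mxvec_indexP: k => i j; rewrite mxvecE in_itv /= -ler_norml.
Qed.

Lemma compact_orthonormal_frames (x : E) (l : R) :
  compact [set F : frames | F.2 *m F.2^T = 1%:M /\ sqnorm (x - F.1) <= l].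
Proof.
have sq1 (a c : R) : a ^+ 2 <= c -> `|a| <= 1 + c by rewrite ler_norml => H; apply/andP; split; nra.
pose xm : R := \big[Num.max/0]_i `|x 0 i|.
apply: (@subclosed_compact _ _ ([set p : E | forall i j, `|p i j| <= xm + (1 + l)] `*`
    [set M : 'M[R]_(d, n) | forall i j, `|M i j| <= 1 + 1])); last first.
- move=> [p M] /= [MM pl]; split => /= i j.
    rewrite (ord1 i) (_ : p 0 j = x 0 j - (x - p) 0 j); last by rewrite !mxE; ring.
    apply: le_trans (ler_normB _ _) _; apply: lerD; first exact: (le_bigmax _ (fun i => `|x 0 i|) j).
    by apply: sq1; apply: le_trans pl; exact: coord_le_sqnorm.
  apply: sq1; have M1 : (M *m M^T) i i = 1 by rewrite MM mxE eqxx.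
  rewrite -[X in _ <= X]M1 mxE (bigD1 j) //= mxE -expr2 lerDl.
  by apply: sumr_ge0 => b _; rewrite mxE -expr2 sqr_ge0.
- by apply: compact_setX; exact: compact_mx_box.
have oT : open [set: frames] := openT.
have -> : [set F : frames | F.2 *m F.2^T = 1%:M /\ sqnorm (x - F.1) <= l] =
   (\bigcap_(ij in [set: 'I_d * 'I_d]) (fun F : frames => (F.2 *m F.2^T) ij.1 ij.2) @^-1` [set (1%:M : 'M[R]_d) ij.1 ij.2])
   `&` (fun F : frames => sqnorm (x - F.1)) @^-1` [set t : R | t <= l].
  apply/seteqP; split => F /= [H1 H2]; split => //.
    by move=> ij _ /=; rewrite H1.
  by apply/matrixP => i j; exact: (H1 (i, j)).
apply: closedI; first apply: closed_bigI => ij _.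
  apply: closed_comp; last exact: closed_eq.
  by move=> F _; exact: (@Ck_continuous R _ [set: frames] 0 _ (Ck_gram oT 0 ij.1 ij.2) F I).
apply: closed_comp; last exact: closed_le.
have C0 : @Ck R _ [set: frames] 0 (fun F : frames => \sum_i (x - F.1) 0 i * (x - F.1) 0 i).
  by apply: (Ck_sum oT) => i; apply: (Ck_mul oT); exact: (Ck_base_entry oT).
move=> F _; have := @Ck_continuous R _ [set: frames] 0 _ C0 F I.
by congr continuous_at; apply/funext => G; apply: eq_bigr => i _; rewrite expr2.
Qed.

(** These planes are the images of the orthonormal frames based at a bounded distance
    from x, which are bounded and closed. *)
Lemma compact_near_planes (x : E) (l : R) : compact [set A : dplane d | dist2 A x <= l].
Proof.
have cK : {within [set F : frames | F.2 *m F.2^T = 1%:M /\ sqnorm (x - F.1) <= l], continuous (@plane_of R n d)}.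
  apply: continuous_in_subspaceT => F; rewrite inE => -[FF _]; apply: continuous_plane_of.
  by rewrite /frame_set /= gram_unit FF unitmx1.
apply: (@subclosed_compact (dplane d) _ _ _ (continuous_compact cK (@compact_orthonormal_frames x l))).
  apply: (@closed_comp _ _ (fun A : dplane d => dist2 A x) [set t : R | t <= l]); last exact: closed_le.
  by move=> A _; exact: continuous_dist2.
move=> A /= Al; have [F [FF AF Fx]] := orthonormal_plane A x.
exists F; first by split => //; rewrite Fx.
by apply: dplane_eq; rewrite plane_ofE // gram_unit FF unitmx1.
Qed.

Definition plane_bump (l : R) (x : E) (A : dplane d) : R[i] := Complex (bump (l^-1 * dist2 A x)) 0.

Lemma plane_bump_test (V : set E) (l : R) (x : E) : 0 < l ->
  (forall y, sqnorm (y - x) <= l -> V y) -> dplane_test_fun V (plane_bump l x).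
Proof.
move=> l0 HV; have hO := @open_frame_set R n d.
have sub : csupport (plane_bump l x) `<=` [set A : dplane d | dist2 A x <= l].
  have cl : closed [set A : dplane d | dist2 A x <= l].
    apply: (@closed_comp _ _ (fun A : dplane d => dist2 A x) [set t : R | t <= l]); last exact: closed_le.
    by move=> A _; exact: continuous_dist2.
  rewrite ((closure_id _).1 cl); apply: closure_subset => A /=; apply: contraNT; rewrite -ltNge => lA.
  by rewrite /plane_bump bump_eq0 // ler_pdivlMl // mulr1 ltW.
split.
- split; apply/smooth_Ck => // k.
    apply: (Ck_eq hO _ (Ck_flat1 hO 1 l^-1 (Ck_frame_dist2 k x))) => F fF.
    rewrite /cRe /frame_pullback; case: pselect => // h.
    by rewrite /plane_bump (dist2E (p := F.1) (M := F.2) x h) //; case: F fF h.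
  apply: (Ck_eq hO _ (Ck_cst hO k 0)) => F fF.
  by rewrite /cIm /frame_pullback; case: pselect.
- exact: (@subclosed_compact (dplane d) _ _ (@closed_closure _ _) (@compact_near_planes x l) sub).
move=> A /sub /= Al; have [y Ay yE] := dist2_foot A x; exists y; split => //.
by apply: HV; rewrite -sqnormN opprB yE.
Qed.

End PlaneBump.

(** * Invariant averages over planes *)

Section Rotations.
Context {R : realType} {n : nat} {d : 'I_n}.
Notation E := 'rV[R]_n.
Notation frames := ('rV[R]_n * 'M[R]_(d, n))%type.
Notation planes := (@borel_dplane R n d).

Lemma continuous_mx (T : topologicalType) a b (f : T -> 'M[R]_(a, b)) (x : T) :
  (forall i j, {for x, continuous (fun y => f y i j)}) -> {for x, continuous f}.
Proof.
move=> H; apply/cvg_ballP => e e0.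
have : \forall y \near x, forall ij : 'I_a * 'I_b, ball (f x ij.1 ij.2) e (f y ij.1 ij.2).
  by apply: filter_forall => ij; have /cvg_ballP/(_ e e0) := H ij.1 ij.2.
by apply: filterS => y Hy; split => // i j; exact: (Hy (i, j)).
Qed.

Lemma continuous_mulmxr a b c (Q : 'M[R]_(b, c)) : continuous (fun M : 'M[R]_(a, b) => M *m Q).
Proof.
move=> M; apply: continuous_mx => i j.
have -> : (fun N : 'M[R]_(a, b) => (N *m Q) i j) = fun N => \sum_k N i k * Q k j.
  by apply/funext => N; rewrite mxE.
apply: continuous_sum => k _; apply: continuousM; [exact: coord_continuous|exact: cst_continuous].
Qed.

Lemma plane_set_mulmx (p : E) (M : 'M[R]_(d, n)) (Q : 'M[R]_n) :
  [set y *m Q | y in plane_set p M] = plane_set (p *m Q) (M *m Q).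
Proof.
apply/seteqP; split => [_ [_ [t _ <-] <-]|_ [t _ <-]].
  by exists t => //; rewrite mulmxDl mulmxA.
by exists (p + t *m M); [exists t|rewrite mulmxDl mulmxA].
Qed.

Definition rotate_frame (Q : 'M[R]_n) (F : frames) : frames := (F.1 *m Q, F.2 *m Q).

Definition rotate_plane (Q : 'M[R]_n) (A : dplane d) : dplane d :=
  plane_of (rotate_frame Q (frame_of A)).

Section Orthogonal.
Variable Q : 'M[R]_n.
Hypothesis hQ : orthogonal_mx Q.

Lemma row_free_rotate (M : 'M[R]_(d, n)) : row_free (M *m Q) = row_free M.
Proof.
by rewrite !gram_unit trmx_mul mulmxA -(mulmxA M Q) (hQ : Q *m Q^T = 1%:M) mulmx1.
Qed.

Lemma rotate_planeE (A : dplane d) : dplane_set (rotate_plane Q A) = [set y *m Q | y in dplane_set A].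
Proof.
have [fM AE] := frame_ofP A.
by rewrite plane_ofE /= ?row_free_rotate // AE plane_set_mulmx.
Qed.

Lemma normal_mx_rotate (A : dplane d) : normal_mx (rotate_plane Q A) = Q^T *m normal_mx A *m Q.
Proof.
have [fM AE] := frame_ofP A; rewrite -coproj_rotate //.
by apply: (normal_mxE (p := (frame_of A).1 *m Q)); [rewrite row_free_rotate|rewrite plane_ofE /= ?row_free_rotate].
Qed.

Lemma rotate_plane_of (F : frames) : row_free F.2 ->
  rotate_plane Q (plane_of F) = plane_of (rotate_frame Q F).
Proof.
move=> fF; apply: dplane_eq; rewrite rotate_planeE plane_ofE // plane_set_mulmx plane_ofE //.
by rewrite /= row_free_rotate.
Qed.

Lemma continuous_rotate_plane : continuous (rotate_plane Q).
Proof.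
apply/continuousP => U oU; apply: open_dplane.
rewrite openE => F [/= UF fF]; apply: filterI; last exact: open_nbhs_nbhs (conj open_frame_set fF).
have cG : {for F, continuous (rotate_frame Q)}.
  have H1 : (fun G : frames => G.1 *m Q) @ F --> F.1 *m Q.
    by apply: (@continuous_comp _ _ _ (@fst E 'M[R]_(d, n)) (fun p : E => p *m Q) F);
      [exact: cvg_fst|exact: continuous_mulmxr].
  have H2 : (fun G : frames => G.2 *m Q) @ F --> F.2 *m Q.
    by apply: (@continuous_comp _ _ _ (@snd E 'M[R]_(d, n)) (fun p : 'M[R]_(d, n) => p *m Q) F);
      [exact: cvg_snd|exact: continuous_mulmxr].
  exact: (cvg_pair H1 H2).
have cP : {for F, continuous (plane_of \o rotate_frame Q)}.
  by apply: continuous_comp => //; apply: continuous_plane_of; rewrite /frame_set /= row_free_rotate.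
have NU : \forall G \near F, U (plane_of (rotate_frame Q G)).
  by apply: cP; apply: open_nbhs_nbhs; split => //=; rewrite -rotate_plane_of.
move: NU (open_nbhs_nbhs (conj open_frame_set fF)); apply: filterS2 => G UG fG /=.
by rewrite rotate_plane_of.
Qed.

End Orthogonal.

Lemma rotate_setE (Q : 'M[R]_n) (S : set (dplane d)) : orthogonal_mx Q ->
  rotate_set Q S = rotate_plane Q^T @^-1` S.
Proof.
move=> hQ; have hQT : orthogonal_mx Q^T by rewrite /orthogonal_mx trmxK; exact: orthogonal_mxC.
apply/seteqP; split => [A [L SL AE]|A SA] /=.
  suff -> : rotate_plane Q^T A = L by [].
  apply: dplane_eq; rewrite rotate_planeE // AE; apply/seteqP; split => [_ [_ [y Ly <-] <-]|y Ly].
    by rewrite -mulmxA (hQ : Q *m Q^T = 1%:M) mulmx1.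
  exists (y *m Q); first by exists y.
  by rewrite -mulmxA (hQ : Q *m Q^T = 1%:M) mulmx1.
exists (rotate_plane Q^T A) => //; rewrite rotate_planeE //.
apply/seteqP; split => [y Ay|_ [_ [y Ay <-] <-]].
  exists (y *m Q^T); first by exists y.
  by rewrite -mulmxA (orthogonal_mxC hQ) mulmx1.
by rewrite -mulmxA (orthogonal_mxC hQ) mulmx1.
Qed.

Lemma dist2_translate (y x : E) (L : dplane d) : planes_through 0 L ->
  dist2 (translate y L) x = qform (normal_mx L) (x - y).
Proof.
move=> L0; have [fM LE] := frame_ofP L; set p := (frame_of L).1 in LE; set M := (frame_of L).2 in fM LE.
have TE : dplane_set (translate y L) = plane_set (y + p) M.
  rewrite /= LE; apply/seteqP; split => [_ [_ [t _ <-] <-]|_ [t _ <-]].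
    by exists t => //; rewrite addrA.
  by exists (p + t *m M); [exists t|rewrite addrA].
have p0 : p *m coproj M = 0.
  move: L0; rewrite /planes_through /= LE => -[t _ /eqP]; rewrite addr_eq0 => /eqP ->.
  by rewrite mulNmx -mulmxA mul_coproj // mulmx0 oppr0.
rewrite (dist2E x fM TE) /frame_dist2 /= (normal_mxE fM LE) !qform_coproj //.
by rewrite opprD addrA [in LHS]mulmxBl p0 subr0.
Qed.

Lemma open_borel_dplane (U : set (@dplane R n d)) : open U -> measurable (U : set planes).
Proof. by move=> oU; exact: sub_sigma_algebra. Qed.

Lemma continuous_measurable_dplane (g : @dplane R n d -> R) :
  continuous g -> measurable_fun setT (g : planes -> R).
Proof.
move=> cg; apply: (measurability _ (RGenOpens.measurableE R)).
move=> _ [_ [a [b ->]] <-]; rewrite setTI; apply: open_borel_dplane.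
by apply: open_comp => [x _|]; [exact: cg|exact: interval_open].
Qed.

Lemma measurable_rotate_plane (Q : 'M[R]_n) : orthogonal_mx Q ->
  measurable_fun setT (rotate_plane Q : planes -> planes).
Proof.
move=> hQ; have E0 : @measurable _ planes = <<s @open (@dplane R n d) >> by [].
apply: (measurability _ E0).
move=> _ [U oU <-]; rewrite setTI; apply: open_borel_dplane.
exact: (proj1 (@continuousP (@dplane R n d) (@dplane R n d) (rotate_plane Q)) (continuous_rotate_plane hQ) U oU).
Qed.

Lemma measurable_planes_through0 : measurable (planes_through 0 : set planes).
Proof.
have := continuous_measurable_dplane (@continuous_dist2 R n d 0) measurableT (measurable_set1 (0 : R)).
rewrite setTI; congr measurable; apply/seteqP; split => A /=.
  by move=> A0; apply/asboolP; rewrite -dist2_eq0 A0.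
by move=> A0; apply/eqP; rewrite dist2_eq0; apply/asboolP.
Qed.

End Rotations.

Section PlaneAverage.
Context {R : realType} {n : nat} {d : 'I_n}.
Notation E := 'rV[R]_n.
Notation planes := (@borel_dplane R n d).
Variable mu : probability planes R.
Hypothesis hmu : invariant_measure mu.
Variables p q : nat.
Hypotheses (pE : p.+1 = (n - d)%N) (qE : q.+1 = d).

Notation D := (planes_through 0 : set planes).
Notation N := (@normal_mx R n d).

Lemma mu_planes_fin : (mu D < +oo)%E.
Proof. by rewrite hmu.1 ltry. Qed.

Lemma measurable_normal i j : measurable_fun D (fun L : planes => N L i j).
Proof.
apply: (measurable_funS measurableT); first by [].
exact: (continuous_measurable_dplane (@continuous_normal_mx R n d i j)).
Qed.

Lemma normal_sym (L : planes) : D L -> (N L)^T = N L.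
Proof. by move=> _; exact: coproj_sym. Qed.

Lemma normal_idem (L : planes) : D L -> N L *m N L = N L.
Proof. by move=> _; apply: coproj_idem; have [] := frame_ofP (L : @dplane R n d). Qed.

Lemma normal_trace (L : planes) : D L -> \tr (N L) = p.+1%:R.
Proof.
move=> _; rewrite coproj_trace; last by have [] := frame_ofP (L : @dplane R n d).
by rewrite pE natrB // ltnW.
Qed.

Lemma ndE : n = (p + q).+2.
Proof. by have := ltn_ord d; move: pE qE; lia. Qed.

Lemma bm_moment a (z : E) : bounded_meas D (fun L : planes => qform (N L) z ^+ a).
Proof.
apply: bmX; apply: bm_qform; [exact: measurable_normal|exact: normal_sym|exact: normal_idem].
Qed.

(** A function of z obtained by averaging over the planes through the origin is
    rotation invariant, because the measure is. *)
Lemma moment_rotate a (Q : 'M[R]_n) (z : E) : Q *m Q^T = 1%:M -> \det Q = 1 ->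
  fint mu D (fun L => qform (N L) (z *m Q) ^+ a) = fint mu D (fun L => qform (N L) z ^+ a).
Proof.
move=> hQ dQ; have hQT : orthogonal_mx Q^T by rewrite /orthogonal_mx trmxK; exact: orthogonal_mxC.
pose rho := rotate_plane Q^T : planes -> planes.
have mrho : measurable_fun setT rho by exact: measurable_rotate_plane hQT.
have mD : measurable D by exact: measurable_planes_through0.
have rhoD : rho @^-1` D = D.
  apply/seteqP; split => L /=; rewrite /planes_through /= rotate_planeE //.
    move=> [y Ly /(congr1 (fun v => v *m Q))]; rewrite -mulmxA (orthogonal_mxC hQ) mulmx1 mul0mx => y0.
    by rewrite -y0.
  by move=> L0; exists 0 => //; rewrite mul0mx.
have Nrho L : qform (N L) (z *m Q) = qform (N (rho L)) z.
  rewrite normal_mx_rotate // trmxK /qform !dotpE trmx_mul !mulmxA.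
  by [].
have mg : measurable_fun D (fun L : planes => (qform (N L) z ^+ a)%:E).
  apply/measurable_EFinP.
  exact: (bm_moment a z).1.
have g0 L : (0 <= (qform (N L) z ^+ a)%:E)%E.
  have [fM _] := frame_ofP (L : @dplane R n d).
  by rewrite lee_fin exprn_ge0 // qform_coproj // sqnorm_ge0.
rewrite /fint /Rintegral; congr fine.
transitivity (\int[pushforward mu rho]_(L in D) (qform (N L) z ^+ a)%:E)%E.
  have := @ge0_integral_pushforward _ _ planes planes R rho mrho mu D _ mD mg (fun L _ => g0 L).
  move=> /esym; rewrite rhoD; apply: etrans.
  by apply: eq_integral => L _; rewrite /= Nrho.
apply: eq_measure_integral => A mA _.
exact: etrans (congr1 (mu : set (@dplane R n d) -> \bar R) (esym (rotate_setE A hQ))) (hmu.2 Q hQ dQ A mA).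
Qed.

Lemma plane_average (h : R -> R) (z : E) : continuous h ->
  fint mu D (fun L => h (qform (N L) z)) = (sin_cos_int p q)^-1 * radial_avg p q h (sqnorm z).
Proof.
move=> ch; have mD : measurable D by exact: measurable_planes_through0.
have muD := mu_planes_fin.
have n2 : (2 <= n)%N by rewrite ndE.
pose i0 : 'I_n := d.
pose m a := fint mu D (fun L => qform (N L) (delta_mx 0 i0) ^+ a).
have Hm a (w : E) : fint mu D (fun L => qform (N L) w ^+ a) = m a * sqnorm w ^+ a.
  apply: (@rotation_invariant_homogeneous R n i0 (fun w => fint mu D (fun L => qform (N L) w ^+ a)) a n2).
    move=> c v; rewrite -(fintZ mD muD).
      by apply: eq_fint => L _; rewrite qformZ exprMn -exprM.
    exact: (bm_moment a v).
  by move=> Q v hQ dQ; exact: moment_rotate.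
have m1 : fine (mu D) = 1 := congr1 fine hmu.1.
apply: etrans (projection_average mD muD ndE measurable_normal normal_sym normal_idem normal_trace Hm z ch) _.
by congr (_ * _); exact: (etrans (congr1 (fun t => t / sin_cos_int p q) m1) (div1r _)).
Qed.

(** A plane through y has distance to x given by the
    projection of x - y to the normal space, so the average over such planes is an
    average over random projections. *)
Lemma adjoint_plane_bump (l : R) (x y : E) :
  adjoint_transform mu (plane_bump l x) y =
  Complex ((sin_cos_int p q)^-1 * radial_avg p q bump (l^-1 * sqnorm (y - x))) 0.
Proof.
have mD : measurable D by exact: measurable_planes_through0.
rewrite /adjoint_transform /cintegral; congr Complex; last first.
  by have := fint_cst mu mD 0; rewrite mul0r.
have ch : continuous (fun t : R => bump (l^-1 * t)).
  by move=> t; apply: continuous_comp; [exact: mulrl_continuous|exact: continuous_bump].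
have := plane_average (x - y) ch.
rewrite -sqnormN opprB /radial_avg.
have -> : (fun t => bump (l^-1 * (sqnorm (y - x) * sin t ^+ 2)) * sin t ^+ p * cos t ^+ q) =
    (fun t => bump (l^-1 * sqnorm (y - x) * sin t ^+ 2) * sin t ^+ p * cos t ^+ q) :> (R -> R).
  by apply/funext => t; rewrite mulrA.
move=> <-; apply: eq_fint => L L0.
by rewrite /cRe /plane_bump /= dist2_translate.
Qed.

End PlaneAverage.

(** * Distributions *)

Section ComplexDistribution.
Context {R : realType} {m : nat}.
Notation E := 'rV[R]_m.+1.

Definition to_complex (phi : E -> R) : E -> R[i] := fun x => Complex (phi x) 0.

Lemma iter_derive_cst0 (vs : seq E) : iter_derive vs (fun=> 0 : R) = fun=> 0.
Proof. by elim: vs => //= v vs ->; apply/funext => x; exact: derive_cst. Qed.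

Lemma smooth_to_complex phi : smooth phi -> smooth_fun (to_complex phi).
Proof. by move=> sp; split; [exact: sp|exact: smooth_cst]. Qed.

Variable u : (E -> R[i]) -> R[i].
Hypothesis hu : compact_distribution u.

(** A complex linear form on smooth functions is determined by its values on real ones. *)
Lemma complex_split phi : smooth_fun phi ->
  u phi = Complex 0 1 * u (to_complex (cIm phi)) + u (to_complex (cRe phi)).
Proof.
move=> [s1 s2]; rewrite -hu.1; [|exact: smooth_to_complex..].
congr u; apply/funext => x; rewrite /to_complex /cIm /cRe; case: (phi x) => a b /=.
by apply/eqP; rewrite eq_complex /=; apply/andP; split; apply/eqP; rewrite /=; ring.
Qed.

Lemma complex_functional : exists r N C,
  functional (fun phi => complex.Re (u (to_complex phi))) r N C /\
  functional (fun phi => complex.Im (u (to_complex phi))) r N C.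
Proof.
have [lin [K [N [C [cK HK]]]]] := hu.
have [M [_ MP]] := compact_bounded cK.
exists (`|M| + 1), N, C.
have linR (c : R) phi psi : smooth phi -> smooth psi ->
    u (to_complex (fun x => c * phi x + psi x)) =
    Complex c 0 * u (to_complex phi) + u (to_complex psi).
  move=> s1 s2; rewrite -lin; [|exact: smooth_to_complex..].
  congr u; apply/funext => x; rewrite /to_complex.
  by apply/eqP; rewrite eq_complex /=; apply/andP; split; apply/eqP; rewrite /=; ring.
have bd phi (B : R) : smooth phi -> 0 <= B ->
     (forall (alpha : seq 'I_m.+1) (x : E), (size alpha <= N)%N -> `|x| <= `|M| + 1 ->
        `|partial alpha phi x| <= B) -> ComplexField.Normc.normc (u (to_complex phi)) <= C * B.
  move=> sp B0 H; apply: HK => // [|alpha x sa Kx]; first exact: smooth_to_complex.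
  split; first by apply: H => //; apply: MP => //; rewrite ltr_pwDr // ler_norm.
  by rewrite /partial (_ : cIm _ = fun=> 0) // iter_derive_cst0 normr0.
split; split.
- move=> c phi psi s1 s2; rewrite linR //.
  by case: (u (to_complex phi)) (u (to_complex psi)) => a b [a' b'] /=; ring.
- move=> phi B sp B0 H; apply: le_trans (bd phi B sp B0 H).
  by have [] := normc_ge_part (u (to_complex phi)).
- move=> c phi psi s1 s2; rewrite linR //.
  by case: (u (to_complex phi)) (u (to_complex psi)) => a b [a' b'] /=; ring.
- move=> phi B sp B0 H; apply: le_trans (bd phi B sp B0 H).
  by have [] := normc_ge_part (u (to_complex phi)).
Qed.

Lemma closed_sqnorm_ball (x0 : E) (r : R) : closed [set y : E | sqnorm (y - x0) <= r].
Proof.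
apply: (@closed_comp _ _ (fun y : E => sqnorm (y - x0)) [set t : R | t <= r]); last exact: closed_le.
move=> y _; apply: (@smooth_continuous R _ (fun y : E => sqnorm (y - x0))).
by apply/smoothP => k; exact: (Ck_sqnorm k x0 openT).
Qed.

Lemma compact_sqnorm_ball (x0 : E) (r : R) : compact [set y : E | sqnorm (y - x0) <= r].
Proof.
have sq1 (a c : R) : a ^+ 2 <= c -> `|a| <= 1 + c by rewrite ler_norml => H; apply/andP; split; nra.
apply: (@subclosed_compact _ _ _ (@closed_sqnorm_ball x0 r) (@compact_mx_box R 1 m.+1 (`|x0| + (1 + r)))).
move=> y /= yr i j; rewrite (ord1 i) (_ : y 0 j = x0 0 j + (y - x0) 0 j); last by rewrite !mxE; ring.
apply: le_trans (ler_normD _ _) _; apply: lerD; first exact: coord_le_norm.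
by apply: sq1; apply: le_trans yr; exact: coord_le_sqnorm.
Qed.

Lemma test_fun_to_complex (V : set E) (x0 : E) (r : R) phi : smooth phi ->
  (forall y, sqnorm (y - x0) <= r -> V y) ->
  (forall y, r <= sqnorm (y - x0) -> phi y = 0) -> test_fun V (to_complex phi).
Proof.
move=> sp HV H0.
have sub : csupport (to_complex phi) `<=` [set y : E | sqnorm (y - x0) <= r].
  rewrite ((closure_id _).1 (@closed_sqnorm_ball x0 r)); apply: closure_subset => y /=.
  by apply: contraNT; rewrite -ltNge => /ltW/H0 e; rewrite /to_complex e.
split; [exact: smooth_to_complex| |by move=> y /sub /HV].
exact: (@subclosed_compact _ _ _ (@closed_closure _ _) (@compact_sqnorm_ball x0 r) sub).
Qed.

End ComplexDistribution.

Section DistributionCase.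
Context {R : realType} {m : nat}.
Notation E := 'rV[R]_m.+2.

(** The real and imaginary parts of u on real functions are forms of compact support.
    They vanish on radial averages, because these are adjoint transforms of bumps
    of the distance to a point near x0, and those bumps are test functions on V. *)
Theorem distribution_case (d : 'I_m.+2) (V : set E) (x0 : E)
    (mu : probability (@borel_dplane R m.+2 d) R) (u : (E -> R[i]) -> R[i]) :
  open V -> V x0 -> odd d -> invariant_measure mu -> compact_distribution u ->
  (forall phi, test_fun V phi -> u phi = 0) ->
  (forall phi : @dplane R m.+2 d -> R[i], dplane_test_fun V phi -> dist_transform mu u phi = 0) ->
  forall phi, smooth_fun phi -> u phi = 0.
Proof.
move=> oV Vx0 od hmu hu H1 H2 phi sp.
have [e /= e0 He] : exists2 e : R, 0 < e & forall y, sqnorm (y - x0) < e -> V y.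
  have /nbhs_ballP[e /= e0 He] : nbhs x0 V by exact: open_nbhs_nbhs.
  exists (e ^+ 2) => [|y ye]; first exact: exprn_gt0.
  apply: He; rewrite -ball_normE /= distrC -ltr_sqr ?nnegrE ?(ltW e0) //.
  exact: le_lt_trans (norm_le_sqnorm _) ye.
pose q := (nat_of_ord d).-1; pose p := (m.+2 - d).-1.
have qE : q.+1 = d by rewrite prednK //; case: (nat_of_ord d) od.
have pE : p.+1 = (m.+2 - d)%N by rewrite prednK // subn_gt0.
have qev : ~~ odd q by move: od; rewrite -qE /=.
have r00 : 0 < e / 8 by rewrite divr_gt0.
have K0 : (sin_cos_int p q)^-1 != 0 :> R by rewrite invr_neq0 // gt_eqF // sin_cos_int_gt0.
have part (psi : E -> R) : smooth psi ->
    (forall y, e / 8 <= sqnorm (y - x0) -> psi y = 0) -> u (to_complex psi) = 0.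
  move=> s0 H; apply: H1; apply: (test_fun_to_complex s0 _ H) => y ye.
  by apply: He; move: ye r00; lra.
have avg (l : R) (x : E) : 0 < l -> l < e / 8 -> sqnorm (x - x0) < e / 8 ->
    u (to_complex (fun y => (sin_cos_int p q)^-1 * radial_avg p q bump (l^-1 * sqnorm (y - x)) + 0)) = 0.
  move=> l0 le xe; rewrite -(H2 (plane_bump l x)); last first.
    apply: plane_bump_test => // y yl; apply: He.
    have -> : y - x0 = (y - x) + (x - x0) by rewrite addrA subrK.
    by apply: le_lt_trans (sqnormD_le _ _) _; move: yl le xe r00; lra.
  by congr u; apply/funext => y; rewrite (adjoint_plane_bump hmu pE qE) /to_complex addr0.
have vanish (P : R[i] -> R) r N C : P 0 = 0 -> functional (fun psi => P (u (to_complex psi))) r N C ->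
    forall psi, smooth psi -> P (u (to_complex psi)) = 0.
  move=> P0 hL psi s0.
  apply: (@functional_eq0 R m _ r N C hL p q x0 (e / 8) (e / 8) qev r00 r00 _ _ psi s0) => [xi s1 Hxi|l x l0 le xe].
    by rewrite part.
  apply: (mulfI K0); rewrite mulr0; have := avg l x l0 le xe => /(congr1 P); rewrite P0.
  rewrite (hL.1 (sin_cos_int p q)^-1 _ (fun=> 0)); [|exact: smooth_radial|exact: smooth_cst].
  by rewrite (functional0 hL) addr0.
have [r [N [C [hR hI]]]] := complex_functional hu.
have vR := vanish _ _ _ _ (erefl : complex.Re (0 : R[i]) = 0) hR.
have vI := vanish _ _ _ _ (erefl : complex.Im (0 : R[i]) = 0) hI.
have z0 (psi : E -> R) : smooth psi -> u (to_complex psi) = 0.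
  move=> s0; have := vR psi s0; have := vI psi s0.
  by case: (u (to_complex psi)) => a b /= -> ->.
have [s1 s2] := sp.
by rewrite (complex_split hu sp) !z0 // mulr0 addr0.
Qed.

End DistributionCase.

Unset Implicit Arguments.
Set Strict Implicit.
Set Printing Implicit Defensive.

Theorem corollary1p4 (R : realType) (n : nat) (V : set 'rV[R]_n) (d : 'I_n)
    (hn : (2 <= n)%N) (hVo : open V) (hV0 : V !=set0)
    (hd0 : (0 < d)%N) (hd : odd d) :
  (forall f : 'rV[R]_n -> R[i], C_infty f ->
     (forall x, V x -> f x = 0) ->
     (forall A : dplane d, planes_meeting V A -> dplane_transform f A = 0) ->
     forall x, f x = 0) /\
  (forall mu : probability (borel_dplane d) R, invariant_measure mu ->
   forall u : ('rV[R]_n -> R[i]) -> R[i], compact_distribution u ->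
     (forall phi, test_fun V phi -> u phi = 0) ->
     (forall phi : dplane d -> R[i], dplane_test_fun V phi ->
        dist_transform mu u phi = 0) ->
     forall phi, smooth_fun phi -> u phi = 0).
Proof.
move: d hd0 hd; case: n hn V hVo hV0 => [|[|m]] // _ V oV [x0 Vx0] d d0 od; split.
  move=> f Cf f0 Hf x; have [rRe rIm] := C_infty_rapid Cf.
  have HA (A : dplane d) : planes_meeting V A ->
      (\int[@hausdorff_measure R m.+2 d]_(y in dplane_set A) cRe f y = 0 /\
       \int[@hausdorff_measure R m.+2 d]_(y in dplane_set A) cIm f y = 0)%R.
    by move=> mA; have := Hf A mA; rewrite /dplane_transform /cintegral => -[-> ->].
  have zRe : cRe f x = 0.
    apply: (@function_case R m.+2 d V x0 _ oV Vx0 od rRe) => [y Vy|A mA].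
      by rewrite /cRe f0.
    exact: (HA A mA).1.
  have zIm : cIm f x = 0.
    apply: (@function_case R m.+2 d V x0 _ oV Vx0 od rIm) => [y Vy|A mA].
      by rewrite /cIm f0.
    exact: (HA A mA).2.
  by move: zRe zIm; rewrite /cRe /cIm; case: (f x) => a b /= -> ->.
move=> mu hmu u hu H1 H2; exact: (@distribution_case R m d V x0 mu u oV Vx0 od hmu hu H1 H2).
Qed.
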